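(* Let $d\ge 2$ and $1\le p\le\infty$. If $\alpha>1$ and $\gamma>\frac{\gamma_{\alpha,p}}{2}$, then there is a constant $C>0$ (depending on $d,\alpha,p,\gamma$ only) such that \[ \|e^{-it|D|^{\alpha}}f\|_{L^{2p}([0,1];L^{\infty}(\mathbb{T}^d))}\le C\|f\|_{H^{\gamma}(\mathbb{T}^d)}\quad\text{for all } f\in H^\gamma(\mathbb{T}^d). \] Similarly, if $0<\alpha<1$ and $\gamma>\frac{\ell_{\alpha,p}}{2}$, the same estimate holds.
   Context: $\mathbb{T}^d=(\mathbb{R}/2\pi\mathbb{Z})^d$. For $f$ on $\mathbb{T}^d$ with Fourier coefficients $\widehat f(k)$, $k\in\mathbb{Z}^d$, $|D|^\alpha=(\sqrt{-\Delta})^\alpha$ is the Fourier multiplier $|k|^\alpha$, and $e^{-it|D|^\alpha}f(x)=\sum_{k\in\mathbb{Z}^d}e^{i(k\cdot x-|k|^\alpha t)}\widehat f(k)$. $\|f\|_{H^\gamma(\mathbb{T}^d)}^2\sim\sum_k(1+|k|^2)^\gamma|\widehat f(k)|^2$. The parameters are: for $\alpha>1$, $\gamma_{\alpha,p}=\frac{d\alpha}{2}$ if $\alpha\ge2$ or if ($1<\alpha<2$ and $\frac{2\alpha}{2-\alpha}\ge pd$), and $\gamma_{\alpha,p}=d-\frac{\alpha}{p}$ if $1<\alpha<2$ and $\frac{2\alpha}{2-\alpha}<pd$; for $0<\alpha<1$, $\ell_{\alpha,p}=d-\frac{\alpha}{p}$ (with $\alpha/p=0$ when $p=\infty$). *)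

(* Defs.v *)
From HB Require Import structures.
From mathcomp Require Import all_boot all_order all_algebra.
From mathcomp Require Import all_classical all_reals all_analysis.
Set Implicit Arguments. Unset Strict Implicit. Unset Printing Implicit Defensive.
Import Order.TTheory GRing.Theory Num.Theory.
Import numFieldNormedType.Exports.
Local Open Scope classical_set_scope.
Local Open Scope ring_scope.

(* Conventions.
   - T^d is represented by the fundamental domain [0, 2 pi]^d, points being
     d-tuples of reals (with the product Borel sigma-algebra on tuples), and
     carrying the d-fold product of Lebesgue measure, realized through
     iterated one-dimensional Lebesgue integrals / almost-everywhere
     statements (Fubini-Tonelli).
   - Complex numbers are represented by (real part, imaginary part).
   - f in H^gamma(T^d) is given by its Fourier coefficients
     hat f(k) = cr k + i ci k, k in Z^d (= d.-tuple int). *)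

Section Defs.
Variable R : realType.

Definition dotk (d : nat) (k : d.-tuple int) (x : d.-tuple R) : R :=
  \sum_(i < d) (tnth k i)%:~R * tnth x i.

Definition normk2 (d : nat) (k : d.-tuple int) : R :=
  \sum_(i < d) ((tnth k i)%:~R) ^+ 2.

Definition normk (d : nat) (k : d.-tuple int) : R := Num.sqrt (normk2 k).

Definition cmod (a b : R) : R := Num.sqrt (a ^+ 2 + b ^+ 2).

Definition torus_itv : set R := `[0, 2 * pi]%classic.

Fixpoint torus_int_nneg (n : nat) : (n.-tuple R -> \bar R) -> \bar R :=
  match n return (n.-tuple R -> \bar R) -> \bar R with
  | 0 => fun f => f [tuple]
  | n'.+1 => fun f =>
      (\int[@lebesgue_measure R]_(x in torus_itv)
         torus_int_nneg (fun y : n'.-tuple R => f (cons_tuple x y)))%E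
  end.

Fixpoint torus_Rint (n : nat) : (n.-tuple R -> R) -> R :=
  match n return (n.-tuple R -> R) -> R with
  | 0 => fun f => f [tuple]
  | n'.+1 => fun f =>
      Rintegral (@lebesgue_measure R) torus_itv
        (fun x => torus_Rint (fun y : n'.-tuple R => f (cons_tuple x y)))
  end.

Fixpoint torus_ae (n : nat) : (n.-tuple R -> Prop) -> Prop :=
  match n return (n.-tuple R -> Prop) -> Prop with
  | 0 => fun P => P [tuple]
  | n'.+1 => fun P =>
      {ae @lebesgue_measure R, forall x, torus_itv x ->
         torus_ae (fun y : n'.-tuple R => P (cons_tuple x y))}
  end.

Definition torus_esssup (d : nat) (g : d.-tuple R -> R) : \bar R :=
  ereal_inf [set M : \bar R | torus_ae (fun x => ((g x)%:E <= M)%E)].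

Definition Hnorm2 (d : nat) (gamma : R) (cr ci : d.-tuple int -> R) : \bar R :=
  \esum_(k in [set: d.-tuple int])
     ((1 + normk2 k) `^ gamma * (cr k ^+ 2 + ci k ^+ 2))%:E.

Definition Hnorm (d : nat) (gamma : R) (cr ci : d.-tuple int -> R) : R :=
  Num.sqrt (fine (Hnorm2 gamma cr ci)).

(* u = ur + i ui : R -> T^d -> C is (a representative of)
   e^{-it|D|^alpha} f for every t in [0,1]: for each such t, u(t,.) is a
   measurable integrable function on T^d whose Fourier coefficients are
   e^{-i|k|^alpha t} hat f(k), i.e.
   (2pi)^{-d} int_{T^d} u(t,x) e^{-ik.x} dx = e^{-i|k|^alpha t} hat f(k). *)
Definition is_propagator (d : nat) (alpha : R) (cr ci : d.-tuple int -> R)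
  (ur ui : R -> d.-tuple R -> R) : Prop :=
  forall t : R, 0 <= t <= 1 ->
    [/\ measurable_fun [set: d.-tuple R] (ur t),
        measurable_fun [set: d.-tuple R] (ui t),
        (torus_int_nneg (fun x => (cmod (ur t x) (ui t x))%:E) < +oo)%E &
        forall k : d.-tuple int,
          let phi := normk k `^ alpha * t in
          (2 * pi) ^- d *
            torus_Rint (fun x => ur t x * cos (dotk k x) + ui t x * sin (dotk k x))
            = cr k * cos phi + ci k * sin phi
          /\
          (2 * pi) ^- d *
            torus_Rint (fun x => ui t x * cos (dotk k x) - ur t x * sin (dotk k x))
            = ci k * cos phi - cr k * sin phi].

Definition div_p (alpha : R) (p : \bar R) : R :=
  match p with r%:E => alpha / r | _ => 0 end.

Definition gamma_ap (d : nat) (alpha : R) (p : \bar R) : R :=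
  if (2 <= alpha) ||
     ((1 < alpha < 2) && ((p * (d%:R)%:E <= (2 * alpha / (2 - alpha))%:E)%E))
  then d%:R * alpha / 2
  else d%:R - div_p alpha p.

Definition ell_ap (d : nat) (alpha : R) (p : \bar R) : R := d%:R - div_p alpha p.

Definition mu01 := mrestr (@lebesgue_measure R) (@measurable_itv R `[0, 1]).

End Defs.

(* Main.v *)
Require Import Defs.
From HB Require Import structures.
From mathcomp Require Import all_boot all_order all_algebra.
From mathcomp Require Import all_classical all_reals all_analysis.
From mathcomp Require Import measurable_realfun ess_sup_inf ring lra zify.
From mathcomp Require complex.
Import Order.TTheory GRing.Theory Num.Theory.
Import numFieldNormedType.Exports.
Local Open Scope classical_set_scope.
Local Open Scope ring_scope.
Set Implicit Arguments. Unset Strict Implicit. Unset Printing Implicit Defensive.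

(* Let S be the sum of cos (k.x - |k|^alpha t + beta) over a dyadic shell
   |k| ~ N. If alpha < 2, cut the shell into cubes of side L with L <= c N and
   L^2 <= N^(2 - alpha) / t. On a cube the phase is linear up to a bounded
   perturbation that is a convergent power series in the coordinates, so the sum
   over the cube is at most a product of one-dimensional geometric sums centred
   at the gradient of t |k|^alpha. The gradients of different cubes are separated
   by c / L, hence the geometric sums add up to
   S <= C (log N)^d (N^(d - alpha theta) t^-theta + N^(d alpha / 2))
   for 0 <= theta <= 1. Weighting the shells by N^(-2 gamma) gives a kernel
   bounded by C t^-theta with theta p < 1; if alpha >= 2 then 2 gamma > d and
   the kernel is bounded by counting. A duality argument and Young's inequality
   at the times r / m, with m large, then bound the time-L^(2p) norm of the
   supremum in x of every partial sum over the cube [-2^J, 2^J)^d.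
   The Fejer means of u(t) are averages of partial sums against a nonnegative
   kernel, and Lebesgue differentiation, one coordinate at a time, bounds |u(t)|
   almost everywhere by any bound on the Fejer means. So the essential supremum
   of u(t) is at most the lower limit in J of the suprema of the partial sums,
   and Fatou's lemma concludes. *)

(** * Trigonometric and logarithmic estimates *)

(** The Taylor remainder of the phase on a box is bounded but not small, and it must be removed
    without losing the cancellation in any coordinate. Monomials in [s / L] are monotone in each
    coordinate, so Abel summation passes them through a geometric sum at a uniform cost; the norm
    [dom] extends this cost to convergent power series in them. The two terms of the shell bound
    come from wrapping: gradients of size V cover about 1 + V periods of the geometric sums in each
    coordinate. The separation of the gradients carries the factor |alpha - 1|, hence [alpha != 1].
    Mostly a free phase [beta] replaces complex numbers: a modulus is the supremum of real parts
    over [beta], and this supremum is linearized together with the one over x. The propagator is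
    known only through its Fourier coefficients, and its supremum may fail to be measurable in time.
    Fejer means depend on the coefficients alone; the suprema of partial sums are dominated by step
    functions in time. The number of steps depends on the data, the constant does not. *)

Lemma mvt_dist (R : realType) (f df : R -> R) (a b K : R) : a <= b ->
  (forall x, a <= x <= b -> is_derive x 1 f (df x)) ->
  (forall x, a <= x <= b -> `|df x| <= K) ->
  `|f b - f a| <= K * (b - a).
Proof.
move=> ab fd dK.
have [x||c cab ->] := @MVT_segment R f df a b ab.
- by rewrite in_itv /= => /andP[ax xb]; apply: fd; rewrite !ltW.
- by apply: derivable_within_continuous => x; rewrite in_itv /= => /fd [].
rewrite normrM (ger0_norm (_ : 0 <= b - a)) ?subr_ge0//.
by apply: ler_wpM2r; [rewrite subr_ge0|apply: dK; rewrite in_itv in cab].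
Qed.

Lemma sin_lip (R : realType) (x y : R) : `|sin x - sin y| <= `|x - y|.
Proof.
wlog yx : x y / y <= x.
  by move=> H; case: (leP y x) => [/H//|/ltW/H]; rewrite distrC (distrC y).
rewrite (ger0_norm (_ : 0 <= x - y)) ?subr_ge0// -[leRHS]mul1r.
apply: (@mvt_dist _ _ cos) => // z _; exact: cos_max.
Qed.

Lemma cos_lip (R : realType) (x y : R) : `|cos x - cos y| <= `|x - y|.
Proof.
wlog yx : x y / y <= x.
  by move=> H; case: (leP y x) => [/H//|/ltW/H]; rewrite distrC (distrC y).
rewrite (ger0_norm (_ : 0 <= x - y)) ?subr_ge0// -[leRHS]mul1r.
apply: (@mvt_dist _ _ (- sin)) => // z _; rewrite normrN; exact: sin_max.
Qed.

(** Halve the angle: sin x = 2 cos (x/2) sin (x/2), and cos (x/2) is at least 1/2 because 2 cos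
    (x/2)^2 - 1 = cos x is nonnegative. *)
Lemma sin_ge_quarter (R : realType) (x : R) : 0 <= x <= pi / 2 -> x / 4 <= sin x.
Proof.
move=> /andP[x0 xpi].
have pi2 : pi / 2 < 2 :> R := pihalf_lt2 R.
have c0 : 1/2 <= cos (x / 2).
  have cx0 : 0 <= cos (x/2) by apply: cos_ge0_pihalf; lra.
  have c2 : cos x = cos (x/2) ^+2 *+ 2 - 1.
    by rewrite -cos_mulr2n mulr2n; congr cos; lra.
  have cx : 0 <= cos x by apply: cos_ge0_pihalf; lra.
  move: cx; rewrite c2 mulr2n => H.
  rewrite leNgt; apply/negP => h.
  have : cos (x/2) ^+ 2 < 1/2 * (1/2).
    by rewrite expr2; apply: ltr_pM.
  by move: H; lra.
have -> : sin x = 2 * (cos (x/2) * sin (x/2)).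
  by rewrite mulrC mulr_natr -sin_mulr2n mulr2n; congr sin; lra.
have s0 : x / 4 <= sin (x/2).
  (* on [0, x/2] the derivative cos is at least 1/2 *)
  have [||c cI] := @MVT_segment R sin cos 0 (x/2); [lra|exact/continuous_subspaceT/continuous_sin|].
  rewrite sin0 !subr0 => ->.
  have : cos (x/2) <= cos c.
    move: cI; rewrite in_itv /= => /andP[c0' cx].
    move: cx; rewrite le_eqVlt => /orP[/eqP->//|cx].
    by rewrite ltW// ltr_cos// in_itv /=; lra.
  move=> H; have : 1/2 <= cos c by lra.
  move=> H2; have H3 : 1/2 * (x/2) <= cos c * (x/2) by apply: ler_wpM2r => //; lra.
  by lra.
have : 1/2 * (x/4) <= cos (x/2) * sin (x/2) by apply: ler_pM; lra.
by lra.
Qed.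

(* [ln (1 + w)] is approximated by its Taylor polynomials since the derivative
   of the difference is [(- w)^n / (1 + w)]. *)
Lemma cvg_ln1D_series (R : realType) (w : R) : `|w| <= 1/2 ->
  (fun n => \sum_(0 <= m < n) (-1) ^+ m / m.+1%:R * w ^+ m.+1) @ \oo --> ln (1 + w).
Proof.
move=> w2.
pose P n (x : R) : R := \sum_(0 <= m < n) (-1) ^+ m / m.+1%:R * x ^+ m.+1.
pose dP n (x : R) : R := \sum_(0 <= m < n) (- x) ^+ m.
have dPE n (x : R) : is_derive x 1 (P n) (dP n x).
  rewrite /P /dP; elim: n => [|n IH].
    under eq_fun do rewrite big_geq//.
    rewrite big_geq//.
    exact: is_derive_cst.
  under eq_fun do rewrite big_nat_recr//=.
  rewrite big_nat_recr//=.
  apply: is_deriveD => //.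
  have -> : (- x) ^+ n = (-1) ^+ n / n.+1%:R * (n.+1%:R * x ^+ n).
    by rewrite mulrA mulfVK ?pnatr_eq0// -exprMn mulN1r.
  apply: is_deriveZ.
  rewrite (_ : (fun y : R => y ^+ n.+1) = (@id R) ^+ n.+1); last by rewrite exprfctE.
  have := @is_deriveX _ _ (@id R) n.+1 x 1 1 (is_derive_id _ _).
  by rewrite /GRing.scale /= mulr1.
have sdP n (x : R) : `|x| <= 1/2 -> (1 + x)^-1 - dP n x = (- x) ^+ n / (1 + x).
  move=> x2.
  have x1 : 1 + x != 0 by move: x2; rewrite ler_norml; lra.
  apply: (mulIf x1); rewrite mulrBl mulVf// divfK// /dP.
  elim: n => [|n IH]; first by rewrite big_geq// mul0r expr0 subr0.
  by rewrite big_nat_recr//= mulrDl opprD addrA IH exprS; ring.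
have key n : `|ln (1 + w) - P n w| <= 2 * (1/2) ^+ n.
  pose f (x : R) := ln (1 + x) - P n x.
  have fd (x : R) : `|x| <= 1/2 -> is_derive x 1 f ((1 + x)^-1 - dP n x).
    move=> x2; apply: is_deriveB.
    have x1 : 0 < 1 + x by move: x2; rewrite ler_norml; lra.
    have h1 := @is_derive1_ln R (1 + x) x1.
    have h2 : is_derive x 1 (fun y : R => 1 + y) 1.
      have := @is_deriveD R R^o R^o (cst (1 : R)) id x 1 0 1 (is_derive_cst _ _ _) (is_derive_id _ _).
      by rewrite add0r.
    have := @is_derive1_comp R (@ln R) (fun y => 1 + y) x (1 + x)^-1 1 h1 h2.
    by rewrite mulr1.
  have bnd (x : R) : `|x| <= 1/2 -> `|(1 + x)^-1 - dP n x| <= 2 * (1/2) ^+ n.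
    move=> x2; rewrite sdP// normrM normrX normrN mulrC.
    have x1 : 1/2 <= 1 + x by move: x2; rewrite ler_norml; lra.
    rewrite normfV (ger0_norm (_ : 0 <= 1 + x)); last lra.
    apply: ler_pM; rewrite ?invr_ge0 ?exprn_ge0//; first lra.
      by rewrite -[leRHS]invrK lef_pV2// ?posrE; lra.
    by apply: lerXn2r; rewrite ?nnegrE.
  have f0 : f 0 = 0.
    rewrite /f addr0 ln1 /P big1 ?subr0// => i _.
    by rewrite expr0n /= mulr0.
  have K0 : 0 <= 2 * (1/2) ^+ n :> R by rewrite mulr_ge0// exprn_ge0//; lra.
  have : `|f w| <= 2 * (1/2) ^+ n * `|w|.
    case: (leP 0 w) => w0.
      have := @mvt_dist R f (fun x => (1 + x)^-1 - dP n x) 0 w _ w0.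
      rewrite f0 !subr0 (ger0_norm w0); apply => x /andP[x0 xw].
        by apply: fd; rewrite ger0_norm// (le_trans xw)// -(ger0_norm w0).
      by apply: bnd; rewrite ger0_norm// (le_trans xw)// -(ger0_norm w0).
    have := @mvt_dist R f (fun x => (1 + x)^-1 - dP n x) w 0 _ (ltW w0).
    rewrite f0 !sub0r normrN (ltr0_norm w0); apply => x /andP[xw x0].
      by apply: fd; rewrite ler0_norm// (le_trans _ w2)// (ltr0_norm w0) lerN2.
    by apply: bnd; rewrite ler0_norm// (le_trans _ w2)// (ltr0_norm w0) lerN2.
  move/le_trans; apply.
  rewrite -[leRHS]mulr1; apply: ler_wpM2l => //; lra.
apply/cvgrPdist_le => e e0.
have := @cvg_geometric R 2 (1/2).
rewrite (_ : `|1/2| < 1 :> R); last by rewrite ger0_norm; lra.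
move=> /(_ isT) /cvgrPdist_le /(_ _ e0); apply: filterS => n.
rewrite sub0r normrN /geometric /= => h.
apply: le_trans (key n) _; apply: le_trans h.
by rewrite ler_norm.
Qed.

(** Each dyadic block contributes at most 1. This is the source of the logarithms. *)
Lemma harmonic_le (R : realType) (m : nat) :
  \sum_(c < 2 ^ m) (c.+1%:R : R)^-1 <= m%:R + 1.
Proof.
elim: m => [|m IH]; first by rewrite expn0 big_ord1 invr1 add0r.
have -> : (2 ^ m.+1 = 2 ^ m + 2 ^ m)%N by rewrite expnS mul2n addnn.
rewrite big_split_ord /= -[m.+1]addn1 natrD.
have : \sum_(i < 2 ^ m) (((2 ^ m + i).+1)%:R : R)^-1 <= \sum_(i < 2 ^ m) ((2 ^ m)%:R)^-1.
  apply: ler_sum => i _; rewrite lef_pV2 ?posrE ?ltr0n ?expn_gt0// ler_nat.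
  by rewrite -addnS leq_addr.
rewrite sumr_const card_ord -(mulr_natr (_^-1)) mulVf; last by rewrite pnatr_eq0 -lt0n expn_gt0.
by move: IH; lra.
Qed.

(* Abel summation against a monotone weight with values in [0, 1]. *)
Lemma abel_sum_bound (R : realType) (n : nat) (a b : nat -> R) (B : R) :
  (forall m, (m <= n)%N -> `|\sum_(0 <= i < m) a i| <= B) ->
  (forall i, (i < n)%N -> b i <= b i.+1) -> (forall i, (i <= n)%N -> 0 <= b i <= 1) ->
  `|\sum_(0 <= i < n) a i * b i| <= 2 * B.
Proof.
move=> aB bmon b01.
pose A m := \sum_(0 <= i < m) a i.
have B0 : 0 <= B by apply: le_trans (aB 0%N (leq0n _)).
have -> : \sum_(0 <= i < n) a i * b i = A n * b n - \sum_(0 <= i < n) A i.+1 * (b i.+1 - b i).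
  clear; elim: n => [|n IH]; first by rewrite /A !big_geq// mul0r subr0.
  rewrite !big_nat_recr//= IH /A !big_nat_recr//=; ring.
apply: le_trans (ler_normB _ _) _.
have -> : 2 * B = B * 1 + B * 1 by ring.
apply: lerD.
  rewrite normrM; apply: ler_pM => //; first exact: aB.
  by have /andP[? ?] := b01 n (leqnn _); rewrite ger0_norm.
apply: le_trans (ler_norm_sum _ _ _) _.
apply: (@le_trans _ _ (\sum_(0 <= i < n) B * (b i.+1 - b i))).
  apply: ler_sum_nat => i /andP[_ iltn]; rewrite normrM.
  rewrite (ger0_norm (_ : 0 <= b i.+1 - b i)); last by rewrite subr_ge0 bmon.
  by apply: ler_wpM2r; [rewrite subr_ge0 bmon|exact: aB].
rewrite -mulr_sumr telescope_sumr//; apply: ler_wpM2l => //.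
by have := b01 n (leqnn _); have := b01 0%N (leq0n _); lra.
Qed.

(** * Absolutely convex majorization *)

Lemma cvg_fsum (R : realType) (I : Type) (r : seq I) (f : I -> nat -> R) (l : I -> R) :
  (forall i, f i n @[n --> \oo] --> l i) ->
  \sum_(i <- r) f i n @[n --> \oo] --> \sum_(i <- r) l i.
Proof.
move=> fl; elim: r => [|i r IH].
  by under eq_fun do rewrite big_nil; rewrite big_nil; exact: cvg_cst.
by under eq_fun do rewrite big_cons; rewrite big_cons; exact: cvgD.
Qed.

(* [dom E C b] holds when [b] lies in [C] times the closed absolutely convex
   hull of [E], expressed by duality.  When [E] is closed under products these
   are the balls of a Banach algebra norm. *)
Definition dom (R : realType) (X : finType) (E : (X -> R) -> Prop) (C : R) (b : X -> R) :=
  0 <= C /\ forall (mu : X -> R) (S : R),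
    (forall e, E e -> `|\sum_x mu x * e x| <= S) -> `|\sum_x mu x * b x| <= C * S.

Section Dom.
Context (R : realType) (X : finType) (E : (X -> R) -> Prop).
Hypothesis E1 : E (fun=> 1).
Hypothesis EM : forall e f, E e -> E f -> E (fun x => e x * f x).
Notation dom := (dom E).

Lemma dom_ge0 C b : dom C b -> 0 <= C. Proof. by case. Qed.

Lemma dom_ext C b b' : b =1 b' -> dom C b -> dom C b'.
Proof. by move=> /funext ->. Qed.

Lemma dom_base e : E e -> dom 1 e.
Proof. by move=> Ee; split => // mu S /(_ _ Ee); rewrite mul1r. Qed.

Lemma dom_test_ge0 (mu : X -> R) S : (forall e, E e -> `|\sum_x mu x * e x| <= S) -> 0 <= S.
Proof. by move=> /(_ _ E1); apply: le_trans. Qed.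

Lemma dom_le C C' b : C <= C' -> dom C b -> dom C' b.
Proof.
move=> CC' [C0 H]; split; first exact: le_trans CC'.
move=> mu S HS; apply: le_trans (H _ _ HS) _.
by apply: ler_wpM2r => //; apply: dom_test_ge0 HS.
Qed.

Lemma dom_add C C' b b' : dom C b -> dom C' b' -> dom (C + C') (fun x => b x + b' x).
Proof.
move=> [C0 H] [C0' H']; split; first exact: addr_ge0.
move=> mu S HS; under eq_bigr do rewrite mulrDr; rewrite big_split /=.
by apply: le_trans (ler_normD _ _) _; rewrite mulrDl lerD ?H ?H'.
Qed.

Lemma dom_scale a C b : dom C b -> dom (`|a| * C) (fun x => a * b x).
Proof.
move=> [C0 H]; split; first exact: mulr_ge0.
move=> mu S HS; under eq_bigr do rewrite mulrCA; rewrite -mulr_sumr normrM -mulrA.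
by apply: ler_wpM2l => //; exact: H.
Qed.

Lemma dom_cst a : dom `|a| (fun=> a).
Proof.
have := dom_scale a (dom_base E1); rewrite mulr1; apply: dom_ext => x; exact: mulr1.
Qed.

(** Two tests in turn: for a generator e the functional mu e is again of size S, as E is closed
    under products; hence mu b is a functional of size C S, to which b' is applied. *)
Lemma dom_mul C C' b b' : dom C b -> dom C' b' -> dom (C * C') (fun x => b x * b' x).
Proof.
move=> [C0 H] [C0' H']; split; first exact: mulr_ge0.
move=> mu S HS; under eq_bigr do rewrite mulrA.
rewrite (mulrC C C') -mulrA; apply: (le_trans (H' (fun x => mu x * b x) (C * S) _)); last by [].
move=> e Ee; under eq_bigr do rewrite mulrAC.
apply: H => f Ef; under eq_bigr do rewrite -mulrA.
exact: HS (EM Ee Ef).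
Qed.

Lemma dom_exp C b n : dom C b -> dom (C ^+ n) (fun x => b x ^+ n).
Proof.
move=> H; elim: n => [|n IH]; first by rewrite expr0; apply: dom_base.
by rewrite exprS; apply: (dom_ext (fun x => esym (exprS _ _))); apply: dom_mul.
Qed.

Lemma dom_sum (I : Type) (r : seq I) (C : I -> R) (b : I -> X -> R) :
  (forall i, dom (C i) (b i)) -> dom (\sum_(i <- r) C i) (fun x => \sum_(i <- r) b i x).
Proof.
move=> H; elim: r => [|i r IH].
  rewrite big_nil; apply: (@dom_ext _ (fun=> 0)); last by have := dom_cst 0; rewrite normr0.
  by move=> x; rewrite big_nil.
rewrite big_cons; apply: (@dom_ext _ (fun x => b i x + \sum_(i <- r) b i x)).
  by move=> x; rewrite big_cons.
exact: dom_add.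
Qed.

(** [X] is finite, so each inequality of the dual description passes to pointwise limits. *)
Lemma dom_lim C (b : nat -> X -> R) b' : (forall n, dom C (b n)) ->
  (forall x, b n x @[n --> \oo] --> b' x) -> dom C b'.
Proof.
move=> H cb; split; first by have [] := H 0%N.
move=> mu S HS.
have cv : \sum_x mu x * b n x @[n --> \oo] --> \sum_x mu x * b' x.
  by apply: cvg_fsum => x; apply: cvgMr; exact: cb.
have cv2 : `|\sum_x mu x * b n x| @[n --> \oo] --> `|\sum_x mu x * b' x|.
  by apply: cvg_norm; exact: cv.
rewrite -(cvg_lim (@Rhausdorff R) cv2).
apply: limr_le; first by apply/cvg_ex; exists (`|\sum_x mu x * b' x|).
by apply: nearW => n; have [_] := H n; apply.
Qed.

(** The norm of a power series is at most the series of the absolute values of its terms. *)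
Lemma dom_series C D b (c : nat -> R) f : dom C b ->
  (forall x, \sum_(0 <= m < n) c m * b x ^+ m @[n --> \oo] --> f x) ->
  (forall n, \sum_(0 <= m < n) `|c m| * C ^+ m <= D) -> dom D f.
Proof.
move=> H cf HD.
apply: (dom_lim _ cf) => n; apply: dom_le (HD n) _.
by apply: dom_sum => m; apply: dom_scale; exact: dom_exp.
Qed.


Lemma dom_fact_series C b (c : nat -> R) f : dom C b ->
  (forall m, `|c m| <= (m`!%:R)^-1) ->
  (forall x, \sum_(0 <= m < n) c m * b x ^+ m @[n --> \oo] --> f x) ->
  dom (expR C) f.
Proof.
move=> H cle cf; have C0 := dom_ge0 H.
apply: (dom_series H cf) => n.
apply: (@le_trans _ _ (series (exp_coeff C) n)).
  rewrite /series /=; apply: ler_sum => i _; rewrite /exp_coeff mulrC.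
  by apply: ler_wpM2l; first exact: exprn_ge0.
rewrite /expR; apply: nondecreasing_cvgn_le; last exact: is_cvg_series_exp_coeff.
apply: nondecreasing_series => i _ _; exact: exp_coeff_ge0.
Qed.

Lemma dom_cos C b : dom C b -> dom (expR C) (fun x => cos (b x)).
Proof.
pose c n : R := (~~ odd n)%:R * (-1) ^+ n./2 / n`!%:R.
move=> H; apply: (dom_fact_series (c := c) H) => [m|x].
  rewrite /c normrM normfV normr_nat ler_piMl ?invr_ge0//.
  by rewrite normrM normrX normrN1 expr1n mulr1 normr_nat; case: odd.
have := @is_cvg_series_cos_coeff R (b x); rewrite cos.unlock /series /= cos_coeffE.
exact.
Qed.

Lemma dom_sin C b : dom C b -> dom (expR C) (fun x => sin (b x)).
Proof.
pose c n : R := (odd n)%:R * (-1) ^+ n.-1./2 / n`!%:R.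
move=> H; apply: (dom_fact_series (c := c) H) => [m|x].
  rewrite /c normrM normfV normr_nat ler_piMl ?invr_ge0//.
  by rewrite normrM normrX normrN1 expr1n mulr1 normr_nat; case: odd.
have := @is_cvg_series_sin_coeff R (b x); rewrite sin.unlock /series /= sin_coeffE.
exact.
Qed.

Lemma fact_ge_exp2 n : (2 ^ n.+1 <= n.+2`!)%N.
Proof. by elim: n => // n IH; rewrite factS expnS leq_mul. Qed.

(** The coefficients 1/m! with m >= 2 add up to at most 1, because m! >= 2^(m-1), and C^m <= C^2. *)
Lemma dom_expR2 C b : dom C b -> C <= 1 -> dom (C ^+ 2) (fun x => expR (b x) - 1 - b x).
Proof.
move=> H C1; have C0 := dom_ge0 H.
pose c n : R := (1 < n)%N%:R * (n`!%:R)^-1.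
have c0 n : 0 <= c n by rewrite mulr_ge0// invr_ge0.
apply: (dom_series (c := c) H) => [x|n].
  have lim2 : (fun n => series (exp_coeff (b x)) n - (1 + b x)) @ \oo --> expR (b x) - 1 - b x.
    rewrite -addrA -opprD; apply: cvgB; last exact: cvg_cst.
    exact: is_cvg_series_exp_coeff.
  apply: cvg_trans lim2; apply: near_eq_cvg.
  near=> n.
  have n2 : (2 <= n)%N by near: n; exact: nbhs_infty_ge.
  rewrite -(subnK n2) addn2 /= /series /= !big_nat_recl//= /c /exp_coeff /=.
  rewrite !mul0r !add0r expr0 expr1 fact0 !divr1.
  rewrite [LHS](addrC _ (- _)) [X in - _ + X]addrA addKr.
  by apply: eq_bigr => i _; rewrite mul1r mulrC.
apply: (@le_trans _ _ (\sum_(0 <= m < n) c m * C ^+ 2)).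
  apply: ler_sum => i _; rewrite ger0_norm//; case: i => [|[|i]]; rewrite ?{1 2}/c /= ?mul0r//.
  apply: ler_wpM2l => //; exact: ler_wiXn2l.
rewrite -mulr_suml ler_piMl ?exprn_ge0//.
suff : \sum_(0 <= m < n.+2) c m <= 1 - (1/2) ^+ n.
  move=> h; apply: (@le_trans _ _ (\sum_(0 <= m < n.+2) c m)).
    by rewrite !big_nat_recr//= -addrA lerDl addr_ge0.
  by apply: le_trans h _; rewrite gerBl exprn_ge0//; lra.
elim: n => [|n IH].
  by rewrite !big_nat_recr//= big_geq// /c /= !mul0r !addr0 expr0 subrr.
rewrite big_nat_recr//=.
have : c n.+2 <= (1/2) ^+ n.+1.
  rewrite /c mul1r div1r exprVn -natrX lef_pV2 ?posrE ?ltr0n ?fact_gt0 ?expn_gt0//.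
  by rewrite ler_nat fact_ge_exp2.
by rewrite exprS; move: IH; set u := (_ / _) ^+ n; lra.
Unshelve. all: by end_near.
Qed.

Section Log.
Hypothesis EB : forall e x, E e -> `|e x| <= 1.

(** Test against a point mass. The bound puts the values of [b] where the logarithmic series is
    available. *)
Lemma dom_norm C b x : dom C b -> `|b x| <= C.
Proof.
move=> [C0 H].
have delta f : \sum_y (y == x)%:R * f y = f x.
  rewrite (bigD1 x)//= eqxx mul1r big1 ?addr0// => y /negPf ->; exact: mul0r.
have := H (fun y => (y == x)%:R) 1; rewrite delta mulr1; apply => e Ee.
by rewrite delta; exact: EB.
Qed.

Lemma geometric_half_le n : \sum_(0 <= m < n) (1/2) ^+ m <= 2 :> R.
Proof.
suff -> : \sum_(0 <= m < n) (1/2) ^+ m = 2 - 2 * (1/2) ^+ n :> R.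
  by rewrite gerBl mulr_ge0// exprn_ge0//; lra.
elim: n => [|n IH]; first by rewrite big_geq// expr0 mulr1 subrr.
by rewrite big_nat_recr//= IH exprS; set u := (_ / _) ^+ n; lra.
Qed.

Lemma dom_ln C b : dom C b -> C <= 1/2 -> dom (2 * C) (fun x => ln (1 + b x)).
Proof.
move=> H C2; have C0 := dom_ge0 H.
pose c n : R := if n is m.+1 then (-1) ^+ m / m.+1%:R else 0.
apply: (dom_series (c := c) H) => [x|n].
  rewrite -cvg_shiftS /=.
  have := @cvg_ln1D_series R (b x) (le_trans (dom_norm x H) C2).
  by under [X in _ -> X @ _ --> _]eq_fun do rewrite big_nat_recl//= mul0r add0r.
case: n => [|n]; first by rewrite big_geq// mulr_ge0.
rewrite big_nat_recl//= normr0 mul0r add0r.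
apply: (@le_trans _ _ (\sum_(0 <= m < n) C * (1/2) ^+ m)).
  apply: ler_sum => i _; rewrite normrM normrX normrN1 expr1n mul1r exprS mulrCA.
  apply: ler_wpM2l => //; rewrite -[leRHS]mul1r; apply: ler_pM => //; first exact: exprn_ge0.
    by rewrite normfV normr_nat div1r invf_le1 ?ltr0n// ler1n.
  by apply: lerXn2r; rewrite ?nnegrE; lra.
by rewrite -mulr_sumr mulrC; apply: ler_wpM2r => //; exact: geometric_half_le.
Qed.

(** From order 2 on the coefficients are at most 1/2, and the geometric series of ratio 1/2 adds up
    to at most 2. *)
Lemma dom_ln2 C b : dom C b -> C <= 1/2 -> dom (C ^+ 2) (fun x => ln (1 + b x) - b x).
Proof.
move=> H C2; have C0 := dom_ge0 H.
pose c n : R := if n is m.+2 then (-1) ^+ m.+1 / m.+2%:R else 0.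
apply: (dom_series (c := c) H) => [x|n].
  rewrite -cvg_shiftS /=.
  have := @cvg_ln1D_series R (b x) (le_trans (dom_norm x H) C2).
  move=> lim1.
  have lim2 : (fun n => \sum_(0 <= m < n) (-1) ^+ m / m.+1%:R * b x ^+ m.+1 - b x) @ \oo
      --> ln (1 + b x) - b x by apply: cvgB => //; exact: cvg_cst.
  apply: cvg_trans lim2; apply: near_eq_cvg.
  near=> n.
  have n1 : (1 <= n)%N by near: n; exact: nbhs_infty_ge.
  rewrite -(subnK n1) addn1 !big_nat_recl//= !mul0r !add0r.
  by rewrite expr0 divr1 mul1r expr1 addrC /= addKr.
case: n => [|[|n]]; first by rewrite big_geq// exprn_ge0.
  by rewrite big_nat_recl//= big_geq// normr0 mul0r add0r exprn_ge0.
rewrite !big_nat_recl//= !normr0 !mul0r !add0r.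
apply: (@le_trans _ _ (\sum_(0 <= m < n) (C ^+ 2 * (1/2)) * (1/2) ^+ m)).
  apply: ler_sum => i _; rewrite normrM normrX normrN1 expr1n mul1r.
  rewrite -[i.+2]add2n exprD mulrCA -mulrA.
  apply: ler_wpM2l; first exact: exprn_ge0.
  apply: ler_pM => //; first exact: exprn_ge0.
    by rewrite normfV normr_nat ?div1r lef_pV2 ?posrE ?ltr0n// ler_nat.
  by apply: lerXn2r; rewrite ?nnegrE; lra.
rewrite -mulr_sumr -mulrA ler_piMr ?exprn_ge0//.
by have := geometric_half_le n; lra.
Unshelve. all: by end_near.
Qed.

End Log.
End Dom.

(** * Oscillatory sums over a small box *)

(* Dominates the geometric sums [sum_(s < L) exp(i z s)] uniformly in [z]. *)
Definition dirichlet_majorant (R : realType) (L : nat) (z : R) : R :=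
  L%:R / (1 + L%:R * `|sin (z / 2)|).

Lemma dirichlet_majorant_ge0 (R : realType) (L : nat) (z : R) : 0 <= dirichlet_majorant L z.
Proof. by rewrite divr_ge0// addr_ge0// mulr_ge0. Qed.

(** Multiplication by sin (z / 2) makes the sum telescope. The form without division is valid for
    all [z] and also serves the Fejer kernel. *)
Lemma dirichlet_sum_sin (R : realType) (n : nat) (z c : R) :
  `|\sum_(0 <= s < n) cos (z * s%:R + c)| * `|sin (z / 2)| <= 1.
Proof.
rewrite -normrM mulr_suml.
pose g s := sin (z * s%:R + c - z / 2) / 2.
rewrite (telescope_sumr_eq g)//; last first.
  move=> s _; rewrite /g -mulrBl.
  have -> : z * s.+1%:R + c - z / 2 = (z * s%:R + c) + z / 2.
    by rewrite -natr1 mulrDr; field.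
  by rewrite sinD sinB; field.
rewrite /g -mulrBl normrM (ger0_norm (_ : 0 <= 2^-1))//.
have := ler_normB (sin (z * n%:R + c - z / 2)) (sin (z * 0%:R + c - z / 2)).
have := sin_max (z * n%:R + c - z / 2); have := sin_max (z * 0%:R + c - z / 2).
lra.
Qed.

Lemma dirichlet_sum (R : realType) (n L : nat) (z c : R) : (n <= L)%N ->
  `|\sum_(0 <= s < n) cos (z * s%:R + c)| <= 2 * dirichlet_majorant L z.
Proof.
move=> nL; have As := dirichlet_sum_sin n z c; set A := \sum_(_ <= _ < _) _ in As *.
have AL : `|A| <= L%:R.
  apply: le_trans (ler_norm_sum _ _ _) _.
  apply: (@le_trans _ _ (\sum_(0 <= s < n) 1)).
    by apply: ler_sum => s _; exact: cos_max.
  by rewrite sumr_const_nat subn0 ler_nat.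
rewrite /dirichlet_majorant mulrA ler_pdivlMr; last by rewrite ltr_pwDl// mulr_ge0.
by rewrite mulrDr mulr1 mulrCA; have := ler_wpM2l (ler0n R L) As; lra.
Qed.

(** The weights (s / L)^m are monotone in s with values in [0, 1], so Abel summation costs a factor
    2 whatever the power m is. *)
Lemma dirichlet_sum_weight (R : realType) (L m : nat) (z c : R) : (0 < L)%N ->
  `|\sum_(s < L) cos (z * s%:R + c) * (s%:R / L%:R) ^+ m| <= 4 * dirichlet_majorant L z.
Proof.
move=> L0; rewrite -(big_mkord predT (fun s => cos (z * s%:R + c) * (s%:R / L%:R) ^+ m)).
have -> : 4 * dirichlet_majorant L z = 2 * (2 * dirichlet_majorant L z) by ring.
have Lr : 0 < L%:R :> R by rewrite ltr0n.
have r01 i : (i <= L)%N -> 0 <= (i%:R / L%:R : R) <= 1.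
  by move=> iL; rewrite divr_ge0//= ler_pdivrMr// mul1r ler_nat.
apply: abel_sum_bound => [n nL|i iL|i iL].
- exact: dirichlet_sum.
- apply: lerXn2r; rewrite ?nnegrE.
  + by have /andP[] := r01 i (ltnW iL).
  + by have /andP[] := r01 _ iL.
  + by rewrite ler_pM2r ?invr_gt0// ler_nat.
- have /andP[h0 h1] := r01 i iL.
  by rewrite exprn_ge0//= exprn_ile1.
Qed.

Section Tensor.
Import complex.
Context (R : realType).
Local Notation C := R[i].
Local Open Scope complex_scope.
Let cis (x : R) : C := Complex (cos x) (sin x).
Let n2 (z : C) : R := Re z ^+ 2 + Im z ^+ 2.

Let cisD x y : cis (x + y) = cis x * cis y.
Proof. by apply/eqP; rewrite eq_complex /= cosD sinD (addrC (sin x * _)) !eqxx. Qed.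

Let cis0 : cis 0 = 1.
Proof. by rewrite /cis cos0 sin0. Qed.

Let n2M z w : n2 (z * w) = n2 z * n2 w.
Proof. case: z w => [a b] [c d]; rewrite /n2 /=; ring. Qed.

Let cis_sum (I : Type) (r : seq I) (f : I -> R) :
  cis (\sum_(i <- r) f i) = \prod_(i <- r) cis (f i).
Proof. exact: (big_morph cis cisD cis0). Qed.

Let ReD (z w : C) : Re (z + w) = Re z + Re w. Proof. by case: z w => [a b] []. Qed.
Let ImD (z w : C) : Im (z + w) = Im z + Im w. Proof. by case: z w => [a b] []. Qed.
Let Re_sum (I : finType) (f : I -> C) : Re (\sum_i f i) = \sum_i Re (f i).
Proof. exact: (big_morph (@Re R) ReD). Qed.
Let Im_sum (I : finType) (f : I -> C) : Im (\sum_i f i) = \sum_i Im (f i).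
Proof. exact: (big_morph (@Im R) ImD). Qed.

(** The cosine of a sum does not factor, the exponential does. The hypothesis for all phases bounds
    both the real and the imaginary part of each factor by B, hence its modulus by 2 B. *)
Lemma tensor_sum_bound (I : finType) (L : nat) (z : I -> R) (b : I -> 'I_L -> R)
    (B : I -> R) (c : R) :
  (forall i c, `|\sum_(s < L) cos (z i * s%:R + c) * b i s| <= B i) ->
  `|\sum_(s : {ffun I -> 'I_L}) cos (\sum_i z i * (s i)%:R + c) * \prod_i b i (s i)|
   <= \prod_i (2 * B i).
Proof.
move=> H.
have B0 i : 0 <= B i by apply: le_trans (H i 0).
pose Z i : C := \sum_(s < L) cis (z i * s%:R) * (b i s)%:C.
have nZ i : n2 (Z i) <= (2 * B i) ^+ 2.
  have hR : `|Re (Z i)| <= B i.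
    rewrite /Z Re_sum; have := H i 0; under eq_bigr do rewrite addr0.
    by under [X in _ -> `|X| <= _]eq_bigr do rewrite /= mulr0 subr0.
  have hI : `|Im (Z i)| <= B i.
    rewrite /Z Im_sum; have := H i (- (pi / 2)).
    under eq_bigr do rewrite cosBpihalf.
    by under [X in _ -> `|X| <= _]eq_bigr do rewrite /= mulr0 add0r.
  rewrite /n2 -(real_normK (num_real (Re _))) -(real_normK (num_real (Im _))).
  have h1 : `|Re (Z i)| ^+ 2 <= B i ^+ 2 by apply: lerXn2r; rewrite ?nnegrE.
  have h2 : `|Im (Z i)| ^+ 2 <= B i ^+ 2 by apply: lerXn2r; rewrite ?nnegrE.
  by rewrite exprMn; have := sqr_ge0 (B i); lra.
set S := \sum_(_ : {ffun _ -> _}) _.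
have SE : S = Re (cis c * \prod_i Z i).
  rewrite /Z bigA_distr_bigA /= mulr_sumr Re_sum; apply: eq_bigr => s _.
  rewrite big_split /= -cis_sum mulrA -cisD (addrC c).
  have -> : \prod_i (b i (s i))%:C = (\prod_i b i (s i))%:C.
    by rewrite -(rmorph_prod (real_complex R)).
  by rewrite /= mulr0 subr0.
rewrite -ler_sqr ?nnegrE ?prodr_ge0//; last by move=> i _; rewrite mulr_ge0.
rewrite real_normK ?num_real//.
apply: (@le_trans _ _ (n2 (cis c * \prod_i Z i))).
  by rewrite SE /n2 lerDl sqr_ge0.
rewrite n2M {1}/n2 /= cos2Dsin2 mul1r.
have -> : n2 (\prod_i Z i) = \prod_i n2 (Z i).
  by apply: (big_morph n2 n2M); rewrite /n2 /= expr1n expr0n addr0.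
rewrite -prodrXl; apply: ler_prod => i _; rewrite nZ andbT.
by rewrite /n2 addr_ge0// sqr_ge0.
Qed.
End Tensor.

Definition sqnorm (R : realType) (I : finType) (k : I -> R) : R := \sum_i k i ^+ 2.
Definition enorm (R : realType) (I : finType) (k : I -> R) : R := Num.sqrt (sqnorm k).

Lemma sqnorm_ge0 (R : realType) (I : finType) (k : I -> R) : 0 <= sqnorm k.
Proof. by apply: sumr_ge0 => i _; exact: sqr_ge0. Qed.

Lemma enorm_powR (R : realType) (I : finType) (k : I -> R) (a : R) :
  enorm k `^ a = sqnorm k `^ (a / 2).
Proof. by rewrite /enorm -powR12_sqrt ?sqnorm_ge0// -powRrM mulrC. Qed.

Lemma coord_le_enorm (R : realType) (I : finType) (k : I -> R) i : `|k i| <= enorm k.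
Proof.
rewrite -sqrtr_sqr; apply: ler_wsqrtr; rewrite /sqnorm (bigD1 i)//= lerDl.
by apply: sumr_ge0 => j _; exact: sqr_ge0.
Qed.

Lemma powRB2 (R : realType) (r a : R) : 0 < r -> r `^ (a - 2) = r `^ a / r ^+ 2.
Proof.
move=> r0; rewrite powRB; last by rewrite (gt_eqF r0) implybT.
by rewrite (powR_mulrn 2 (ltW r0)).
Qed.

Section Box.
Context (R : realType) (d L : nat).
Hypothesis L0 : (0 < L)%N.
Notation box := {ffun 'I_d -> 'I_L}.

Let box_monomial (e : box -> R) :=
  exists m : 'I_d -> nat, e = fun s => \prod_i ((s i)%:R / L%:R) ^+ m i.

Let box_monomial1 : box_monomial (fun=> 1).
Proof. by exists (fun=> 0%N); apply/funext => s; rewrite big1// => i _; rewrite expr0. Qed.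

Let box_monomialM e f : box_monomial e -> box_monomial f -> box_monomial (fun s => e s * f s).
Proof.
move=> [m ->] [m' ->]; exists (fun i => m i + m' i)%N; apply/funext => s.
by rewrite -big_split; apply: eq_bigr => i _; rewrite exprD.
Qed.

Let u (s : box) (i : 'I_d) : R := (s i)%:R / L%:R.

Let u01 s i : 0 <= u s i <= 1.
Proof.
by rewrite divr_ge0//= ler_pdivrMr ?ltr0n// mul1r ler_nat ltnW.
Qed.

Let box_monomial_le1 e s : box_monomial e -> `|e s| <= 1.
Proof.
move=> [m ->]; rewrite normr_prod; apply: prodr_ile1 => i _.
rewrite normr_ge0 normrX /=; have /andP[h0 h1] := u01 s i.
by rewrite exprn_ile1// ger0_norm.
Qed.

Let dom_u i : dom box_monomial 1 (u ^~ i).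
Proof.
apply: dom_base; exists (fun j => (j == i) : nat); apply/funext => s.
rewrite (bigD1 i)//= eqxx expr1 big1 ?mulr1// => j /negPf ->; exact: expr0.
Qed.


Let dom_test (C : R) (z : 'I_d -> R) (c : R) (f : box -> R) :
  dom box_monomial C f ->
  `|\sum_(s : box) cos (\sum_i z i * (s i)%:R + c) * f s| <=
    C * \prod_i (8 * dirichlet_majorant L (z i)).
Proof.
move=> [_ H]; apply: H => e [m ->].
rewrite (eq_bigr (fun i => 2 * (4 * dirichlet_majorant L (z i)))); last by move=> i _; ring.
apply: (@tensor_sum_bound R 'I_d L z (fun i s => (s%:R / L%:R) ^+ m i)) => i c'.
exact: dirichlet_sum_weight.
Qed.

(** With u = s / L one has |k0 + s|^2 = lam (1 + w), where w is a small polynomial in u. Write (1 +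
    w)^a as exp (a ln (1 + w)) and split off the constant and the part linear in s. The remainder
    [B] has bounded norm, so its cosine and sine are admissible weights for the geometric sums. *)
Lemma box_sum_bound (k0 y : 'I_d -> R) (N t alpha beta : R) :
  0 < alpha < 2 -> 0 <= t -> 0 < N -> N <= enorm k0 -> 6 * d%:R * L%:R <= N ->
  L%:R <= N -> t * N `^ (alpha - 2) * L%:R ^+ 2 <= 1 ->
  `|\sum_(s : box) cos (\sum_i y i * (s i)%:R
       - t * enorm (fun i => k0 i + (s i)%:R) `^ alpha + beta)|
  <= 2 * expR (46 * d%:R ^+ 2) *
     \prod_i (8 * dirichlet_majorant L (y i - t * alpha * enorm k0 `^ (alpha - 2) * k0 i)).
Proof.
move=> /andP[al0 al2] t0 N0 Nr dLN LN tL.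
set r := enorm k0; set lam := sqnorm k0; set a := alpha / 2.
rewrite -/r in Nr.
have r0 : 0 < r by apply: lt_le_trans Nr.
have rr : r ^+ 2 = lam by rewrite sqr_sqrtr// sqnorm_ge0.
have lam0 : 0 < lam by rewrite -rr exprn_gt0.
have a01 : 0 < a < 1 by rewrite /a; lra.
have Lr : 0 < L%:R :> R by rewrite ltr0n.
pose w (s : box) := \sum_i (2 * k0 i * L%:R / lam * u s i + L%:R ^+ 2 / lam * u s i ^+ 2).
have sE (s : box) i : (s i)%:R = L%:R * u s i by rewrite /u mulrC divfK// gt_eqF.
have wE (s : box) : sqnorm (fun i => k0 i + (s i)%:R) = lam * (1 + w s).
  rewrite mulrDr mulr1 mulr_sumr /lam /sqnorm -big_split /=; apply: eq_bigr => i _.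
  by rewrite sE -/lam; field; rewrite gt_eqF.
(* Each coordinate contributes 2 |k0 i| L / lam + L^2 / lam, which is at most 3 L / r. *)
pose om := 3 * d%:R * L%:R / r.
have om0 : 0 <= om by rewrite divr_ge0// ?(ltW r0)// !mulr_ge0.
have om2 : om <= 1/2 by rewrite ler_pdivrMr//; lra.
have dw : dom box_monomial om w.
  have -> : om = \sum_(i < d) (3 * L%:R / r).
    by rewrite sumr_const card_ord -[RHS]mulr_natl /om; field; rewrite gt_eqF.
  apply: (dom_sum box_monomial1) => i.
  have h1 := dom_scale (2 * k0 i * L%:R / lam) (dom_u i).
  have h2 := dom_scale (L%:R ^+ 2 / lam) (dom_exp box_monomial1 box_monomialM 2 (dom_u i)).
  apply: (dom_le box_monomial1) (dom_add h1 h2).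
  rewrite expr1n !mulr1 (ger0_norm (_ : 0 <= L%:R ^+ 2 / lam)); last first.
    by rewrite divr_ge0// ?exprn_ge0// ltW.
  rewrite !normrM normfV (ger0_norm (ltW lam0)) (ger0_norm (ltW Lr)) (ger0_norm (_ : 0 <= 2))//.
  rewrite -mulrDl (_ : 3 * L%:R / r = (3 * (r * L%:R)) / lam); last first.
    by rewrite -rr; field; rewrite gt_eqF.
  rewrite ler_pM2r ?invr_gt0//.
  have hk : `|k0 i| * L%:R <= r * L%:R by apply: ler_wpM2r; [exact: ltW|exact: coord_le_enorm].
  have hL : L%:R * L%:R <= r * L%:R :> R.
    by apply: ler_wpM2r; [exact: ltW|apply: le_trans Nr].
  by rewrite expr2; lra.
have w2 (s : box) : `|w s| <= 1/2.
  by apply: le_trans om2; exact: (dom_norm box_monomial_le1 s dw).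
pose ell (s : box) := ln (1 + w s).
have dell : dom box_monomial (2 * om) ell := dom_ln box_monomial1 box_monomialM box_monomial_le1 dw om2.
have dq : dom box_monomial (om ^+ 2) (fun s => ell s - w s) := dom_ln2 box_monomial1 box_monomialM box_monomial_le1 dw om2.
have dal : dom box_monomial (a * (2 * om)) (fun s => a * ell s).
  by rewrite -{1}(ger0_norm (_ : 0 <= a)); [exact: dom_scale|lra].
have aom1 : a * (2 * om) <= 1.
  have h : a * (2 * om) <= 1 * (2 * om) by apply: ler_wpM2r; lra.
  by lra.
have de := dom_expR2 box_monomial1 box_monomialM dal aom1.
pose T := t * lam `^ a.
have T0 : 0 <= T by rewrite mulr_ge0// powR_ge0.
(* The error of exp at first order, the error of ln at first order, and the quadratic part of T a
   w. *)
pose B (s : box) := T * ((expR (a * ell s) - 1 - a * ell s) + a * (ell s - w s))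
   + \sum_i (T * a * L%:R ^+ 2 / lam) * u s i ^+ 2.
(* As alpha < 2, r^(alpha - 2) is at most N^(alpha - 2), so the condition at the inner radius N
   controls the second-order terms at k0. *)
have TL : T * L%:R ^+ 2 / lam <= 1.
  apply: le_trans tL; rewrite /T -/a -mulrA -mulrA -[leRHS]mulrA.
  apply: ler_wpM2l => //; rewrite mulrCA [leRHS]mulrC; apply: ler_wpM2l; first exact: exprn_ge0.
  rewrite /a -enorm_powR -/r -rr.
  rewrite -powRB2//.
  rewrite (_ : alpha - 2 = - (2 - alpha)); last by ring.
  rewrite !powRN lef_pV2 ?posrE ?powR_gt0//.
  by apply: ge0_ler_powR; rewrite ?nnegrE ?(ltW N0) ?(ltW r0)//; lra.
(* 46 = 36 + 9 + 1: since T om^2 <= 9 d^2, the three parts have norms at most 36 d^2, 9 d^2 and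
   d. *)
have dB : dom box_monomial (46 * d%:R ^+ 2) B.
  have d1 := dom_scale T (dom_add de (dom_scale a dq)).
  have d2 : dom box_monomial (\sum_(i < d) (T * a * L%:R ^+ 2 / lam))
      (fun s => \sum_i (T * a * L%:R ^+ 2 / lam) * u s i ^+ 2).
    apply: (dom_sum box_monomial1) => i.
    have := dom_scale (T * a * L%:R ^+ 2 / lam) (dom_exp box_monomial1 box_monomialM 2 (dom_u i)).
    rewrite expr1n mulr1 ger0_norm// divr_ge0 ?(ltW lam0)// mulr_ge0 ?exprn_ge0// mulr_ge0//; lra.
  apply: (dom_le box_monomial1) (dom_add d1 d2).
  rewrite (ger0_norm T0) (ger0_norm (_ : 0 <= a)); last lra.
  rewrite sumr_const card_ord -[(_ / lam) *+ d]mulr_natl.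
  have Tom : T * om ^+ 2 <= 9 * d%:R ^+ 2.
    have -> : T * om ^+ 2 = 9 * d%:R ^+ 2 * (T * L%:R ^+ 2 / lam).
      by rewrite /om -rr; field; rewrite gt_eqF.
    by rewrite -[leRHS]mulr1; apply: ler_wpM2l => //; rewrite mulr_ge0// exprn_ge0.
  have dd : d%:R <= d%:R ^+ 2 :> R.
    by rewrite -natrX ler_nat; case: (d) => // n; rewrite leq_pmulr.
  have Tom0 : 0 <= T * om ^+ 2 by rewrite mulr_ge0// exprn_ge0.
  have h1 : T * (a * (2 * om)) ^+ 2 <= 4 * (T * om ^+ 2).
    rewrite (_ : T * _ = a ^+ 2 * (4 * (T * om ^+ 2))); last by ring.
    rewrite ler_piMl//; first by rewrite mulr_ge0.
    by apply: exprn_ile1; lra.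
  have h2 : T * (a * om ^+ 2) <= T * om ^+ 2.
    by rewrite mulrCA ler_piMl//; lra.
  have h3 : d%:R * (T * a * L%:R ^+ 2 / lam) <= d%:R.
    rewrite -[leRHS]mulr1; apply: ler_wpM2l => //.
    rewrite (_ : T * a * _ / _ = a * (T * L%:R ^+ 2 / lam)); last by ring.
    apply: le_trans TL; rewrite ler_piMl//; last lra.
    by rewrite divr_ge0 ?(ltW lam0)// mulr_ge0// exprn_ge0.
  rewrite mulrDr; lra.
set v := fun i => t * alpha * r `^ (alpha - 2) * k0 i.
have vE i : v i = T * a * (2 * k0 i / lam).
  rewrite /v /T /a -enorm_powR -/r powRB2// -rr.
  by field; rewrite gt_eqF.
have phase (s : box) : t * enorm (fun i => k0 i + (s i)%:R) `^ alpha =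
    T + \sum_i v i * (s i)%:R + B s.
  rewrite enorm_powR -/a wE.
  have w1 : 0 < 1 + w s by have := w2 s; rewrite ler_norml; lra.
  rewrite powRM ?(ltW lam0) ?(ltW w1)// [(1 + w s) `^ a]/powR gt_eqF// -/(ell s).
  rewrite mulrA -/T /B.
  have -> : \sum_i v i * (s i)%:R =
      T * a * w s - \sum_i (T * a * L%:R ^+ 2 / lam) * u s i ^+ 2.
    rewrite /w mulr_sumr -sumrB; apply: eq_bigr => i _.
    by rewrite vE sE; field; rewrite gt_eqF.
  ring.
pose phi (s : box) := \sum_i (y i - v i) * (s i)%:R + (beta - T).
(* The factor 2 of the bound: cos (phi - B) is a sum of two products, and the sine of phi is a
   cosine shifted by pi / 2. *)
have cE (s : box) : cos (\sum_i y i * (s i)%:R - t * enorm (fun i => k0 i + (s i)%:R) `^ alpha + beta)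
    = cos (phi s) * cos (B s) + cos (phi s - pi / 2) * sin (B s).
  rewrite cosBpihalf -cosB; congr cos; rewrite phase /phi.
  under [in RHS]eq_bigr do rewrite mulrBl.
  by rewrite sumrB; ring.
rewrite (eq_bigr _ (fun s _ => cE s)).
rewrite big_split /=; apply: le_trans (ler_normD _ _) _.
have dbl (x z : R) : 2 * x * z = x * z + x * z by ring.
rewrite dbl.
apply: lerD.
  exact: (dom_test _ _ (dom_cos box_monomial1 box_monomialM dB)).
under eq_bigr do rewrite /phi -addrA.
exact: (dom_test _ _ (dom_sin box_monomial1 box_monomialM dB)).
Qed.
End Box.

(** Mean value theorem: for b <= 1 the derivative is smallest in modulus at the largest argument.
    Negative exponents occur for alpha < 1, where b = alpha - 1. *)
Lemma powR_diff_ge (R : realType) (b x y M : R) : 0 < x -> x <= y -> y <= M -> b <= 1 ->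
  `|b| * M `^ (b - 1) * (y - x) <= `|y `^ b - x `^ b|.
Proof.
move=> x0 xy yM b1.
have der (z : R) : 0 < z -> is_derive z 1 (fun u => u `^ b) (b * z `^ (b - 1)).
  move=> z0; have zin : z \in `]0, +oo[%R by rewrite in_itv /= z0.
  have := powR_derive1 b zin; rewrite derive1E => <-.
  by apply: derivableP; exact: derivable_powR.
have [||c] := @MVT_segment R (fun u => u `^ b) (fun z => b * z `^ (b - 1)) x y xy.
- by move=> z; rewrite in_itv /= => /andP[xz _]; apply: der; exact: lt_trans xz.
- apply: derivable_within_continuous => z; rewrite in_itv /= => /andP[xz _].
  by have [] := der z (lt_le_trans x0 xz).
rewrite in_itv /= => /andP[xc cy] ->.
rewrite !normrM (ger0_norm (_ : 0 <= y - x)) ?subr_ge0//.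
apply: ler_wpM2r; rewrite ?subr_ge0//; apply: ler_wpM2l => //.
rewrite ger0_norm ?powR_ge0//.
have c0 : 0 < c by exact: lt_le_trans xc.
rewrite (_ : b - 1 = - (1 - b)); last by ring.
rewrite !powRN lef_pV2 ?posrE ?powR_gt0//; last by lra.
by apply: ge0_ler_powR; rewrite ?nnegrE; lra.
Qed.

(** * Separation of the gradients of the phase *)

Section Separation.
Context (R : realType) (I : finType).
Implicit Types k : I -> R.

Let dot k k' := \sum_i k i * k' i.

Lemma sqnorm_comb k k' x x' : sqnorm (fun i => x * k i - x' * k' i) =
  x ^+ 2 * sqnorm k + x' ^+ 2 * sqnorm k' - 2 * x * x' * dot k k'.
Proof.
rewrite /sqnorm /dot !mulr_sumr -big_split -sumrB; apply: eq_bigr => i _ /=; ring.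
Qed.

(* With [r = |k|], [r' = |k'|] both sides split into a radial part and a multiple
   of the angular part [r r' - k.k']. *)
Lemma gradient_separation k k' (N La alpha : R) :
  0 < N -> N <= enorm k <= La * N -> N <= enorm k' <= La * N -> 0 < alpha < 2 ->
  (alpha - 1) ^+ 2 * ((La * N) `^ (alpha - 2)) ^+ 2 * sqnorm (fun i => k i - k' i)
  <= sqnorm (fun i => enorm k `^ (alpha - 2) * k i - enorm k' `^ (alpha - 2) * k' i).
Proof.
move=> N0 /andP[Nr rL] /andP[Nr' rL'] /andP[al0 al2].
set r := enorm k in Nr rL *; set r' := enorm k' in Nr' rL' *.
have r0 : 0 < r by exact: lt_le_trans Nr.
have r0' : 0 < r' by exact: lt_le_trans Nr'.
have rr : sqnorm k = r ^+ 2 by rewrite sqr_sqrtr// sqnorm_ge0.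
have rr' : sqnorm k' = r' ^+ 2 by rewrite sqr_sqrtr// sqnorm_ge0.
(* Cauchy-Schwarz, read off from |r' k - r k'|^2 >= 0. *)
have cs : 0 <= r * r' - dot k k'.
  have := sqnorm_ge0 (fun i => r' * k i - r * k' i).
  rewrite sqnorm_comb rr rr'.
  have -> : r' ^+ 2 * r ^+ 2 + r ^+ 2 * r' ^+ 2 - 2 * r' * r * dot k k' =
    (2 * (r * r')) * (r * r' - dot k k') by ring.
  by rewrite pmulr_rge0// !mulr_gt0.
have -> : sqnorm (fun i => k i - k' i) = (r - r') ^+ 2 + 2 * (r * r' - dot k k').
  have -> : (fun i => k i - k' i) = (fun i => 1 * k i - 1 * k' i).
    by apply/funext => i; rewrite !mul1r.
  by rewrite sqnorm_comb rr rr'; ring.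
set x := r `^ _; set x' := r' `^ _; set z := (La * N) `^ _.
have LN : 0 < La * N by apply: lt_le_trans rL.
have z0 : 0 < z by rewrite powR_gt0.
have zle (u : R) : 0 < u -> u <= La * N -> z <= u `^ (alpha - 2).
  move=> u0 uL; rewrite /z (_ : alpha - 2 = - (2 - alpha)); last by ring.
  rewrite !powRN lef_pV2 ?posrE ?powR_gt0//.
  by apply: ge0_ler_powR; rewrite ?nnegrE; lra.
have zx : z <= x by exact: zle.
have zx' : z <= x' by exact: zle.
have xr (u : R) : 0 < u -> u `^ (alpha - 2) * u = u `^ (alpha - 1).
  move=> u0; rewrite (_ : alpha - 1 = (alpha - 2) + 1); last by ring.
  by rewrite [RHS]powRD; [rewrite powRr1// ltW|rewrite (gt_eqF u0) implybT].
rewrite sqnorm_comb rr rr'.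
have -> : x ^+ 2 * r ^+ 2 + x' ^+ 2 * r' ^+ 2 - 2 * x * x' * dot k k' =
   (x * r - x' * r') ^+ 2 + 2 * (x * x') * (r * r' - dot k k') by ring.
(* The radial part is compared by the mean value theorem with the loss |alpha - 1|, which vanishes
   at alpha = 1; for the angular part z^2 <= x x' is enough. *)
rewrite mulrDr; apply: lerD.
  rewrite !xr//.
  wlog le_r : r r' r0 r0' rL rL' {Nr Nr' rr rr' cs x x' zx zx'} / r <= r'.
    move=> H; case: (leP r r') => [h|/ltW h]; first exact: H.
    by rewrite -(sqrrN (r - _)) -(sqrrN (r `^ _ - _)) !opprB; exact: H.
  rewrite -(sqrrN (r - _)) -(sqrrN (r `^ _ - _)) !opprB.
  rewrite -(real_normK (num_real (_ `^ _ - _))) -(real_normK (num_real (alpha - 1))) -!exprMn.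
  have h := @powR_diff_ge R (alpha - 1) r r' (La * N) r0 le_r rL' _.
  apply: lerXn2r; rewrite ?nnegrE ?mulr_ge0 ?subr_ge0 ?(ltW z0)//.
  rewrite (_ : alpha - 1 - 1 = alpha - 2) in h; last by ring.
  by apply: h; lra.
rewrite mulrA; apply: ler_wpM2r => //.
have zz : z ^+ 2 <= x * x' by rewrite expr2; apply: ler_pM => //; exact: ltW.
have a1 : (alpha - 1) ^+ 2 <= 1.
  rewrite -(real_normK (num_real (alpha - 1))) exprn_ile1// ler_norml; lra.
have : (alpha - 1) ^+ 2 * z ^+ 2 <= 1 * (x * x').
  by apply: ler_pM => //; rewrite sqr_ge0.
lra.
Qed.
End Separation.

(** * Separation of the boxes and the kernel of a dyadic shell *)

Section Majorant.
Context (R : realType).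
Local Notation W := (@dirichlet_majorant R).

Lemma dirichlet_majorant_period L (z : R) (n : nat) : W L (z + 2 * pi * n%:R) = W L z.
Proof.
rewrite /dirichlet_majorant.
have -> : (z + 2 * pi * n%:R) / 2 = z / 2 + pi *+ n by rewrite -mulr_natr; field.
suff -> : `|sin (z / 2 + pi *+ n)| = `|sin (z / 2)| by [].
elim: n => [|n IH]; first by rewrite mulr0n addr0.
by rewrite [pi *+ _]mulrSr addrA sinDpi normrN.
Qed.

Lemma dirichlet_majorant_periodz L (z : R) (n : int) : W L (z + 2 * pi * n%:~R) = W L z.
Proof.
case: (intP n) => [|m|m].
- by rewrite mulr0 addr0.
- exact: dirichlet_majorant_period.
- by rewrite -(dirichlet_majorant_period L (z + _) m.+1) mulrNz mulrN subrK.
Qed.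

(** This allows the centres of the geometric sums to be rounded to grid points: a displacement by 2
    / L changes L |sin (z / 2)| by at most 1. *)
Lemma dirichlet_majorant_slow L (z z' : R) : L%:R * `|z - z'| <= 2 -> W L z <= 2 * W L z'.
Proof.
move=> h; rewrite /dirichlet_majorant mulrCA; apply: ler_wpM2l => //.
have p0 (u : R) : 0 < 1 + L%:R * `|u| by rewrite ltr_pwDl// mulr_ge0.
rewrite ler_pdivlMr// mulrC ler_pdivrMr//.
have h1 := sin_lip (z' / 2) (z / 2).
have h2 : `|z' / 2 - z / 2| = `|z - z'| / 2.
  by rewrite distrC -mulrBl normrM (ger0_norm (_ : 0 <= 2^-1)).
have h3 : `|sin (z' / 2)| <= `|sin (z / 2)| + `|z - z'| / 2.
  rewrite -h2 -lerBlDl; apply: le_trans h1; exact: lerB_dist.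
have := ler_wpM2l (ler0n R L) h3.
have := mulr_ge0 (ler0n R L) (normr_ge0 (sin (z / 2))).
rewrite mulrDr mulrA; lra.
Qed.

Let sin_grid (Q c : nat) : (0 < Q)%N -> (2 * c <= Q)%N ->
  c%:R / (2 * Q%:R) <= sin (pi * c%:R / Q%:R) :> R.
Proof.
move=> Q0 cQ; have Qr : 0 < Q%:R :> R by rewrite ltr0n.
have cr : 2 * c%:R <= Q%:R :> R by rewrite -natrM ler_nat.
have q01 : 0 <= (c%:R / Q%:R : R) <= 1/2.
  by rewrite divr_ge0//= ler_pdivrMr//; lra.
have p2 := @pi_ge2 R.
apply: (@le_trans _ _ (pi * c%:R / Q%:R / 4)).
  rewrite (_ : _ / (2 * _) = 2 * (c%:R / Q%:R) / 4); last by field; rewrite gt_eqF.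
  rewrite ler_pM2r// -mulrA; apply: ler_wpM2r => //; lra.
apply: sin_ge_quarter; rewrite -mulrA; apply/andP; split; first by apply: mulr_ge0; lra.
have : pi * (c%:R / Q%:R) <= pi * (1/2) :> R by apply: ler_wpM2l; lra.
lra.
Qed.

(** The sine is bounded below by the distance to the nearer end of the period. The sum of the two
    reciprocals stands for their maximum, and c + 1 keeps the first one finite at c = 0. *)
Let grid_term (kap l c : nat) : (c < 2 ^ (kap + l))%N ->
  W (2 ^ l) (2 * pi / (2 ^ (kap + l))%:R * c%:R) <=
  (2 ^ l)%:R * (2 * (2 ^ kap)%:R) * ((c.+1%:R)^-1 + ((2 ^ (kap + l) - c)%:R)^-1).
Proof.
set Q := (2 ^ (kap + l))%N => cQ; set L := (2 ^ l)%N; set K := (2 ^ kap)%N.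
have QE : Q = (K * L)%N by rewrite /Q expnD.
have Q0 : (0 < Q)%N by rewrite expn_gt0.
have Lr : 0 < L%:R :> R by rewrite ltr0n expn_gt0.
have K1 : 1 <= K%:R :> R by rewrite ler1n expn_gt0.
rewrite /dirichlet_majorant -[leRHS]mulrA; apply: ler_wpM2l => //.
have -> : 2 * pi / Q%:R * c%:R / 2 = pi * c%:R / Q%:R :> R by field; rewrite pnatr_eq0 -lt0n.
set sn : R := sin (pi * c%:R / Q%:R).
have key (m : nat) : (0 < m)%N -> (m%:R - 1) / (2 * Q%:R) <= `|sn| ->
    (1 + L%:R * `|sn|)^-1 <= 2 * K%:R * (m%:R)^-1.
  move=> m0 hm.
  have m1 : 1 <= m%:R :> R by rewrite ler1n.
  rewrite -[X in _ <= X * _]invrK -invfM lef_pV2 ?posrE; last 2 first.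
  - by rewrite ltr_pwDl// mulr_ge0.
  - by rewrite mulr_gt0 ?invr_gt0// ?mulr_gt0//; lra.
  have h := ler_wpM2l (ltW Lr) hm.
  have e : L%:R * ((m%:R - 1) / (2 * Q%:R)) = (m%:R - 1) / (2 * K%:R) :> R.
    by rewrite QE natrM; field; rewrite !gt_eqF//; lra.
  rewrite e in h.
  have K2 : (2 * K%:R)^-1 <= 1 :> R.
    by rewrite -natrM invf_le1 ?ltr0n ?muln_gt0 ?expn_gt0// ler1n muln_gt0 expn_gt0.
  rewrite mulrBl mul1r (mulrC m%:R) in h; set iK := (2 * K%:R)^-1 in h K2 *; lra.
case: (leqP (2 * c) Q) => h.
  have := key c.+1 isT; rewrite -natr1 addrK => /(_ (le_trans (sin_grid Q0 h) (ler_norm _))).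
  move/le_trans; apply; rewrite ler_wpM2l ?mulr_ge0//.
  by rewrite natr1 lerDl invr_ge0.
have Qc0 : (0 < Q - c)%N by rewrite subn_gt0.
have h2 : (2 * (Q - c) <= Q)%N by lia.
have := key (Q - c)%N Qc0.
have -> : sn = sin (pi * (Q - c)%:R / Q%:R).
  rewrite /sn natrB; last exact: ltnW.
  have -> : pi * (Q%:R - c%:R) / Q%:R = - (pi * c%:R / Q%:R) + pi :> R.
    by field; rewrite pnatr_eq0 -lt0n.
  by rewrite sinDpi sinN opprK.
move=> /(_ (le_trans _ (le_trans (sin_grid Q0 h2) (ler_norm _)))).
have hh : ((Q - c)%:R - 1) / (2 * Q%:R) <= (Q - c)%:R / (2 * Q%:R) :> R.
  by rewrite ler_pM2r ?gerBl// invr_gt0 mulr_gt0// ltr0n.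
move=> /(_ hh) /le_trans; apply; rewrite ler_wpM2l ?mulr_ge0//.
by rewrite lerDr invr_ge0.
Qed.

(** Over one period the harmonic sums give L log L, where l + 1 plays the role of log L. *)
Lemma dirichlet_majorant_grid (kap l : nat) :
  \sum_(c < 2 ^ (kap + l)) W (2 ^ l) (2 * pi / (2 ^ (kap + l))%:R * c%:R) <=
  4 * (2 ^ kap)%:R * (kap%:R + 1) * ((2 ^ l)%:R * (l%:R + 1)).
Proof.
apply: (le_trans (ler_sum _ (fun c _ => grid_term (ltn_ord c)))).
rewrite -mulr_sumr big_split /=.
have h := harmonic_le R (kap + l).
have h2 : \sum_(c < 2 ^ (kap + l)) ((2 ^ (kap + l) - c)%:R : R)^-1 <= (kap + l)%:R + 1.
  apply: le_trans h; rewrite (reindex_inj rev_ord_inj) /=.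
  apply: ler_sum => c _; rewrite subKn//.
set A := \sum_(_ < _) _ in h *; set B := \sum_(_ < _) _ in h2 *.
have hk : kap%:R + l%:R + 1 <= (kap%:R + 1) * (l%:R + 1) :> R.
  by rewrite -natrD !natr1 -natrM ler_nat; lia.
have LK : 0 <= (2 ^ l)%:R * (2 * (2 ^ kap)%:R) :> R by rewrite !mulr_ge0.
rewrite natrD in h h2.
have : A + B <= 2 * ((kap%:R + 1) * (l%:R + 1)) by lra.
move=> /(ler_wpM2l LK) /le_trans; apply.
by rewrite le_eqVlt; apply/orP; left; apply/eqP; ring.
Qed.

Lemma sum_periodic (f : nat -> R) (Q m : nat) : (forall c, f (Q + c)%N = f c) ->
  \sum_(c < m * Q) f c = m%:R * \sum_(c < Q) f c.
Proof.
move=> fQ; elim: m => [|m IH]; first by rewrite mul0n big_ord0 mul0r.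
rewrite mulSn big_split_ord /= (eq_bigr (fun i : 'I_(m * Q) => f i)); last by move=> i _; exact: fQ.
by rewrite IH -natr1; ring.
Qed.

End Majorant.

Lemma sum_over_injective_le (R : realType) (T U : finType) (P : pred T) (h : T -> U) (G : U -> R) :
  {in P &, injective h} -> (forall c, 0 <= G c) ->
  \sum_(n | P n) G (h n) <= \sum_c G c.
Proof.
move=> hinj G0; rewrite (partition_big h predT)//=; apply: ler_sum => c _.
case: (pickP (fun n => P n && (h n == c))) => [n0 /andP[Pn0 /eqP hn0]|none].
  rewrite (big_pred1 n0); first by rewrite hn0.
  move=> n; apply/andP/eqP => [[Pn /eqP hn]|->]; last by rewrite Pn0 hn0.
  by apply: hinj => //; rewrite hn.
by rewrite big_pred0.
Qed.

Lemma absz_shift_lt (f : int) (a : nat) :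
  (- a%:Z <= f)%R -> (f < a%:Z)%R -> (absz (f + a%:Z)%R < 2 * a)%N.
Proof. lia. Qed.

Lemma exp2_large (R : realType) (x : R) : exists n : nat, x <= (2 ^ n)%:R.
Proof.
exists (Num.truncn `|x|).+1; apply: le_trans (ler_norm x) _.
have /andP[_ /ltW h] := truncn_itv (normr_ge0 x).
by apply: le_trans h _; rewrite ler_nat ltnW// ltn_expl.
Qed.

(* The points [v n] lie in distinct cells of a grid of mesh [delta], a submultiple
   of the period of the majorant. *)
Lemma separated_sum_bound (R : realType) (d : nat) (e0 : R) : 0 < e0 <= 1 ->
  exists2 C : R, 0 < C & forall (T : finType) (P : pred T) (v : T -> 'I_d -> R)
    (y : 'I_d -> R) (V : R) (l : nat), 0 <= V ->
    (forall n i, P n -> `|v n i| <= V) ->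
    (forall n n', P n -> P n' -> n != n' ->
       (e0 / (2 ^ l)%:R) ^+ 2 <= sqnorm (fun i => v n i - v n' i)) ->
    \sum_(n | P n) \prod_i dirichlet_majorant (2 ^ l) (y i - v n i) <=
      (C * (1 + V) * ((2 ^ l)%:R * (l%:R + 1))) ^+ d.
Proof.
move=> /andP[e00 e01].
(* The mesh will be 2 pi / (2^kap L). Since 2 pi < 8, this choice makes it at most e0 / ((d + 1)
   L). *)
have [kap hkap] := exp2_large (8 * (d%:R + 1) / e0).
have K0 : 0 < (2 ^ kap)%:R :> R by rewrite ltr0n expn_gt0.
have hK : 8 * (d%:R + 1) <= (2 ^ kap)%:R * e0 by rewrite -ler_pdivrMr.
exists (32 * (2 ^ kap)%:R * (kap%:R + 1)).
  by rewrite !mulr_gt0// ltr_wpDl.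
move=> T P v y V l V0 vV sep.
set L := (2 ^ l)%N; set Q := (2 ^ (kap + l))%N.
have L0 : 0 < L%:R :> R by rewrite ltr0n expn_gt0.
have QE : Q%:R = (2 ^ kap)%:R * L%:R :> R by rewrite -natrM /Q expnD.
have Qn : (0 < Q)%N by rewrite expn_gt0.
have Q0 : 0 < Q%:R :> R by rewrite ltr0n.
have p4 : pi < 4 :> R by have := pihalf_lt2 R; rewrite ltr_pdivrMr//; lra.
have p2 : 2 <= pi :> R by exact: pi_ge2.
pose delta : R := 2 * pi / Q%:R.
have delta0 : 0 < delta by rewrite divr_gt0// mulr_gt0//; lra.
have dQ : delta * Q%:R = 2 * pi by rewrite divfK// gt_eqF.
have dle : delta <= e0 / (d%:R + 1) / L%:R.
  rewrite /delta QE ler_pdivrMr ?mulr_gt0//.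
  rewrite (_ : e0 / _ / _ * _ = (2 ^ kap)%:R * e0 / (d%:R + 1)); last first.
    by field; rewrite gt_eqF//= gt_eqF// ltr_wpDl.
  by rewrite ler_pdivlMr ?ltr_wpDl//; apply: le_trans hK; rewrite ler_pM2r ?ltr_wpDl//; lra.
have dL : L%:R * delta <= 2.
  apply: (@le_trans _ _ (e0 / (d%:R + 1))).
    by rewrite mulrC -ler_pdivlMr.
  rewrite ler_pdivrMr ?ltr_wpDl//; have := ler0n R d; lra.
(* After [y] is reduced to [z] in [0, 2 pi), all values z - v lie within Pn periods on either side
   of 0, as V <= Pn - 1. *)
pose Pn := (Num.truncn V).+2.
have /andP[Pn1 Pn2] : V + 1 <= Pn%:R <= V + 2.
  have /andP[h1 h2] := truncn_itv V0.
  move: h2; rewrite /Pn -!natr1; lra.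
pose z i := y i - 2 * pi * (Num.floor (y i / (2 * pi)))%:~R.
have z02 i : 0 <= z i < 2 * pi.
  have /andP[h1 h2] := floor_itv (y i / (2 * pi)).
  have pp : 0 < 2 * pi :> R by lra.
  rewrite ler_pdivlMr// in h1; rewrite ltr_pdivrMr// intrD in h2.
  by rewrite /z; lra.
pose M := (2 * Pn * Q)%N.
have M0 : (0 < M)%N by rewrite !muln_gt0.
pose idx n i : nat := absz (Num.floor ((z i - v n i) / delta) + (Q * Pn)%:Z).
have vPn n i : P n -> `|v n i| <= 2 * pi * (Pn%:R - 1).
  move=> /(vV _ i) /le_trans; apply; apply: (@le_trans _ _ (1 * (Pn%:R - 1))); first lra.
  by apply: ler_wpM2r; lra.
have flb n i : P n -> (- (Q * Pn)%:Z <= Num.floor ((z i - v n i) / delta))%R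
    /\ (Num.floor ((z i - v n i) / delta) < (Q * Pn)%:Z)%R.
  move=> Pnn; have := vPn n i Pnn; rewrite ler_norml => /andP[v1 v2].
  have := z02 i => /andP[z1 z2].
  have hQP : (Q * Pn)%:R * delta = 2 * pi * Pn%:R by rewrite natrM mulrAC (mulrC Q%:R) dQ.
  split.
    rewrite floor_ge_int mulrNz ler_pdivlMr// mulNr.
    by rewrite -[X in X * delta]/((Q * Pn)%:R) hQP; lra.
  rewrite -(ltr_int R); apply: le_lt_trans (floor_le _) _.
  rewrite ltr_pdivrMr// -[X in _ < X * delta]/((Q * Pn)%:R) hQP; lra.
have idxE n i : P n -> (idx n i)%:R = (Num.floor ((z i - v n i) / delta))%:~R + (Q * Pn)%:R :> R.
  move=> Pnn; have [f1 f2] := flb n i Pnn.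
  rewrite /idx -[LHS]/((`|_|%N : int)%:~R) gez0_abs; last by rewrite -lerBlDr sub0r.
  by rewrite intrD.
have idxM n i : P n -> (idx n i < M)%N.
  move=> Pnn; have [f1 f2] := flb n i Pnn.
  by rewrite /M -mulnA (mulnC Pn); exact: absz_shift_lt.
have idx_near n i : P n -> `|z i - v n i + 2 * pi * Pn%:R - delta * (idx n i)%:R| < delta.
  move=> Pnn; have e : delta * (Q * Pn)%:R = 2 * pi * Pn%:R by rewrite natrM mulrA dQ.
  rewrite idxE// (mulrDr delta) e.
  have /andP[h1 h2] := floor_itv ((z i - v n i) / delta).
  rewrite ler_pdivlMr// in h1; rewrite ltr_pdivrMr// intrD in h2.
  by rewrite ltr_norml; lra.
(* [inord] needs a bound of the form of a successor. *)
pose M' := M.-1.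
have ME : M = M'.+1 by rewrite prednK.
pose cell n : {ffun 'I_d -> 'I_M'.+1} := [ffun i => inord (idx n i)].
have cellE n i : P n -> (cell n i : nat) = idx n i.
  by move=> Pnn; rewrite ffunE inordK// -ME idxM.
pose g (c : nat) : R := 2 * dirichlet_majorant L (delta * c%:R).
have g0 c : 0 <= g c by rewrite mulr_ge0// dirichlet_majorant_ge0.
apply: (@le_trans _ _ (\sum_(n | P n) \prod_i g (cell n i))).
  apply: ler_sum => n Pnn; apply: ler_prod => i _; rewrite dirichlet_majorant_ge0 /=.
  rewrite cellE// /g.
  have -> : dirichlet_majorant L (y i - v n i) =
      dirichlet_majorant L (z i - v n i + 2 * pi * Pn%:R).
    rewrite dirichlet_majorant_period -(dirichlet_majorant_periodz _ (z i - v n i) (Num.floor (y i / (2 * pi)))).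
    by congr dirichlet_majorant; rewrite /z; ring.
  apply: dirichlet_majorant_slow; apply: le_trans dL.
  by apply: ler_wpM2l => //; apply/ltW/idx_near.
apply: (@le_trans _ _ (\sum_(c : {ffun 'I_d -> 'I_M'.+1}) \prod_i g (c i))).
  apply: (@sum_over_injective_le R _ _ P cell (fun c => \prod_i g (c i))); last first.
    by move=> c; apply: prodr_ge0.
  move=> n n' Pnn Pnn' ceq; apply/eqP/negPn/negP => /(sep _ _ Pnn Pnn').
  apply/negP; rewrite -ltNge.
  (* Two points in one cell differ by at most delta in every coordinate, and d delta^2 < (e0 / L)^2
     contradicts their separation. *)
  have dif i : (v n i - v n' i) ^+ 2 <= delta ^+ 2.
    rewrite -(real_normK (num_real (_ - _))); apply: lerXn2r; rewrite ?nnegrE ?(ltW delta0)//.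
    have e : Num.floor ((z i - v n i) / delta) = Num.floor ((z i - v n' i) / delta).
      apply: (@intr_inj R); apply: (addIr (Q * Pn)%:R).
      by rewrite -!idxE// -(cellE n)// -(cellE n')// ceq.
    have /andP[h1 h2] := floor_itv ((z i - v n i) / delta).
    have /andP[h1' h2'] := floor_itv ((z i - v n' i) / delta).
    rewrite -e in h1' h2'.
    rewrite ler_pdivlMr// in h1; rewrite ltr_pdivrMr// intrD in h2.
    rewrite ler_pdivlMr// in h1'; rewrite ltr_pdivrMr// intrD in h2'.
    rewrite ler_norml; lra.
  apply: (@le_lt_trans _ _ (d%:R * delta ^+ 2)).
    rewrite -[d%:R]/(d%:R) mulr_natl -[X in _ *+ X](card_ord d) -sumr_const.
    by apply: ler_sum => i _; exact: dif.
  apply: (@le_lt_trans _ _ (d%:R * (e0 / (d%:R + 1) / L%:R) ^+ 2)).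
    by apply: ler_wpM2l => //; apply: lerXn2r; rewrite ?nnegrE ?(ltW delta0)// !divr_ge0 ?ltW ?ltr_wpDl.
  have -> : d%:R * (e0 / (d%:R + 1) / L%:R) ^+ 2 = (e0 / L%:R) ^+ 2 * (d%:R / (d%:R + 1) ^+ 2).
    by field; rewrite gt_eqF//= gt_eqF// ltr_wpDl.
  rewrite -[ltRHS]mulr1 ltr_pM2l ?exprn_gt0 ?divr_gt0//.
  rewrite ltr_pdivrMr ?exprn_gt0 ?ltr_wpDl// mul1r sqrrD1.
  have := ler0n R d; have := sqr_ge0 (d%:R : R); lra.
rewrite -(bigA_distr_bigA (fun (i : 'I_d) (c : 'I_M'.+1) => g c)) /=.
rewrite prodr_const card_ord; apply: lerXn2r.
- by rewrite nnegrE; apply: sumr_ge0.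
- rewrite nnegrE !mulr_ge0// ?addr_ge0//.
rewrite -ME /M (@sum_periodic R g Q); last first.
  move=> c; rewrite /g natrD mulrDr dQ addrC -[2 * pi]mulr1.
  by rewrite (dirichlet_majorant_period L _ 1).
rewrite -mulr_sumr.
have := dirichlet_majorant_grid R kap l; rewrite -/Q -/L -/delta.
set S := \sum_(_ < Q) _ => hS.
have hS0 : 0 <= (2 * Pn)%:R :> R by [].
have hP : (2 * Pn)%:R <= 4 * (1 + V) by rewrite natrM; lra.
have S0 : 0 <= S by apply: sumr_ge0 => c _; exact: dirichlet_majorant_ge0.
have := ler_pM hS0 S0 hP hS.
lra.
Qed.

(** * Cutting a cube of frequencies into boxes *)

Section Boxes.
Local Open Scope nat_scope.
Context (A L : nat) (L0 : 0 < L).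

Lemma box_ord_subproof (n : 'I_A) (s : 'I_L) : L * n + s < A * L.
Proof.
have h1 := ltn_ord n; have h2 := ltn_ord s.
have : L * n.+1 <= L * A by rewrite leq_mul2l h1 orbT.
by rewrite mulnS (mulnC A); apply: leq_trans; rewrite addnC ltn_add2r.
Qed.
Definition box_ord (n : 'I_A) (s : 'I_L) : 'I_(A * L) := Ordinal (box_ord_subproof n s).

Lemma box_quo_subproof (f : 'I_(A * L)) : f %/ L < A.
Proof. by rewrite ltn_divLR. Qed.
Definition box_quo f : 'I_A := Ordinal (box_quo_subproof f).

Lemma box_rem_subproof (f : 'I_(A * L)) : f %% L < L.
Proof. by rewrite ltn_pmod. Qed.
Definition box_rem f : 'I_L := Ordinal (box_rem_subproof f).

(** Euclidean division by L in every coordinate: n is the quotient and s the remainder. *)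
Lemma sum_boxes (R : realType) (I : finType) (P : (I -> nat) -> bool) (F : (I -> nat) -> R) :
  (\sum_(f : {ffun I -> 'I_(A * L)} | P (fun i => f i)) F (fun i => f i) =
  \sum_(n : {ffun I -> 'I_A}) \sum_(s : {ffun I -> 'I_L} | P (fun i => L * n i + s i)%N)
     F (fun i => L * n i + s i)%N)%R.
Proof.
rewrite pair_big_dep /=.
pose h (p : {ffun I -> 'I_A} * {ffun I -> 'I_L}) := [ffun i => box_ord (p.1 i) (p.2 i)].
pose h' (f : {ffun I -> 'I_(A * L)}) := ([ffun i => box_quo (f i)], [ffun i => box_rem (f i)]).
have hh' : cancel h h'.
  move=> [n s]; congr pair; apply/ffunP => i; rewrite !ffunE; apply: val_inj => /=.
    by rewrite mulnC divnMDl// divn_small// addn0.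
  by rewrite mulnC modnMDl modn_small.
have h'h : cancel h' h.
  move=> f; apply/ffunP => i; rewrite !ffunE; apply: val_inj => /=.
  by rewrite ?ffunE /= mulnC -divn_eq.
rewrite (reindex h); last by exists h' => ? _; [exact: hh'|exact: h'h].
have hE p : (fun i => h p i : nat) = (fun i => L * p.1 i + p.2 i).
  by apply/funext => i; rewrite ffunE.
by apply: eq_big => [p|p _]; rewrite hE.
Qed.
End Boxes.

(** * Dyadic shells of frequencies *)

Section Shell.
Context (R : realType) (d : nat).

(* Frequencies [k] with [-2^(j+1) <= k_i < 2^(j+1)] are encoded by [f = k + 2^(j+1)]. *)
Definition shell_vec (j : nat) (f : 'I_d -> nat) (i : 'I_d) : R := (f i)%:R - (2 ^ j.+1)%:R.

(** The complement of the inner cube: 2^j and 3 * 2^j encode the coordinates -2^j and 2^j. *)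
Definition in_shell (j : nat) (f : 'I_d -> nat) : bool :=
  [exists i, (f i < 2 ^ j)%N || (3 * 2 ^ j <= f i)%N].

Definition phase (alpha t beta : R) (x k : 'I_d -> R) : R :=
  \sum_i x i * k i - t * enorm k `^ alpha + beta.

Lemma in_shell_enorm j f : in_shell j f -> (2 ^ j)%:R <= enorm (shell_vec j f).
Proof.
move=> /existsP[i /orP hi]; apply: le_trans (coord_le_enorm _ i).
rewrite /shell_vec expnS natrM; case: hi => h.
  have : (f i).+1%:R <= (2 ^ j)%:R :> R by rewrite ler_nat.
  rewrite -natr1 ler_normr => h'; apply/orP; right; lra.
have : (3 * 2 ^ j)%:R <= (f i)%:R :> R by rewrite ler_nat.
rewrite natrM ler_normr => h'; apply/orP; left; lra.
Qed.

Lemma shell_enorm_le j (f : 'I_d -> nat) : (0 < d)%N -> (forall i, (f i < 2 ^ j.+2)%N) ->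
  enorm (shell_vec j f) <= (2 * d%:R) * (2 ^ j)%:R.
Proof.
move=> d0 fi; set B := (2 ^ j.+1)%:R : R.
have B0 : 0 <= B by [].
have vB i : `|shell_vec j f i| <= B.
  rewrite ler_norml /shell_vec -/B lerBlDr.
  have : (f i).+1%:R <= (2 ^ j.+2)%:R :> R by rewrite ler_nat.
  rewrite -natr1 expnS natrM -/B => h.
  by have h0 := ler0n R (f i); apply/andP; split; lra.
have -> : 2 * d%:R * (2 ^ j)%:R = d%:R * B by rewrite /B expnS natrM; ring.
have dB0 : 0 <= d%:R * B by rewrite mulr_ge0.
rewrite -[leRHS]ger0_norm// -sqrtr_sqr; apply: ler_wsqrtr.
apply: (@le_trans _ _ (\sum_(i < d) B ^+ 2)).
  apply: ler_sum => i _; rewrite -(real_normK (num_real (shell_vec _ _ _))).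
  by apply: lerXn2r; rewrite ?nnegrE.
rewrite sumr_const card_ord -[leLHS]mulr_natl exprMn; apply: ler_wpM2r; first exact: exprn_ge0.
by rewrite -natrX ler_nat leq_pmulr.
Qed.

(** The side 2^l divides 2^j, so no box crosses the boundary of the inner cube. *)
Lemma shell_box j l (n s : 'I_d -> nat) : (l <= j)%N -> (forall i, (s i < 2 ^ l)%N) ->
  in_shell j (fun i => 2 ^ l * n i + s i)%N = in_shell j (fun i => 2 ^ l * n i)%N.
Proof.
move=> lj sl; rewrite /in_shell; apply: eq_existsb => i.
have -> : (2 ^ j = 2 ^ l * 2 ^ (j - l))%N by rewrite -expnD subnKC.
have L0 : (0 < 2 ^ l)%N by rewrite expn_gt0.
rewrite mulnCA; move: (sl i) L0; set L := (2 ^ l)%N; set a := (2 ^ (j - l))%N => si L0.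
have lt b : (L * n i + s i < L * b)%N = (L * n i < L * b)%N.
  apply/idP/idP; first by apply: leq_ltn_trans; rewrite leq_addr.
  rewrite ltn_pmul2l// => h; apply: (@leq_trans (L * (n i).+1)); first by rewrite mulnS addnC ltn_add2r.
  by rewrite leq_pmul2l.
by rewrite lt !(leqNgt (L * _)) lt.
Qed.

End Shell.

Lemma exprD_le (R : realType) (a b : R) (d : nat) : 0 <= a -> 0 <= b ->
  (a + b) ^+ d <= 2 ^+ d * (a ^+ d + b ^+ d).
Proof.
move=> a0 b0; wlog ab : a b a0 b0 / a <= b.
  by move=> H; case: (leP a b) => [/H->//|/ltW/H]; rewrite addrC (addrC (b ^+ _)); exact.
apply: (@le_trans _ _ ((2 * b) ^+ d)).
  by apply: lerXn2r; rewrite ?nnegrE ?addr_ge0 ?mulr_ge0//; lra.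
by rewrite exprMn; apply: ler_wpM2l; rewrite ?exprn_ge0// lerDr exprn_ge0.
Qed.

Section Powers.
Context (R : realType) (d : nat) (N t L alpha theta : R).
Hypothesis (d2 : (2 <= d)%N) (N1 : 1 <= N) (t01 : 0 < t <= 1) (L0 : 0 < L) (LN : L <= N).
Hypothesis (al0 : 0 < alpha) (tL : t * N `^ (alpha - 2) * L ^+ 2 <= 1).

Let N0 : 0 < N. Proof. exact: lt_le_trans N1. Qed.
Let t0 : 0 < t. Proof. by case/andP: t01. Qed.

Let tLN : t * N `^ alpha * L ^+ 2 <= N ^+ 2.
Proof.
have := tL; rewrite powRB2// => h.
have -> : t * N `^ alpha * L ^+ 2 = t * (N `^ alpha / N ^+ 2) * L ^+ 2 * N ^+ 2.
  by field; rewrite gt_eqF.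
by rewrite -[leRHS]mul1r; apply: ler_wpM2r => //; rewrite exprn_ge0// ltW.
Qed.

(** With s = t N^alpha the hypotheses say L^2 <= N^2 and L^2 <= N^2 / s, hence L^2 <= N^2
    s^(-theta). The other d - 2 factors are at most N, which uses d >= 2. *)
Lemma side_pow_le1 : 0 <= theta <= 1 -> L ^+ d <= N `^ (d%:R - alpha * theta) * t `^ (- theta).
Proof.
move=> /andP[th0 th1].
set s := t * N `^ alpha.
have s0 : 0 < s by rewrite mulr_gt0// powR_gt0.
have -> : N `^ (d%:R - alpha * theta) * t `^ (- theta) = N ^+ d * s `^ (- theta).
  rewrite powRD; last by rewrite (gt_eqF N0) implybT.
  rewrite (powR_mulrn d (ltW N0)) /s powRM ?powR_ge0 ?(ltW t0)//.
  by rewrite -powRrM mulrN -mulrA; congr (_ * _); rewrite mulrC.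
have L2 : L ^+ 2 <= N ^+ 2 * s `^ (- theta).
  case: (leP s 1) => s1.
    apply: (@le_trans _ _ (N ^+ 2 * 1)).
      by rewrite mulr1; apply: lerXn2r; rewrite ?nnegrE// ltW.
    apply: ler_wpM2l; first by rewrite exprn_ge0// ltW.
    have := @ger_powR R s; rewrite s0 s1 => /(_ isT (- theta) 0).
    by rewrite powRr0; apply; lra.
  apply: (@le_trans _ _ (N ^+ 2 * s `^ (-1))).
    by rewrite powR_inv1 ?(ltW s0)// ler_pdivlMr// mulrC.
  apply: ler_wpM2l; first by rewrite exprn_ge0// ltW.
  by apply: ler_powR; [exact: ltW|lra].
have e (u : R) : u ^+ d = u ^+ 2 * u ^+ (d - 2) by rewrite -exprD subnKC.
rewrite !e [leRHS]mulrAC; apply: ler_pM => //; rewrite ?exprn_ge0 ?(ltW L0)//.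
by apply: lerXn2r; rewrite ?nnegrE// ltW.
Qed.

(** The square of the base is t N^alpha times t N^alpha L^2 / N^2, and the second factor is at most
    1. *)
Lemma side_pow_le2 : (L * (t * N `^ (alpha - 1))) ^+ d <= N `^ (d%:R * alpha / 2).
Proof.
have -> : N `^ (d%:R * alpha / 2) = (N `^ (alpha / 2)) ^+ d.
  rewrite -(powR_mulrn d (powR_ge0 N (alpha / 2))) -powRrM.
  by congr (_ `^ _); ring.
have x0 : 0 <= L * (t * N `^ (alpha - 1)).
  by rewrite !mulr_ge0// ?powR_ge0// ltW.
apply: lerXn2r; rewrite ?nnegrE ?powR_ge0//.
rewrite -ler_sqr ?nnegrE ?powR_ge0//.
rewrite -(powR_mulrn 2 (powR_ge0 N (alpha / 2))) -powRrM (_ : alpha / 2 * 2%:R = alpha); last by field.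
have -> : N `^ (alpha - 1) = N `^ alpha / N.
  rewrite powRD; last by rewrite (gt_eqF N0) implybT.
  by rewrite powR_inv1// ltW.
have := tLN; set P := N `^ alpha => tPL.
have P0 : 0 < P by rewrite powR_gt0.
have -> : (L * (t * (P / N))) ^+ 2 = t * P * (t * P * L ^+ 2 / N ^+ 2).
  by field; rewrite gt_eqF.
have h : t * P * L ^+ 2 / N ^+ 2 <= 1 by rewrite ler_pdivrMr ?mul1r ?exprn_gt0.
have tP : t * P <= P by rewrite ler_piMl ?(ltW P0)//; case/andP: t01.
by rewrite -[leRHS]mulr1; apply: ler_pM => //; rewrite ?divr_ge0 ?mulr_ge0 ?exprn_ge0 ?(ltW t0) ?(ltW P0) ?(ltW L0) ?(ltW N0).
Qed.
End Powers.

Section ShellKernel.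
Context (R : realType) (d : nat).

Lemma shell_kernel_card (j : nat) (phi : {ffun 'I_d -> 'I_(2 ^ j.+2)} -> R) :
  `|\sum_(f : {ffun 'I_d -> 'I_(2 ^ j.+2)} | in_shell j (fun i => f i)) cos (phi f)| <=
   ((2 ^ j.+2)%:R) ^+ d.
Proof.
apply: le_trans (ler_norm_sum _ _ _) _.
apply: (@le_trans _ _ (\sum_(f : {ffun 'I_d -> 'I_(2 ^ j.+2)}) 1)).
  by rewrite big_mkcond; apply: ler_sum => f _; case: ifP => // _; exact: cos_max.
by rewrite sumr_const card_ffun !card_ord -natrX ler_nat.
Qed.

Lemma shell_kernel_boxes (j l : nat) (P : (_ -> nat) -> bool) (F : ('I_d -> nat) -> R) : (l <= j.+2)%N ->
  (\sum_(f : {ffun 'I_d -> 'I_(2 ^ j.+2)} | P (fun i => f i)) F (fun i => f i) =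
  \sum_(n : {ffun 'I_d -> 'I_(2 ^ (j.+2 - l))})
   \sum_(s : {ffun 'I_d -> 'I_(2 ^ l)} | P (fun i => 2 ^ l * n i + s i)%N)
     F (fun i => 2 ^ l * n i + s i)%N)%R.
Proof.
move=> lj; have -> : (2 ^ j.+2 = 2 ^ (j.+2 - l) * 2 ^ l)%N by rewrite -expnD subnK.
by apply: sum_boxes; rewrite expn_gt0.
Qed.

(** The boxes get the largest admissible dyadic side L. By maximality t N^(alpha - 2) L^2 is of
    order 1, which separates the gradients by about 1 / L. If the shell is small or L is comparable
    to N, counting the frequencies is enough. *)
Lemma shell_kernel_bound (alpha : R) : (2 <= d)%N -> 0 < alpha < 2 -> alpha != 1 ->
  exists2 C : R, 0 < C & forall (j : nat) (t theta beta : R) (x : 'I_d -> R),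
    0 < t <= 1 -> 0 <= theta <= 1 ->
    `|\sum_(f : {ffun 'I_d -> 'I_(2 ^ j.+2)} | in_shell j (fun i => f i))
        cos (phase alpha t beta x (shell_vec R j (fun i => f i)))| <=
    C * (j%:R + 1) ^+ d *
     (((2 ^ j)%:R) `^ (d%:R - alpha * theta) * t `^ (- theta) + ((2 ^ j)%:R) `^ (d%:R * alpha / 2)).
Proof.
move=> d2 /[dup] al02 /andP[al0 al2] al1.
have d1 : 1 <= d%:R :> R by rewrite ler1n (leq_trans _ d2).
(* For l <= j - m the side 2^l satisfies 6 d L <= N, as [box_sum_bound] requires. *)
have [m hm] := exp2_large (6 * d%:R : R).
(* Corners at distance at least L have gradients at distance at least t alpha |alpha - 1| (2 d
   N)^(alpha - 2) L; the 1/4 is that of [tL4]. *)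
pose a1 := alpha * `|alpha - 1| * (2 * d%:R) `^ (alpha - 2) / 4.
have a10 : 0 < a1.
  by rewrite divr_gt0// mulr_gt0 ?powR_gt0//; [rewrite mulr_gt0// normr_gt0 subr_eq0|lra].
pose e0 := Num.min 1 a1.
have e01 : 0 < e0 <= 1 by rewrite lt_min ltr01 a10 /= ge_min lexx.
have e0a : e0 <= a1 by rewrite ge_min lexx orbT.
have [C1 C10 HC1] := separated_sum_bound d e01.
pose E := 2 * expR (46 * d%:R ^+ 2) : R.
have E0 : 0 < E by rewrite mulr_gt0// expR_gt0.
pose Ca := ((2 ^ m.+2)%:R) ^+ d : R.
pose Cb := E * 8 ^+ d * ((C1 * (4 * d%:R)) ^+ d * 2 ^+ d).
have Ca0 : 0 < Ca by rewrite exprn_gt0// ltr0n expn_gt0.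
have c4 : 0 < C1 * (4 * d%:R) by apply: mulr_gt0 => //; lra.
have Cb0 : 0 < Cb by apply: mulr_gt0; apply: mulr_gt0; rewrite ?exprn_gt0.
exists (Ca + Cb); first exact: addr_gt0.
move=> j t theta beta x t01 th01; have /andP[t0 t1] := t01.
set N := (2 ^ j)%:R : R.
have N1 : 1 <= N by rewrite ler1n expn_gt0.
have N0 : 0 < N by exact: lt_le_trans N1.
set X := N `^ _ * _; set Y := N `^ (_ / _).
have X0 : 0 <= X by rewrite mulr_ge0 ?powR_ge0.
have Y0 : 0 <= Y by rewrite powR_ge0.
have J1 : 1 <= (j%:R + 1) ^+ d :> R.
  by rewrite exprn_ege1// lerDr.
(* the number of frequencies already suffices when a cube has the size of the shell *)
have trivial (D : R) : ((2 ^ j.+2)%:R) ^+ d <= D * (X + Y) -> 0 <= D -> D <= Ca + Cb ->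
  ((2 ^ j.+2)%:R) ^+ d <= (Ca + Cb) * (j%:R + 1) ^+ d * (X + Y).
  move=> h D0 DC; apply: le_trans h _; apply: ler_wpM2r; first exact: addr_ge0.
  by apply: le_trans DC _; rewrite ler_peMr// ltW// addr_gt0.
case: (ltnP j m) => [jm|mj].
  apply: le_trans (shell_kernel_card _) _; apply: (trivial Ca); [|exact: ltW|by rewrite lerDl ltW].
  apply: (@le_trans _ _ (Ca * 1)).
    by rewrite mulr1 /Ca; apply: lerXn2r; rewrite ?nnegrE// ler_nat leq_exp2l// !ltnS ltnW.
  apply: ler_wpM2l; first exact: ltW.
  have : 1 <= Y.
    have := @ler_powR _ N N1 0 (d%:R * alpha / 2); rewrite powRr0; apply.
    by rewrite divr_ge0// mulr_ge0// ltW.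
  by lra.
pose P l := (l <= j - m)%N && (t * N `^ (alpha - 2) * ((2 ^ l)%:R) ^+ 2 <= 1).
have P0 : P 0%N.
  rewrite /P leq0n /= expn0 expr1n mulr1.
  have h : N `^ (alpha - 2) <= 1.
    by have := @ler_powR _ N N1 (alpha - 2) 0; rewrite powRr0; apply; lra.
  by rewrite -[leRHS]mulr1; apply: ler_pM => //; rewrite ?powR_ge0// ltW.
have Pub l : P l -> (l <= j - m)%N by case/andP.
have exP : exists l, P l by exists 0%N.
case: (ex_maxnP exP Pub) => l /andP[ljm tL] lmax.
have lj : (l <= j)%N by exact: leq_trans ljm (leq_subr _ _).
have lj2 : (l <= j.+2)%N by rewrite (leq_trans lj)// -addn2 leq_addr.
set L := (2 ^ l)%N in tL *.
have L0 : 0 < L%:R :> R by rewrite ltr0n expn_gt0.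
have LN : L%:R <= N by rewrite ler_nat leq_exp2l.
have LX : L%:R ^+ d <= X by apply: side_pow_le1.
have LY : (L%:R * (t * N `^ (alpha - 1))) ^+ d <= Y by apply: side_pow_le2.
case: (eqVneq l (j - m)%N) => [le|lne].
  apply: le_trans (shell_kernel_card _) _; apply: (trivial Ca); [|exact: ltW|by rewrite lerDl ltW].
  have -> : (2 ^ j.+2 = 2 ^ m.+2 * L)%N by rewrite /L -expnD le !addSn subnKC.
  rewrite natrM exprMn; apply: ler_wpM2l; first exact: ltW.
  by apply: le_trans LX _; rewrite lerDl.
(* The side 2 L violates the condition on t, and doubling the side costs a factor 4. *)
have tL4 : 1 / 4 <= t * N `^ (alpha - 2) * L%:R ^+ 2.
  have : ~~ P l.+1 by apply/negP => /lmax; rewrite ltnn.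
  rewrite /P negb_and -!ltnNge -ltNge => /orP[|]; first by rewrite ltnS leqNgt ltn_neqAle lne ljm.
  rewrite expnS natrM exprMn -/L => /ltW h; rewrite ler_pdivrMr//.
  by apply: le_trans h _; rewrite le_eqVlt; apply/orP; left; apply/eqP; ring.
rewrite (@shell_kernel_boxes j l _ (fun f => cos (phase alpha t beta x (shell_vec R j f))) lj2).
pose k0 (n : {ffun 'I_d -> 'I_(2 ^ (j.+2 - l))}) := shell_vec R j (fun i => L * n i)%N.
pose Q (n : {ffun 'I_d -> 'I_(2 ^ (j.+2 - l))}) := in_shell j (fun i => L * n i)%N.
rewrite (eq_bigr (fun n => if Q n then \sum_(s : {ffun 'I_d -> 'I_L})
    cos (phase alpha t beta x (shell_vec R j (fun i => L * n i + s i)%N)) else 0)); last first.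
  move=> n _; rewrite big_mkcond; case: ifP => Qn.
    by apply: eq_bigr => s _; rewrite shell_box// -/(Q n) Qn.
  by apply: big1 => s _; rewrite shell_box// -/(Q n) Qn.
rewrite -big_mkcond; apply: le_trans (ler_norm_sum _ _ _) _.
pose v n i := t * alpha * enorm (k0 n) `^ (alpha - 2) * k0 n i.
have k0N n : Q n -> N <= enorm (k0 n) by exact: in_shell_enorm.
have k0L n : enorm (k0 n) <= (2 * d%:R) * N.
  apply: shell_enorm_le => [|i]; first exact: leq_trans d2.
  have := ltn_ord (n i); rewrite -(ltn_pmul2l (_ : 0 < L)%N) ?expn_gt0// => h.
  by apply: leq_trans h _; rewrite -expnD subnKC.
have step1 n : Q n -> `|\sum_(s : {ffun 'I_d -> 'I_L})
    cos (phase alpha t beta x (shell_vec R j (fun i => L * n i + s i)%N))| <=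
    E * 8 ^+ d * \prod_i dirichlet_majorant L (x i - v n i).
  move=> Qn.
  have Ln : (0 < L)%N by rewrite expn_gt0.
  have := @box_sum_bound R d L Ln (k0 n) x N t alpha (beta + \sum_i x i * k0 n i)
    al02 (ltW t0) N0 (k0N n Qn) _ LN tL.
  rewrite big_split prodr_const card_ord /= mulrA -/E => H.
  under eq_bigr => s _.
    rewrite (_ : phase _ _ _ _ _ = \sum_i x i * (s i)%:R
       - t * enorm (fun i => k0 n i + (s i)%:R) `^ alpha + (beta + \sum_i x i * k0 n i)); last first.
      rewrite /phase.
      have -> : shell_vec R j (fun i => L * n i + s i)%N = (fun i => k0 n i + (s i)%:R).
        by apply/funext => i; rewrite /k0 /shell_vec natrD; ring.
      under eq_bigr do rewrite mulrDr.
      by rewrite big_split /=; ring.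
    over.
  apply: H.
  have -> : N = (2 ^ m)%:R * (2 ^ (j - m))%:R by rewrite -natrM -expnD subnKC.
  by apply: ler_pM => //; rewrite ?mulr_ge0// ler_nat leq_exp2l.
apply: le_trans (ler_sum _ step1) _.
rewrite -mulr_sumr.
pose V := 4 * d%:R * (t * N `^ (alpha - 1)).
have tN0 : 0 <= t * N `^ (alpha - 1) by rewrite mulr_ge0 ?powR_ge0// ltW.
have V0 : 0 <= V by apply: mulr_ge0 => //; exact: mulr_ge0.
have vV n i : Q n -> `|v n i| <= V.
  move=> Qn; have r0 : 0 < enorm (k0 n) by exact: lt_le_trans (k0N n Qn).
  rewrite /v !normrM (ger0_norm (ltW t0)) (ger0_norm (ltW al0)) ger0_norm ?powR_ge0//.
  apply: (@le_trans _ _ (t * alpha * (enorm (k0 n) `^ (alpha - 2) * enorm (k0 n)))).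
    rewrite -mulrA; apply: ler_wpM2l; first by rewrite mulr_ge0 ?ltW.
    by apply: ler_wpM2l; [rewrite powR_ge0|exact: coord_le_enorm].
  have -> : enorm (k0 n) `^ (alpha - 2) * enorm (k0 n) = enorm (k0 n) `^ (alpha - 1).
    rewrite (_ : alpha - 1 = (alpha - 2) + 1); last by ring.
    by rewrite [RHS]powRD; [rewrite powRr1// ltW|rewrite (gt_eqF r0) implybT].
  (* The sign of alpha - 1 decides whether |k0| <= 2 d N or |k0| >= N is used. *)
  have rle : enorm (k0 n) `^ (alpha - 1) <= (2 * d%:R) * N `^ (alpha - 1).
    case: (leP 1 alpha) => a1'.
      apply: (@le_trans _ _ ((2 * d%:R * N) `^ (alpha - 1))).
        apply: ge0_ler_powR; rewrite ?nnegrE ?(ltW r0) ?mulr_ge0 ?(ltW N0)//; clear -a1'; lra.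
      rewrite powRM ?mulr_ge0 ?(ltW N0)//; apply: ler_wpM2r; first exact: powR_ge0.
      rewrite -[leRHS]powRr1; last by rewrite mulr_ge0.
      by apply: ler_powR; clear -d1 al2; lra.
    apply: (@le_trans _ _ (1 * N `^ (alpha - 1))); last first.
      by apply: ler_wpM2r; [rewrite powR_ge0|clear -d1; lra].
    rewrite mul1r (_ : alpha - 1 = - (1 - alpha)); last by ring.
    rewrite !powRN lef_pV2 ?posrE ?powR_gt0//.
    apply: ge0_ler_powR; rewrite ?nnegrE ?(ltW r0) ?(ltW N0) ?k0N//; clear -a1'; lra.
  have ta : 0 <= t * alpha by apply: mulr_ge0; exact: ltW.
  apply: le_trans (ler_wpM2l ta rle) _.
  rewrite (_ : V = 2 * (t * ((2 * d%:R) * N `^ (alpha - 1)))); last by rewrite /V; ring.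
  rewrite (_ : t * alpha * _ = alpha * (t * (2 * d%:R * N `^ (alpha - 1)))); last by ring.
  apply: ler_wpM2r; last exact: ltW.
  by apply: mulr_ge0; [exact: ltW|apply: mulr_ge0; [apply: mulr_ge0|exact: powR_ge0]].
have sep n n' : Q n -> Q n' -> n != n' ->
    (e0 / L%:R) ^+ 2 <= sqnorm (fun i => v n i - v n' i).
  move=> Qn Qn' nn'.
  have := @gradient_separation R 'I_d (k0 n) (k0 n') N (2 * d%:R) alpha N0 _ _ al02.
  rewrite k0N//= k0L k0N//= k0L => /(_ isT isT).
  set S := sqnorm _; set S' := sqnorm _ => HS.
  have kk : L%:R ^+ 2 <= S.
    have [i nii] : exists i, n i != n' i.
      apply/existsP; rewrite -negb_forall; apply: contra nn' => /forallP h.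
      by apply/eqP/ffunP => i; apply/eqP.
    rewrite /S /sqnorm (bigD1 i)//= -[leLHS]addr0; apply: lerD; last first.
      by apply: sumr_ge0 => ? _; exact: sqr_ge0.
    rewrite /k0 /shell_vec !natrM.
    rewrite (_ : _ - _ - (_ - _) = L%:R * ((n i)%:R - (n' i)%:R)); last by ring.
    rewrite exprMn ler_peMr ?exprn_ge0//.
    rewrite -(real_normK (num_real (_ - _))) exprn_ege1//.
    have nii' : (n i : nat) != n' i by apply: contra nii => /eqP /val_inj /eqP.
    rewrite ler_normr; case: (ltngtP (n i) (n' i)) nii' => // h _; apply/orP; [right|left].
      have : (n i).+1%:R <= (n' i)%:R :> R by rewrite ler_nat.
      by rewrite -natr1; clear; lra.
    have : (n' i).+1%:R <= (n i)%:R :> R by rewrite ler_nat.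
    by rewrite -natr1; clear; lra.
  have -> : sqnorm (fun i => v n i - v n' i) = (t * alpha) ^+ 2 * S'.
    rewrite /S' /sqnorm mulr_sumr; apply: eq_bigr => i _.
    rewrite /v -exprMn; congr (_ ^+ 2).
    by move: (k0 n i) (k0 n' i) (enorm (k0 n) `^ _) (enorm (k0 n') `^ _) => *; ring.
  have ta0 : 0 <= (t * alpha) ^+ 2 by exact: sqr_ge0.
  apply: le_trans (ler_wpM2l ta0 HS).
  rewrite powRM ?mulr_ge0 ?(ltW N0)//.
  set G := (2 * d%:R) `^ _; set H := N `^ _ in tL tL4 *.
  have G0 : 0 < G by rewrite powR_gt0//; clear -d1; lra.
  have H0 : 0 < H by rewrite powR_gt0.
  apply: (@le_trans _ _ ((t * alpha * (`|alpha - 1| * (G * H)) * L%:R) ^+ 2)).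
    apply: lerXn2r; rewrite ?nnegrE.
    - by rewrite divr_ge0// ltW//; case/andP: e01.
    - by rewrite !mulr_ge0// ?ltW.
    rewrite ler_pdivrMr//; apply: le_trans e0a _.
    rewrite /a1 -/G (_ : _ * L%:R * L%:R = (alpha * `|alpha - 1| * G) * (t * H * L%:R ^+ 2)); last by ring.
    apply: ler_wpM2l; first by rewrite !mulr_ge0// ?ltW.
    by rewrite -div1r.
  have -> : (t * alpha * (`|alpha - 1| * (G * H)) * L%:R) ^+ 2 =
      (t * alpha) ^+ 2 * (`|alpha - 1| ^+ 2 * (G * H) ^+ 2 * L%:R ^+ 2) by ring.
  rewrite real_normK ?num_real//; apply: ler_wpM2l => //.
  by apply: ler_wpM2l => //; apply: mulr_ge0; exact: sqr_ge0.
have := HC1 _ Q v x V l V0 vV sep; rewrite -/L => H1.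
have HE : 0 <= E * 8 ^+ d by rewrite mulr_ge0 ?exprn_ge0// ltW.
apply: le_trans (ler_wpM2l HE H1) _.
(* 1 + V counts the periods met by the gradients. Its two summands yield L^d, bounded by X, and (L t
   N^(alpha - 1))^d, bounded by Y. *)
have h1 : (C1 * (1 + V) * (L%:R * (l%:R + 1))) ^+ d <=
   (C1 * (4 * d%:R)) ^+ d * (j%:R + 1) ^+ d * (2 ^+ d * (X + Y)).
  apply: (@le_trans _ _ ((C1 * (4 * d%:R) * (j%:R + 1) * (L%:R + L%:R * (t * N `^ (alpha - 1)))) ^+ d)).
    have ljr : l%:R + 1 <= j%:R + 1 :> R by rewrite lerD2r ler_nat.
    have l0 := ler0n R l.
    apply: lerXn2r; rewrite ?nnegrE.
    - by rewrite !mulr_ge0 ?addr_ge0// ltW.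
    - apply: mulr_ge0; first by apply: mulr_ge0; [exact: ltW|exact: addr_ge0].
      by apply: addr_ge0; [exact: ltW|apply: mulr_ge0 => //; exact: ltW].
    have hV : 1 + V <= 4 * d%:R * (1 + t * N `^ (alpha - 1)) by rewrite mulrDr -/V; clear -d1; lra.
    have V1 : 0 <= 1 + V by exact: addr_ge0.
    have h := ler_pM V1 (_ : 0 <= l%:R + 1) hV ljr.
    have := h (addr_ge0 l0 ler01) => /(ler_wpM2l (mulr_ge0 (ltW C10) (ltW L0))).
    by set u := t * _; clear; lra.
  rewrite [leLHS]exprMn [(_ * (j%:R + 1)) ^+ d]exprMn; apply: ler_wpM2l.
    by apply: mulr_ge0; apply: exprn_ge0; [exact: ltW|exact: addr_ge0].
  apply: le_trans (exprD_le _ _ _) _; [exact: ltW|apply: mulr_ge0 => //; exact: ltW|].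
  by apply: ler_wpM2l; rewrite ?exprn_ge0//; exact: lerD.
apply: le_trans (ler_wpM2l HE h1) _.
rewrite (_ : _ * (_ * _ * _) = Cb * (j%:R + 1) ^+ d * (X + Y)); last by rewrite /Cb; ring.
apply: ler_wpM2r; first exact: addr_ge0.
by apply: ler_wpM2r; [exact: le_trans J1|rewrite lerDr ltW].
Qed.

End ShellKernel.

(** * The weighted kernel *)

Definition int_range (J : nat) : seq int := [seq i%:Z - (2 ^ J)%:Z | i <- iota 0 (2 ^ J.+1)].

Lemma mem_int_range J (a : int) : (a \in int_range J) = (- (2 ^ J)%:Z <= a < (2 ^ J)%:Z).
Proof.
have e : (2 ^ J.+1 = 2 ^ J + 2 ^ J)%N by rewrite expnS mul2n addnn.
apply/mapP/idP => [[i]|/andP[h1 h2]].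
  by rewrite mem_iota add0n e => ilt ->; move: ilt; set b := (2 ^ J)%N; clear; lia.
exists (absz (a + (2 ^ J)%:Z)).
  rewrite mem_iota add0n e; move: h1 h2; set b := (2 ^ J)%N; clear; lia.
move: h1 h2; set b := (2 ^ J)%N; clear; lia.
Qed.

Lemma int_range_uniq J : uniq (int_range J).
Proof. by rewrite map_inj_uniq ?iota_uniq// => i j /addIr []. Qed.

(* The dyadic cube [-2^J, 2^J)^n of frequencies. *)
Fixpoint cube (n J : nat) : seq (n.-tuple int) :=
  match n return seq (n.-tuple int) with
  | 0 => [:: [tuple]]
  | n'.+1 => [seq cons_tuple a k | a <- int_range J, k <- cube n' J]
  end.

Lemma cons_tuple_inj (T : Type) n (a b : T) (x y : n.-tuple T) :
  cons_tuple a x = cons_tuple b y -> a = b /\ x = y.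
Proof. by move=> /(congr1 val) [-> /val_inj ->]. Qed.

Lemma mem_cube n J (k : n.-tuple int) :
  (k \in cube n J) = [forall i, - (2 ^ J)%:Z <= tnth k i < (2 ^ J)%:Z].
Proof.
elim: n k => [|n IH] k.
  by rewrite tuple0 inE eqxx; apply/esym/forallP => -[].
case/tupleP: k => a k; apply/allpairsP/forallP => [[[a' k'] [/= h1 h2 e]] i|H].
  have [-> ->] := cons_tuple_inj e.
  case: (unliftP ord0 i) => [i' ->|->].
    by rewrite tnthS; move: h2; rewrite IH => /forallP; exact.
  by rewrite tnth0 -mem_int_range.
exists (a, k); split => //=.
  by rewrite mem_int_range; have := H ord0; rewrite tnth0.
by rewrite IH; apply/forallP => i; have := H (lift ord0 i); rewrite tnthS.
Qed.

Lemma cube_uniq n J : uniq (cube n J).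
Proof.
elim: n => [//|n IH]; apply: allpairs_uniq => //; first exact: int_range_uniq.
by move=> [a x] [b y] _ _ /= e; have [-> ->] := cons_tuple_inj e.
Qed.

Definition cshell (n J : nat) : seq (n.-tuple int) :=
  [seq k <- cube n J.+1 | k \notin cube n J].

Section CubeSums.
Context (R : realType) (d : nat).

Lemma cube_subset J : {subset cube d J <= cube d J.+1}.
Proof.
move=> k; rewrite !mem_cube => /forallP H; apply/forallP => i.
have := H i; rewrite expnS; set b := (2 ^ J)%N; clear; lia.
Qed.

Lemma sum_cubeS J (G : d.-tuple int -> R) :
  \sum_(k <- cube d J.+1) G k = \sum_(k <- cube d J) G k + \sum_(k <- cshell d J) G k.
Proof.
rewrite /cshell big_filter (bigID (mem (cube d J))) /=; congr (_ + _).
rewrite -big_filter; apply: perm_big; apply: uniq_perm.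
- exact/filter_uniq/cube_uniq.
- exact: cube_uniq.
move=> k; rewrite mem_filter; apply/andP/idP => [[]//|h]; split => //.
exact: cube_subset.
Qed.

Let tup (J : nat) (f : {ffun 'I_d -> 'I_(2 ^ J.+1)}) : d.-tuple int :=
  [tuple (f i)%:Z - (2 ^ J)%:Z | i < d].

Let tup_inj J : injective (@tup J).
Proof.
move=> f g /(congr1 (fun k => tnth k)) e; apply/ffunP => i; apply: val_inj.
by have := congr1 (@^~ i) e; rewrite !tnth_mktuple => /addIr [].
Qed.

Lemma sum_cube_ffun J (P : pred (d.-tuple int)) (G : d.-tuple int -> R) :
  \sum_(k <- cube d J | P k) G k =
  \sum_(f : {ffun 'I_d -> 'I_(2 ^ J.+1)} | P (tup f)) G (tup f).
Proof.
rewrite -(big_map (@tup J) P G) /=; apply: perm_big; apply: uniq_perm.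
- exact: cube_uniq.
- by rewrite map_inj_uniq ?index_enum_uniq//; exact: tup_inj.
move=> k; rewrite mem_cube; apply/forallP/mapP => [H|[f _ ->] i].
  have e : (2 ^ J.+1 = 2 ^ J + 2 ^ J)%N by rewrite expnS mul2n addnn.
  have hlt i : (absz (tnth k i + (2 ^ J)%:Z)%R < 2 ^ J.+1)%N.
    have /andP[] := H i; rewrite e; set b := (2 ^ J)%N; set a := tnth k i; clear; lia.
  exists [ffun i => Ordinal (hlt i)]; first by rewrite mem_index_enum.
  apply: eq_from_tnth => i; rewrite tnth_mktuple ffunE /=.
  by have := H i; set b := (2 ^ J)%N; clear; lia.
rewrite tnth_mktuple; have := ltn_ord (f i).
rewrite [X in (_ < X)%N](_ : _ = 2 ^ J + 2 ^ J)%N; last by rewrite expnS mul2n addnn.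
by move: (nat_of_ord (f i)) (2 ^ J)%N => a b; clear => h; apply/andP; split; lia.
Qed.

Lemma sum_cshell_ffun J (F : ('I_d -> R) -> R) :
  \sum_(k <- cshell d J) F (fun i => (tnth k i)%:~R) =
  \sum_(f : {ffun 'I_d -> 'I_(2 ^ J.+2)} | in_shell J (fun i => f i))
     F (shell_vec R J (fun i => f i)).
Proof.
rewrite /cshell big_filter sum_cube_ffun; apply: eq_big => [f|f _].
  rewrite mem_cube negb_forall /in_shell; apply: eq_existsb => i.
  rewrite tnth_mktuple; move: (nat_of_ord (f i)) => a; rewrite expnS.
  by move: (2 ^ J)%N => b; clear; lia.
congr F; apply/funext => i.
by rewrite tnth_mktuple /shell_vec intrB.
Qed.

Lemma card_cube J : size (cube d J) = ((2 ^ J.+1) ^ d)%N.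
Proof.
elim: d => [|n IH]; first by rewrite expn0.
by rewrite /= size_allpairs IH size_map size_iota -expnS.
Qed.
End CubeSums.

(** The frequencies of a cube, each tagged with the index of its shell. A weight that is constant on
    shells makes the kernel an exact combination of shell sums; the innermost cube shares the tag 0
    with the first shell. *)
Fixpoint levels (n J : nat) : seq (nat * n.-tuple int) :=
  if J is J'.+1 then levels n J' ++ [seq (J', k) | k <- cshell n J']
  else [seq (0%N, k) | k <- cube n 0].

Section Levels.
Context (R : realType) (d : nat).

Lemma sum_levels J (G : d.-tuple int -> R) :
  \sum_(q <- levels d J) G q.2 = \sum_(k <- cube d J) G k.
Proof.
elim: J => [|J IH]; first by rewrite /= big_map.
by rewrite sum_cubeS /= big_cat big_map IH.
Qed.

(** A frequency of the j-th shell has a coordinate of modulus at least 2^j. *)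
Lemma levels_weight J (gamma : R) q : 0 <= gamma -> q \in levels d J ->
  ((2 ^ q.1)%:R) `^ (2 * gamma) <= (1 + normk2 R q.2) `^ gamma.
Proof.
move=> g0; elim: J => [|J IH] /=.
  move=> /mapP[k _ ->] /=; rewrite expn0 powR1.
  apply: (@le_trans _ _ (1 `^ gamma)); first by rewrite powR1.
  have n0 : 0 <= normk2 R k by apply: sumr_ge0 => i _; exact: sqr_ge0.
  by apply: ge0_ler_powR; rewrite ?nnegrE ?addr_ge0// lerDl.
rewrite mem_cat => /orP[/IH//|/mapP[k + ->]] /=.
rewrite mem_filter mem_cube negb_forall => /andP[/existsP[i hi] _].
rewrite powRrM; apply: ge0_ler_powR; rewrite ?nnegrE ?powR_ge0//.
  by apply: addr_ge0 => //; apply: sumr_ge0 => j _; exact: sqr_ge0.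
rewrite (powR_mulrn 2)//.
apply: (@le_trans _ _ (normk2 R k)); last by rewrite lerDr.
rewrite /normk2 (bigD1 i)//= -[leLHS]addr0; apply: lerD; last first.
  by apply: sumr_ge0 => j _; exact: sqr_ge0.
rewrite -[leRHS]real_normK ?num_real//; apply: lerXn2r; rewrite ?nnegrE//.
rewrite -intr_norm -[leLHS]/(((2 ^ J)%:Z)%:~R) ler_int.
by move: hi; set b := (2 ^ J)%N; clear; lia.
Qed.

Lemma sum_levels_weighted J (w : nat -> R) (G : d.-tuple int -> R) :
  \sum_(q <- levels d J) w q.1 * G q.2 =
  w 0%N * \sum_(k <- cube d 0) G k + \sum_(j < J) w j * \sum_(k <- cshell d j) G k.
Proof.
elim: J => [|J IH]; first by rewrite big_ord0 addr0 /= big_map /= mulr_sumr.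
by rewrite big_ord_recr /= big_cat big_map IH /= -addrA -mulr_sumr.
Qed.
End Levels.

(** 2^(-eta j) = q^j q^j with q = exp (- c): one factor absorbs the polynomial, the other is
    summed. *)
Lemma poly_geom_sum_bounded (R : realType) (d : nat) (eta : R) : 0 < eta ->
  exists2 B : R, 0 < B & forall J, \sum_(j < J) (j%:R + 1) ^+ d * ((2 ^ j)%:R) `^ (- eta) <= B.
Proof.
move=> eta0.
pose c := eta / 2 * ln 2 : R.
have c0 : 0 < c by rewrite mulr_gt0 ?ln_gt0 ?ltr1n// divr_gt0.
have pe (j : nat) : ((2 ^ j)%:R) `^ (- eta) = expR (- c) ^+ j * expR (- c) ^+ j :> R.
  rewrite /powR gt_eqF ?ltr0n ?expn_gt0// natrX lnXn// -exprMn -expRD -expRM_natr.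
  by congr expR; rewrite /c -[ln 2 *+ j]mulr_natr; field.
pose q := expR (- c).
have q0 : 0 < q by exact: expR_gt0.
have q1 : q < 1 by rewrite /q expR_lt1; lra.
pose D := (d.+1)`!%:R / c ^+ d.+1 * expR c.
have D0 : 0 < D by rewrite mulr_gt0 ?expR_gt0// divr_gt0 ?exprn_gt0// ltr0n fact_gt0.
have poly (j : nat) : (j%:R + 1) ^+ d <= D * (expR c) ^+ j :> R.
  have j1 : 1 <= j%:R + 1 :> R by rewrite lerDr.
  apply: (@le_trans _ _ ((j%:R + 1) ^+ d.+1)); first exact: ler_weXn2l.
  have h := @expR_ge1Dxn R (c * (j%:R + 1)) d (_ : 0 <= c * (j%:R + 1)).
  have := h (mulr_ge0 (ltW c0) (le_trans ler01 j1)).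
  rewrite mulrDr mulr1 expRD expRM_natr => {}h.
  have f0 : 0 < (d.+1)`!%:R :> R by rewrite ltr0n fact_gt0.
  have : (c * j%:R + c) ^+ d.+1 / (d.+1)`!%:R <= expR c ^+ j * expR c.
    by apply: le_trans h; rewrite lerDr.
  rewrite ler_pdivrMr// (_ : c * j%:R + c = c * (j%:R + 1)); last by ring.
  rewrite exprMn mulrC -ler_pdivlMr ?exprn_gt0// => /le_trans; apply.
  by rewrite /D le_eqVlt; apply/orP; left; apply/eqP; ring.
exists (D / (1 - q)); first by rewrite divr_gt0// subr_gt0.
move=> J.
have geo : \sum_(j < J) q ^+ j <= (1 - q)^-1.
  have e : \sum_(j < J) q ^+ j * (1 - q) = 1 - q ^+ J.
    elim: J => [|J IH]; first by rewrite big_ord0 expr0 subrr.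
    by rewrite big_ord_recr /= IH exprS; ring.
  rewrite -[leRHS]mul1r ler_pdivlMr ?subr_gt0// mulr_suml e.
  by rewrite gerBl exprn_ge0// ltW.
apply: (@le_trans _ _ (\sum_(j < J) D * q ^+ j)).
  apply: ler_sum => j _; rewrite pe -/q.
  have h := poly j.
  have e : expR c * q = 1 by rewrite /q expRxMexpNx_1.
  have qq : expR c ^+ j * q ^+ j = 1 by rewrite -exprMn e expr1n.
  have qj : 0 <= q ^+ j * q ^+ j by rewrite mulr_ge0// exprn_ge0// ltW.
  apply: le_trans (ler_wpM2r qj h) _.
  rewrite [leLHS](_ : _ = D * (expR c ^+ j * q ^+ j) * q ^+ j); last by ring.
  by rewrite qq mulr1.
by rewrite -mulr_sumr; apply: ler_wpM2l => //; exact: ltW.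
Qed.

Section WeightedKernel.
Context (R : realType) (d : nat) (alpha gamma : R).

(** The phase of e^(i (k.x - |k|^alpha t)) after multiplication by e^(i beta); letting [beta] vary
    recovers a modulus from real parts. *)
Definition wave (beta t : R) (x : d.-tuple R) (k : d.-tuple int) : R :=
  dotk k x - normk R k `^ alpha * t + beta.

Definition level_weight (j : nat) : R := ((2 ^ j)%:R) `^ (2 * gamma).

Lemma level_weight_gt0 j : 0 < level_weight j.
Proof. by rewrite powR_gt0// ltr0n expn_gt0. Qed.

Definition kernel (J : nat) (beta t : R) (x : d.-tuple R) : R :=
  \sum_(q <- levels d J) (level_weight q.1)^-1 * cos (wave beta t x q.2).

Lemma sum_cube0_cos_le (beta t : R) (x : d.-tuple R) :
  `|\sum_(k <- cube d 0) cos (wave beta t x k)| <= 2 ^+ d.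
Proof.
apply: le_trans (ler_norm_sum _ _ _) _.
apply: (@le_trans _ _ (\sum_(k <- cube d 0) 1)).
  by apply: ler_sum => k _; exact: cos_max.
by rewrite big_const_seq count_predT card_cube iter_addr addr0 natrX.
Qed.

Lemma sum_cshell_cos (J : nat) (beta t : R) (x : d.-tuple R) :
  \sum_(k <- cshell d J) cos (wave beta t x k) =
  \sum_(f : {ffun 'I_d -> 'I_(2 ^ J.+2)} | in_shell J (fun i => f i))
    cos (phase alpha t beta (tnth x) (shell_vec R J (fun i => f i))).
Proof.
rewrite -(sum_cshell_ffun J (fun k => cos (phase alpha t beta (tnth x) k))).
apply: eq_bigr => k _; congr (cos (_ - _ + _)); last by rewrite mulrC.
by apply: eq_bigr => i _; rewrite mulrC.
Qed.

Lemma kernel_bound_from_shells (T eta C t beta : R) (x : d.-tuple R) B J :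
  1 <= T -> 0 <= C ->
  (forall j, `|\sum_(k <- cshell d j) cos (wave beta t x k)| <=
     C * (j%:R + 1) ^+ d * (((2 ^ j)%:R) `^ (2 * gamma - eta) * T)) ->
  (\sum_(j < J) (j%:R + 1) ^+ d * ((2 ^ j)%:R) `^ (- eta) <= B) ->
  `|kernel J beta t x| <= (2 ^+ d + C * B) * T.
Proof.
move=> T1 C0 HC HB; have T0 : 0 <= T by lra.
rewrite /kernel (sum_levels_weighted (d := d) J (fun j => (level_weight j)^-1) (fun k => cos (wave beta t x k))).
apply: le_trans (ler_normD _ _) _; rewrite mulrDl; apply: lerD.
  rewrite /level_weight expn0 powR1 invr1 mul1r; apply: le_trans (sum_cube0_cos_le _ _ _) _.
  by rewrite ler_peMr ?exprn_ge0.
apply: le_trans (ler_norm_sum _ _ _) _.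
rewrite (mulrC C) -mulrA; apply: le_trans (ler_wpM2r _ HB); last exact: mulr_ge0.
rewrite mulr_suml; apply: ler_sum => j _.
rewrite normrM ger0_norm; last by rewrite invr_ge0 ltW// level_weight_gt0.
rewrite -ler_pdivlMl ?invr_gt0 ?level_weight_gt0// invrK.
apply: le_trans (HC j) _.
rewrite /level_weight powRD; last by rewrite (gt_eqF (_ : 0 < (2 ^ j)%:R :> R)) ?implybT// ltr0n expn_gt0.
by rewrite le_eqVlt; apply/orP; left; apply/eqP; ring.
Qed.

(** A shell has at most 4^d 2^(j d) frequencies, and 2^(j (d - 2 gamma)) is summable. *)
Lemma kernel_bound_trivial : d%:R < 2 * gamma ->
  exists2 C : R, 0 < C & forall J beta t (x : d.-tuple R), `|kernel J beta t x| <= C.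
Proof.
move=> dg; have eta0 : 0 < 2 * gamma - d%:R by lra.
have [B B0 HB] := poly_geom_sum_bounded d eta0.
exists (2 ^+ d + 4 ^+ d * B); first by rewrite addr_gt0 ?mulr_gt0 ?exprn_gt0.
move=> J beta t x.
have := @kernel_bound_from_shells 1 (2 * gamma - d%:R) (4 ^+ d) t beta x B J (lexx 1) _ _ (HB J).
rewrite mulr1; apply; first by rewrite exprn_ge0.
move=> j; rewrite mulr1 sum_cshell_cos.
apply: le_trans (shell_kernel_card _) _.
rewrite (_ : 2 * gamma - (2 * gamma - d%:R) = d%:R); last by ring.
rewrite (powR_mulrn d)// !expnS !natrM mulrA -natrM exprMn -mulrA.
apply: ler_wpM2l; first exact: exprn_ge0.
by rewrite ler_peMl ?exprn_ge0// exprn_ege1// lerDr.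
Qed.

Lemma kernel_bound (p : R) : (2 <= d)%N -> 1 <= p -> 0 < alpha < 2 -> alpha != 1 ->
  d%:R * alpha / 2 < 2 * gamma -> d%:R - alpha / p < 2 * gamma ->
  exists theta C : R, [/\ 0 <= theta, theta * p < 1, 0 < C &
   forall J beta t (x : d.-tuple R), 0 < t <= 1 ->
    `|kernel J beta t x| <= C * t `^ (- theta)].
Proof.
move=> d2 p1 al02 al1 g1 g2; have /andP[al0 al2] := al02.
have p0 : 0 < p by exact: lt_le_trans p1.
(* The second entry is halved because eta is spent twice: in theta and in the decay 2^(-eta j). *)
pose eta := Num.min (2 * gamma - d%:R * alpha / 2) ((2 * gamma - (d%:R - alpha / p)) / 2).
have eta0 : 0 < eta by rewrite lt_min; apply/andP; split; lra.
have eta1 : eta <= 2 * gamma - d%:R * alpha / 2 by rewrite ge_min lexx.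
have eta2 : 2 * eta <= 2 * gamma - (d%:R - alpha / p).
  have : eta <= (2 * gamma - (d%:R - alpha / p)) / 2 by rewrite ge_min lexx orbT.
  by lra.
(* Below 1 / p, so that t^(-theta p) is integrable, but so little that d - alpha theta is still at
   most 2 gamma - eta. *)
pose theta := Num.max 0 (1 / p - eta / alpha).
have pinv1 : 1 / p <= 1 by rewrite ler_pdivrMr// mul1r.
have ea0 : 0 < eta / alpha by rewrite divr_gt0.
have th0 : 0 <= theta by rewrite le_max lexx.
have th1 : theta <= 1 by rewrite ge_max ler01 /=; lra.
have thp : theta * p < 1.
  rewrite -ltr_pdivlMr// gt_max divr_gt0//=; lra.
have ath : d%:R - alpha * theta <= 2 * gamma - eta.
  have h : alpha * (1 / p - eta / alpha) <= alpha * theta.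
    by apply: ler_wpM2l; [exact: ltW|rewrite le_max lexx orbT].
  have e : alpha * (1 / p - eta / alpha) = alpha / p - eta by field; rewrite !gt_eqF.
  by rewrite e in h; lra.
have [C C0 HC] := shell_kernel_bound d2 al02 al1.
have [B B0 HB] := poly_geom_sum_bounded d eta0.
exists theta, (2 ^+ d + (C * 2) * B); split => //.
  by rewrite addr_gt0 ?mulr_gt0 ?exprn_gt0.
move=> J beta t x t01; have /andP[t0 t1] := t01.
have tt : 1 <= t `^ (- theta).
  have := @ger_powR R t; rewrite t0 t1 => /(_ isT (- theta) 0).
  by rewrite powRr0; apply; lra.
apply: (@kernel_bound_from_shells (t `^ (- theta)) eta (C * 2) t beta x B J) => //.
  by rewrite mulr_ge0// ltW.
move=> j; rewrite sum_cshell_cos.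
apply: le_trans (HC j t theta beta (tnth x) t01 _) _; first by rewrite th0.
rewrite [leRHS](_ : _ = C * (j%:R + 1) ^+ d * (2 * (((2 ^ j)%:R) `^ (2 * gamma - eta) * t `^ (- theta)))); last by ring.
apply: ler_wpM2l.
  by apply: mulr_ge0; [exact: ltW|apply: exprn_ge0; exact: addr_ge0].
have N1 : 1 <= (2 ^ j)%:R :> R by rewrite ler1n expn_gt0.
have h1 : ((2 ^ j)%:R) `^ (d%:R - alpha * theta) <= ((2 ^ j)%:R) `^ (2 * gamma - eta).
  by apply: ler_powR.
have h2 : ((2 ^ j)%:R) `^ (d%:R * alpha / 2) <= ((2 ^ j)%:R) `^ (2 * gamma - eta).
  by apply: ler_powR => //; lra.
set G := _ `^ (2 * gamma - eta) in h1 h2 *; set T := t `^ _ in tt *.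
have G0 : 0 <= G by exact: powR_ge0.
have T0 : 0 <= T by lra.
have := ler_wpM2r T0 h1.
have := ler_wpM2l G0 tt.
lra.
Qed.

End WeightedKernel.

(** * Discrete Strichartz estimate for partial sums *)

Lemma cauchy_schwarz2 (R : realType) (I : Type) (r : seq I) (f f' g g' : I -> R) :
  (\sum_(i <- r) (f i * g i + f' i * g' i)) ^+ 2 <=
  (\sum_(i <- r) (f i ^+ 2 + f' i ^+ 2)) * (\sum_(i <- r) (g i ^+ 2 + g' i ^+ 2)).
Proof.
set y := \sum_(i <- r) (f i * g i + _); set F := \sum_(i <- r) (f i ^+ 2 + _).
set x := \sum_(i <- r) _.
have disc u v : 0 <= u ^+ 2 * F - 2 * u * v * y + v ^+ 2 * x.
  rewrite /F /x /y !mulr_sumr -sumrB -big_split /=; apply: sumr_ge0 => i _.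
  rewrite [leRHS](_ : _ = (u * f i - v * g i) ^+ 2 + (u * f' i - v * g' i) ^+ 2); last by ring.
  by rewrite addr_ge0// sqr_ge0.
have x0 : 0 <= x by apply: sumr_ge0 => i _; rewrite addr_ge0// sqr_ge0.
have F0 : 0 <= F by apply: sumr_ge0 => i _; rewrite addr_ge0// sqr_ge0.
have [xe|xn] := eqVneq x 0.
  have [->|yn] := eqVneq y 0; first by rewrite expr0n mulr_ge0.
  (* With these values the nonnegative quadratic form would equal -1. *)
  have := disc 1 ((F + 1) / (2 * y)).
  rewrite xe mulr0 addr0 expr1n mul1r (_ : 2 * 1 * _ * y = F + 1); last by field.
  by lra.
have xp : 0 < x by rewrite lt_neqAle eq_sym xn.
have := disc x y; rewrite [leRHS](_ : _ = x * (F * x - y ^+ 2)); last by ring.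
by rewrite pmulr_rge0// subr_ge0.
Qed.

(** Concavity of ln, used through its tangent at the weighted mean s. The case b = 0 occurs for p =
    1. *)
Lemma weighted_amgm3 (R : realType) (a b x y z : R) : 0 < a -> 0 <= b -> 2 * a + b = 1 ->
  0 <= x -> 0 <= y -> 0 <= z -> x `^ a * y `^ a * z `^ b <= a * x + a * y + b * z.
Proof.
move=> a0 b0 ab x0 y0 z0.
have S0 : 0 <= a * x + a * y + b * z by rewrite !addr_ge0// mulr_ge0// ltW.
move: x0; rewrite le_eqVlt => /orP[/eqP xe|xp].
  by rewrite -xe powR0 ?gt_eqF// !mul0r mulr0 add0r; rewrite -xe mulr0 add0r in S0.
move: y0; rewrite le_eqVlt => /orP[/eqP ye|yp].
  by rewrite -ye powR0 ?gt_eqF// mulr0 mul0r; rewrite -ye in S0.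
have main z' : 0 < z' -> x `^ a * y `^ a * z' `^ b <= a * x + a * y + b * z'.
  move=> zp; set s := a * x + _ + _.
  have s0 : 0 < s by rewrite ltr_wpDr// ?mulr_ge0 ?(ltW zp)// addr_gt0// mulr_gt0.
  have lnb u : 0 < u -> ln u - ln s <= u / s - 1.
    move=> u0; rewrite -ln_div ?posrE//.
    have := @le_ln1Dx R (u / s - 1); rewrite (addrCA 1) subrr addr0; apply.
    by rewrite -[ltLHS]add0r ltrD2r divr_gt0.
  rewrite /powR !gt_eqF// -!expRD -[leRHS]lnK ?posrE// ler_expR.
  have hx := ler_wpM2l (ltW a0) (lnb x xp).
  have hy := ler_wpM2l (ltW a0) (lnb y yp).
  have hz := ler_wpM2l b0 (lnb z' zp).
  have e : a * (x / s) + a * (y / s) + b * (z' / s) = 1.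
    by rewrite !mulrA -!mulrDl divff// gt_eqF.
  have e2 : ln s = (2 * a + b) * ln s by rewrite ab mul1r.
  by rewrite e2; lra.
move: z0; rewrite le_eqVlt => /orP[/eqP ze|zp]; last exact: main.
rewrite -ze in S0 *.
have [be|bn] := eqVneq b 0; last by rewrite powR0// mulr0.
by have := main 1 ltr01; rewrite be !powRr0 !mul0r.
Qed.

(** A right-endpoint Riemann sum of x^(-s) lies below the integral; the increments of x^(1 - s)
    telescope. *)
Lemma powR_sum_le (R : realType) (s h : R) (n : nat) : 0 <= s < 1 -> 0 < h ->
  \sum_(i < n) h * ((i.+1)%:R * h) `^ (- s) <= (n%:R * h) `^ (1 - s) / (1 - s).
Proof.
move=> /andP[s0 s1] h0.
have b0 : 0 < 1 - s by lra.
rewrite ler_pdivlMr// mulr_suml.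
pose F (i : nat) : R := (i%:R * h) `^ (1 - s).
apply: (@le_trans _ _ (\sum_(0 <= i < n) (F i.+1 - F i))).
  rewrite big_mkord; apply: ler_sum => i _; rewrite /F.
  have ip : 0 < i.+1%:R * h by rewrite mulr_gt0.
  case: (posnP i) => [->|i0].
    rewrite mul0r powR0 ?gt_eqF// subr0 mul1r.
    have -> : h `^ (1 - s) = h * h `^ (- s).
      by rewrite powRD ?powRr1 ?(ltW h0)// (gt_eqF h0) implybT.
    by rewrite ler_piMr ?mulr_ge0 ?powR_ge0 ?(ltW h0)//; lra.
  have hi : 0 < i%:R * h by rewrite mulr_gt0// ltr0n.
  have hii : i%:R * h <= i.+1%:R * h by rewrite ler_pM2r// ler_nat.
  have := @powR_diff_ge R (1 - s) (i%:R * h) (i.+1%:R * h) (i.+1%:R * h) hi hii (lexx _) _.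
  rewrite (_ : 1 - s - 1 = - s); last by ring.
  rewrite (ger0_norm (ltW b0)) (_ : i.+1%:R * h - i%:R * h = h); last by rewrite -natr1; ring.
  rewrite ger0_norm; last first.
    by rewrite subr_ge0; apply: ge0_ler_powR; rewrite ?nnegrE ?(ltW hi) ?(ltW ip) ?(ltW b0).
  move=> H; rewrite [leLHS](_ : _ = (1 - s) * (i.+1%:R * h) `^ (- s) * h); last by ring.
  by apply: H; lra.
by rewrite telescope_sumr// /F mul0r powR0 ?gt_eqF// subr0.
Qed.

Lemma young_exponents (R : realType) (a b p I x y k : R) : 0 < I -> 0 <= x -> 0 <= y -> 0 <= k ->
  p * a + p * a = 1 -> a + b != 0 ->
  (I * x) `^ (a + b) * (I * y) `^ (a + b) * k =
  I `^ (2 * (a + b)) * ((x * k `^ p) `^ a * (y * k `^ p) `^ a * (x * y) `^ b).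
Proof.
move=> I0 x0 y0 k0 pa nab; rewrite !powRM ?powR_ge0 ?(ltW I0)//.
have pD u : u `^ (a + b) = u `^ a * u `^ b by rewrite powRD// (negPf nab).
rewrite (_ : 2 * (a + b) = (a + b) + (a + b)); last by ring.
rewrite (@powRD _ I (a + b) (a + b)); last by rewrite (gt_eqF I0) implybT.
rewrite !(pD x) !(pD y) -!powRrM.
have {1}-> : k = k `^ (p * a) * k `^ (p * a).
  by rewrite -powRD pa ?powRr1// oner_eq0.
ring.
Qed.

(* Young's inequality for the discrete form [sum phi_r phi_s k_rs]
   with [phi = g ^ (2p - 1)], in the form needed for the TT* argument. *)
Lemma discrete_young (R : realType) (n : nat) (p h kap F : R) (g : 'I_n -> R) (k : 'I_n -> 'I_n -> R) :
  1 <= p -> 0 < h -> 0 <= kap -> 0 <= F -> (forall r, 0 <= g r) -> (forall r s, 0 <= k r s) ->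
  (forall r s, k r s = k s r) ->
  (forall r, h * \sum_s (k r s) `^ p <= kap) ->
  (forall phi : 'I_n -> R, (forall r, 0 <= phi r) ->
     (\sum_r phi r * g r) ^+ 2 <= F * \sum_r \sum_s phi r * phi s * k r s) ->
  h * \sum_r (g r) `^ (2 * p) <= (F * (kap + 1)) `^ p.
Proof.
move=> p1 h0 kap0 F0 g0 k0 ksym hk dual.
have p0 : 0 < p by lra.
set I := h * _.
have I0 : 0 <= I by rewrite mulr_ge0 ?(ltW h0)//; apply: sumr_ge0 => r _; exact: powR_ge0.
move: I0; rewrite le_eqVlt => /orP[/eqP <-|Ip]; first exact: powR_ge0.
(* The exponents of the three factors in Young's inequality: k = (k^p)^a (k^p)^a, and phi = (I G)^(a
   + b) where G is g^(2p) normalized to total mass 1. *)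
pose a := 1 / (2 * p); pose b := 1 - 1 / p.
have a0 : 0 < a by rewrite divr_gt0// mulr_gt0.
have pinv1 : 1 / p <= 1 by rewrite ler_pdivrMr// mul1r.
have b0 : 0 <= b by rewrite subr_ge0.
have b1 : b <= 1 by rewrite gerBl divr_ge0// ltW.
have ab : 2 * a + b = 1 by rewrite /a /b; field; rewrite gt_eqF.
pose G r := g r `^ (2 * p) / I.
have G0 r : 0 <= G r by rewrite divr_ge0 ?powR_ge0// ltW.
have sG : h * \sum_r G r = 1 by rewrite -mulr_suml mulrA -/I divff// gt_eqF.
pose phi r := g r `^ (2 * p - 1).
have phi0 r : 0 <= phi r by exact: powR_ge0.
have phiE r : phi r = (I * G r) `^ (a + b).
  rewrite /G mulrC divfK ?gt_eqF// -powRrM; congr (_ `^ _).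
  by rewrite /a /b; field; rewrite gt_eqF.
have term r s : phi r * phi s * k r s <=
    I `^ (2 * (a + b)) * (a * (G r * k r s `^ p) + a * (G s * k r s `^ p) + b * (G r * G s)).
  have := weighted_amgm3 a0 b0 ab (mulr_ge0 (G0 r) (powR_ge0 (k r s) p))
    (mulr_ge0 (G0 s) (powR_ge0 (k r s) p)) (mulr_ge0 (G0 r) (G0 s)).
  move=> /(ler_wpM2l (powR_ge0 I (2 * (a + b)))); apply: le_trans.
  rewrite !phiE le_eqVlt; apply/orP; left; apply/eqP; apply: young_exponents => //.
    by rewrite /a; field; rewrite gt_eqF.
  by rewrite gt_eqF// ltr_wpDr.
have sumk : h ^+ 2 * \sum_r \sum_s (a * (G r * k r s `^ p) + a * (G s * k r s `^ p) + b * (G r * G s))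
    <= kap + 1.
  have e1 : h ^+ 2 * \sum_r \sum_s (G r * k r s `^ p) <= kap.
    rewrite expr2 -mulrA mulr_sumr (_ : kap = h * \sum_r (kap * G r)); last first.
      by rewrite -mulr_sumr mulrCA sG mulr1.
    apply: ler_wpM2l; first exact: ltW.
    apply: ler_sum => r _; rewrite -mulr_sumr mulrCA mulrC; apply: ler_wpM2r => //.
  have e2 : h ^+ 2 * \sum_r \sum_s (G s * k r s `^ p) <= kap.
    rewrite exchange_big /=; under eq_bigr do under eq_bigr do rewrite ksym.
    exact: e1.
  have e3 : h ^+ 2 * \sum_r \sum_s (G r * G s) = 1.
    under eq_bigr do rewrite -mulr_sumr.
    by rewrite -mulr_suml expr2 mulrACA sG mulr1.
  have lin (f1 f2 f3 : 'I_n -> 'I_n -> R) : \sum_r \sum_s (a * f1 r s + a * f2 r s + b * f3 r s) =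
      a * (\sum_r \sum_s f1 r s) + a * (\sum_r \sum_s f2 r s) + b * (\sum_r \sum_s f3 r s).
    under eq_bigr do rewrite !big_split /= -!mulr_sumr.
    by rewrite !big_split /= -!mulr_sumr.
  rewrite (lin (fun r s => G r * k r s `^ p) (fun r s => G s * k r s `^ p) (fun r s => G r * G s)).
  rewrite !mulrDr !(mulrCA (h ^+ 2)) e3 mulr1.
  have := ler_wpM2l (ltW a0) e1; have := ler_wpM2l (ltW a0) e2.
  have : 2 * a * kap <= 1 * kap by apply: ler_wpM2r => //; lra.
  lra.
have A : h ^+ 2 * \sum_r \sum_s phi r * phi s * k r s <= I `^ (2 * (a + b)) * (kap + 1).
  apply: le_trans (ler_wpM2l (powR_ge0 _ _) sumk).
  rewrite mulrCA; apply: ler_wpM2l; first exact: sqr_ge0.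
  rewrite mulr_sumr; apply: ler_sum => r _; rewrite mulr_sumr; apply: ler_sum => s _; exact: term.
have IE : I = h * \sum_r phi r * g r.
  rewrite /I; congr (_ * _); apply: eq_bigr => r _.
  by rewrite /phi [RHS]mulrC mulr_powRB1// mulr_gt0.
have I2 : I ^+ 2 <= F * (I `^ (2 * (a + b)) * (kap + 1)).
  apply: le_trans (ler_wpM2l F0 A); rewrite IE exprMn [leRHS]mulrCA.
  by apply: ler_wpM2l; [exact: sqr_ge0|exact: dual].
(* 2 (a + b) = 2 - 1 / p, so I^(1 / p) is what remains after division. *)
have Ipp : I `^ (1 / p) <= F * (kap + 1).
  have e : I ^+ 2 = I `^ (1 / p) * I `^ (2 * (a + b)).
    rewrite -powRD; last by rewrite (gt_eqF Ip) implybT.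
    rewrite -(powR_mulrn 2 (ltW Ip)); congr (_ `^ _).
    by rewrite /a /b; field; rewrite gt_eqF.
  move: I2; rewrite e (_ : F * _ = F * (kap + 1) * I `^ (2 * (a + b))); last by ring.
  by rewrite ler_pM2r// powR_gt0.
have -> : I = (I `^ (1 / p)) `^ p by rewrite -powRrM div1r mulVf ?gt_eqF// powRr1// ltW.
by apply: ge0_ler_powR; rewrite ?nnegrE ?powR_ge0 ?mulr_ge0 ?(ltW p0) ?addr_ge0.
Qed.

Lemma powR_add_le (R : realType) (a b q : R) : 0 <= a -> 0 <= b -> 0 <= q ->
  (a + b) `^ q <= 2 `^ q * (a `^ q + b `^ q).
Proof.
move=> a0 b0 q0; wlog ab : a b a0 b0 / a <= b.
  by move=> H; case: (leP a b) => [/H->//|/ltW/H]; rewrite addrC (addrC (b `^ _)); exact.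
apply: (@le_trans _ _ ((2 * b) `^ q)).
  by apply: ge0_ler_powR; rewrite ?nnegrE ?addr_ge0 ?mulr_ge0//; lra.
by rewrite powRM//; apply: ler_wpM2l; rewrite ?powR_ge0// lerDr powR_ge0.
Qed.

Lemma distn_le_bound (a b c : nat) : (a <= c)%N -> (b <= c)%N -> (`|a - b| <= c)%N.
Proof. lia. Qed.

Section Packet.
Context (R : realType) (d : nat) (alpha gamma : R).
Implicit Types (ar ai : d.-tuple int -> R) (x y : d.-tuple R).
Local Notation level_weight := (level_weight gamma).

(* Real part of [exp(i beta)] times a partial sum of the propagator. *)
Definition packet (J : nat) ar ai (beta t : R) x : R :=
  \sum_(k <- cube d J) (ar k * cos (wave alpha beta t x k) - ai k * sin (wave alpha beta t x k)).

Definition tuple_sub x y : d.-tuple R := [tuple tnth x i - tnth y i | i < d].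

Lemma waveB beta t x beta' t' y k :
  wave alpha (beta - beta') (t - t') (tuple_sub x y) k = wave alpha beta t x k - wave alpha beta' t' y k.
Proof.
rewrite /wave /dotk.
under eq_bigr do rewrite tnth_mktuple mulrBr.
by rewrite sumrB; ring.
Qed.

Lemma kernel_sym J beta t x beta' t' y :
  kernel alpha gamma J (beta - beta') (t - t') (tuple_sub x y) =
  kernel alpha gamma J (beta' - beta) (t' - t) (tuple_sub y x).
Proof. by apply: eq_bigr => q _; rewrite !waveB -cosN opprB. Qed.

(** Cauchy-Schwarz over the frequencies separates the coefficients from the test sequence. The
    square of the second factor expands into kernels at differences, by cos A cos B + sin A sin B =
    cos (A - B). The points and phases are arbitrary functions of r, which linearizes the
    supremum. *)
Lemma packet_dual (J n : nat) ar ai (F : R) (phi beta t : 'I_n -> R) (x : 'I_n -> d.-tuple R) :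
  \sum_(q <- levels d J) level_weight q.1 * (ar q.2 ^+ 2 + ai q.2 ^+ 2) <= F ->
  (forall r, 0 <= phi r) ->
  (\sum_r phi r * packet J ar ai (beta r) (t r) (x r)) ^+ 2 <=
  F * \sum_r \sum_s phi r * phi s *
    `|kernel alpha gamma J (beta r - beta s) (t r - t s) (tuple_sub (x r) (x s))|.
Proof.
move=> HF phi0.
pose w j := Num.sqrt (level_weight j).
have w0 j : 0 < w j by rewrite sqrtr_gt0 level_weight_gt0.
have w2 j : w j ^+ 2 = level_weight j by rewrite sqr_sqrtr// ltW// level_weight_gt0.
pose Cq (k : d.-tuple int) := \sum_r phi r * cos (wave alpha (beta r) (t r) (x r) k).
pose Sq (k : d.-tuple int) := \sum_r phi r * sin (wave alpha (beta r) (t r) (x r) k).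
have e1 : \sum_r phi r * packet J ar ai (beta r) (t r) (x r) =
    \sum_(q <- levels d J) ((w q.1 * ar q.2) * ((w q.1)^-1 * Cq q.2) +
       (w q.1 * ai q.2) * (- (w q.1)^-1 * Sq q.2)).
  transitivity (\sum_(q <- levels d J) (ar q.2 * Cq q.2 - ai q.2 * Sq q.2)).
    rewrite (sum_levels J (fun k => ar k * Cq k - ai k * Sq k)).
    under eq_bigr do rewrite mulr_sumr.
    rewrite exchange_big /=; apply: eq_bigr => k _.
    by rewrite /Cq /Sq !mulr_sumr -sumrB; apply: eq_bigr => r _; ring.
  by apply: eq_bigr => q _; field; rewrite gt_eqF.
rewrite e1; apply: le_trans (cauchy_schwarz2 _ _ _ _ _) _.
apply: ler_pM.
- by apply: sumr_ge0 => q _; rewrite addr_ge0// sqr_ge0.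
- by apply: sumr_ge0 => q _; rewrite addr_ge0// sqr_ge0.
- apply: le_trans HF; rewrite le_eqVlt; apply/orP; left; apply/eqP.
  by apply: eq_bigr => q _; rewrite -w2; ring.
have e2 : \sum_(q <- levels d J) (((w q.1)^-1 * Cq q.2) ^+ 2 + (- (w q.1)^-1 * Sq q.2) ^+ 2) =
    \sum_r \sum_s phi r * phi s * kernel alpha gamma J (beta r - beta s) (t r - t s) (tuple_sub (x r) (x s)).
  under [RHS]eq_bigr do under eq_bigr do rewrite /kernel mulr_sumr.
  under [RHS]eq_bigr do rewrite exchange_big /=.
  rewrite exchange_big /=; apply: eq_bigr => q _.
  transitivity ((level_weight q.1)^-1 * (Cq q.2 ^+ 2 + Sq q.2 ^+ 2)).
    by rewrite -w2; field; rewrite gt_eqF.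
  rewrite !expr2 /Cq /Sq !mulr_suml -big_split mulr_sumr; apply: eq_bigr => r _ /=.
  rewrite !mulr_sumr -big_split mulr_sumr; apply: eq_bigr => s _ /=.
  by rewrite waveB cosB; ring.
rewrite e2; apply: ler_sum => r _; apply: ler_sum => s _.
by apply: ler_wpM2l; [exact: mulr_ge0|exact: ler_norm].
Qed.

Lemma packet_sq_le J ar ai F beta t x :
  \sum_(q <- levels d J) level_weight q.1 * (ar q.2 ^+ 2 + ai q.2 ^+ 2) <= F ->
  (packet J ar ai beta t x) ^+ 2 <= F * `|kernel alpha gamma J 0 0 (tuple_sub x x)|.
Proof.
move=> HF.
have := @packet_dual J 1 ar ai F (fun=> 1) (fun=> beta) (fun=> t) (fun=> x) HF (fun=> ler01).
by rewrite !big_ord1 !mul1r !subrr.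
Qed.

Lemma packetNpi J ar ai beta t x : packet J ar ai (beta + pi) t x = - packet J ar ai beta t x.
Proof.
rewrite /packet -sumrN; apply: eq_bigr => k _.
rewrite /wave addrA cosDpi sinDpi; ring.
Qed.

Lemma packet_le J ar ai beta t x :
  packet J ar ai beta t x <= \sum_(k <- cube d J) (`|ar k| + `|ai k|).
Proof.
apply: ler_sum => k _; apply: le_trans (ler_norm _) _.
apply: le_trans (ler_normB _ _) _; rewrite !normrM.
by apply: lerD; rewrite ler_piMr// ?cos_max ?sin_max.
Qed.

Lemma packet_lip J ar ai beta t t' x :
  packet J ar ai beta t x - packet J ar ai beta t' x <=
  (\sum_(k <- cube d J) (`|ar k| + `|ai k|) * normk R k `^ alpha) * `|t - t'|.
Proof.
rewrite /packet -sumrB mulr_suml; apply: ler_sum => k _.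
have e : `|wave alpha beta t x k - wave alpha beta t' x k| = normk R k `^ alpha * `|t - t'|.
  rewrite (_ : _ - _ = - (normk R k `^ alpha * (t - t'))); last by rewrite /wave; ring.
  by rewrite normrN normrM (ger0_norm (powR_ge0 _ _)).
rewrite -mulrA -e; apply: le_trans (ler_norm _) _.
rewrite (_ : _ - _ = ar k * (cos (wave alpha beta t x k) - cos (wave alpha beta t' x k))
  - ai k * (sin (wave alpha beta t x k) - sin (wave alpha beta t' x k))); last by ring.
apply: le_trans (ler_normB _ _) _; rewrite !normrM mulrDl.
by apply: lerD; apply: ler_wpM2l => //; [exact: cos_lip|exact: sin_lip].
Qed.

(** A near-maximizer replaces a possibly unattained supremum; shifting [beta] by pi makes its value
    nonnegative. *)
Lemma packet_near_sup J ar ai t (dl : R) : 0 < dl ->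
  exists z : R * d.-tuple R, 0 <= packet J ar ai z.1 t z.2 /\
    forall beta x, packet J ar ai beta t x <= packet J ar ai z.1 t z.2 + dl.
Proof.
move=> dl0.
pose A := [set y : R | exists z : R * d.-tuple R, y = packet J ar ai z.1 t z.2].
have As : has_sup A.
  split; first by exists (packet J ar ai 0 t [tuple of nseq d 0]), (0, [tuple of nseq d 0]).
  by exists (\sum_(k <- cube d J) (`|ar k| + `|ai k|)) => _ [z ->]; exact: packet_le.
have [_ [z ->] hz] := sup_adherent dl0 As.
have ub beta x : packet J ar ai beta t x <= sup A.
  by apply: ub_le_sup; [exact: (proj2 As)|exists (beta, x)].
have [z0|zn] := leP 0 (packet J ar ai z.1 t z.2).
  by exists z; split => // beta x; have := ub beta x; lra.
pose z' := (z.1 + pi, z.2); exists z'; rewrite /= packetNpi; split; first lra.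
by move=> beta x; have := ub beta x; lra.
Qed.

(** Every positive distance occurs at most twice, once on each side of r. *)
Lemma sum_dist_le (n : nat) (r : 'I_n) (f : nat -> R) : (forall i, 0 <= f i) ->
  \sum_(s < n | s != r) f (`|r - s|%N) <= 2 * \sum_(i < n) f i.+1.
Proof.
move=> f0; rewrite (bigID (fun s : 'I_n => (s < r)%N)) /= mulr_natl mulr2n.
have lt (u v : 'I_n) : (u - v.+1 < n)%N by rewrite (leq_ltn_trans (leq_subr _ _)).
have G0 (i : 'I_n) : 0 <= f i.+1 by [].
apply: lerD.
  apply: le_trans (@sum_over_injective_le R _ _ (fun s : 'I_n => (s < r)%N)
    (fun s => Ordinal (lt r s)) (fun i => f i.+1) _ G0).
    rewrite [leRHS](eq_bigr (fun s : 'I_n => f (`|r - s|%N))); last first.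
      by move=> s sr /=; congr f; move: sr; move: (nat_of_ord r) (nat_of_ord s) => a b; clear; lia.
    rewrite le_eqVlt; apply/orP; left; apply/eqP; apply: eq_bigl => s; rewrite andbC.
    by case: ltnP => // sr; apply/eqP => e; rewrite e ltnn in sr.
  move=> s s'; rewrite -!topredE /= => sr sr' /(congr1 val) /= e; apply: val_inj => /=.
  by move: sr sr' e; move: (nat_of_ord r) (nat_of_ord s) (nat_of_ord s') => a b c; clear; lia.
apply: le_trans (@sum_over_injective_le R _ _ (fun s : 'I_n => (r < s)%N)
    (fun s => Ordinal (lt s r)) (fun i => f i.+1) _ G0).
  rewrite [leRHS](eq_bigr (fun s : 'I_n => f (`|r - s|%N))); last first.
    by move=> s sr /=; congr f; move: sr; move: (nat_of_ord r) (nat_of_ord s) => a b; clear; lia.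
  rewrite le_eqVlt; apply/orP; left; apply/eqP; apply: eq_bigl => s; rewrite -leqNgt (ltn_neqAle r) eq_sym.
  by congr (_ && _).
move=> s s'; rewrite -!topredE /= => sr sr' /(congr1 val) /= e; apply: val_inj => /=.
by move: sr sr' e; move: (nat_of_ord r) (nat_of_ord s) (nat_of_ord s') => a b c; clear; lia.
Qed.

(** [m] depends on J and on the coefficients, [D] does not. The supremum in x is bounded by a number
    on each time cell, which later gives a measurable majorant. *)
Lemma packet_strichartz (p theta C : R) : 1 <= p -> 0 <= theta -> theta * p < 1 -> 0 < C ->
  (forall J beta t (x : d.-tuple R), 0 < t <= 1 -> `|kernel alpha gamma J beta t x| <= C * t `^ (- theta)) ->
  exists2 D : R, 0 < D & forall J ar ai F, 0 <= F ->
    \sum_(q <- levels d J) level_weight q.1 * (ar q.2 ^+ 2 + ai q.2 ^+ 2) <= F ->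
    exists m (c : nat -> R), [/\ (0 < m)%N, forall i, 0 <= c i,
      forall beta t x, 0 <= t <= 1 -> packet J ar ai beta t x <= c (Num.truncn (m%:R * t)) &
      m%:R^-1 * \sum_(r < m.+1) (c r) `^ (2 * p) <= D * F `^ p].
Proof.
move=> p1 th0 thp C0 HK.
have p0 : 0 < p by lra.
pose sg := theta * p.
have sg0 : 0 <= sg by rewrite mulr_ge0// ltW.
have sg1 : 0 < 1 - sg by rewrite subr_gt0.
(* The 1 pays for the diagonal s = r; the rest bounds the Riemann sums of C^p t^(-sg) on both sides
   of r. *)
pose kap := 1 + C `^ p * (2 * (2 / (1 - sg))).
have kap0 : 0 <= kap by rewrite addr_ge0// mulr_ge0 ?powR_ge0// mulr_ge0// divr_ge0// ltW.
(* 2^(2p) separates the two summands of [c r]; the 2 bounds (m + 1) / m. *)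
pose D := 2 `^ (2 * p) * ((kap + 1) `^ p + 2).
have D0 : 0 < D.
  by apply: mulr_gt0; [exact: powR_gt0|have := powR_ge0 (kap + 1) p; lra].
(* F = 0 is treated apart, since [dl] below has to be positive; every packet then vanishes. *)
exists D => // J ar ai F; rewrite le_eqVlt => /orP[/eqP <-|F0] HF.
  exists 1%N, (fun=> 0); split => //.
    move=> beta t x _; have := packet_sq_le beta t x HF; rewrite mul0r => h.
    have : packet J ar ai beta t x == 0.
      by rewrite -sqrf_eq0 eq_le h sqr_ge0.
    by move=> /eqP ->.
  rewrite big1 ?mulr0; first by apply: mulr_ge0; [exact: ltW|exact: powR_ge0].
  by move=> i _; rewrite powR0// gt_eqF// mulr_gt0.
pose dl := Num.sqrt F.
have dl0 : 0 < dl by rewrite sqrtr_gt0.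
pose La := \sum_(k <- cube d J) (`|ar k| + `|ai k|) * normk R k `^ alpha.
have La0 : 0 <= La by apply: sumr_ge0 => k _; rewrite mulr_ge0 ?powR_ge0// addr_ge0.
pose Kz := \sum_(q <- levels d J) (level_weight q.1)^-1.
have Kz0 : 0 <= Kz by apply: sumr_ge0 => q _; rewrite invr_ge0 ltW// level_weight_gt0.
(* The first term keeps the variation in time over a cell below dl / 2; the second makes the
   diagonal contribution Kz^p / m at most 1. *)
pose m := (Num.truncn (2 * La / dl + Kz `^ p)).+1.
have m0 : 0 < m%:R :> R by [].
have /ltW hm : 2 * La / dl + Kz `^ p < m%:R.
  have := @truncn_itv R (2 * La / dl + Kz `^ p) _; rewrite addr_ge0 ?powR_ge0//.
    by move=> /(_ isT) /andP[].
  by rewrite divr_ge0 ?(ltW dl0)// mulr_ge0.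
have hm1 : 2 * La / dl <= m%:R by apply: le_trans hm; rewrite lerDl powR_ge0.
have hm2 : Kz `^ p <= m%:R by apply: le_trans hm; rewrite lerDr divr_ge0 ?(ltW dl0)// mulr_ge0.
pose h : R := m%:R^-1.
have h0 : 0 < h by rewrite invr_gt0.
have mh : m%:R * h = 1 by rewrite divff// gt_eqF.
have dl20 : 0 < dl / 2 by rewrite divr_gt0.
have [z Hz] := choice (fun r : 'I_m.+1 => packet_near_sup J ar ai (r%:R * h) dl20).
pose g r := packet J ar ai (z r).1 (r%:R * h) (z r).2.
have g0 r : 0 <= g r by have [] := Hz r.
(* One half of [dl] pays for the near-maximizer, the other half for the motion in time within a
   cell. *)
exists m, (fun i => g (inord i) + dl); split => //.
- by move=> i; rewrite addr_ge0// ltW.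
- move=> beta t x /andP[t0 t1].
  set i := Num.truncn _.
  have mt0 : 0 <= m%:R * t by rewrite mulr_ge0.
  have /andP[i1 i2] := truncn_itv mt0; rewrite -/i in i1 i2.
  have im : (i < m.+1)%N.
    rewrite ltnS -(ler_nat R); apply: le_trans i1 _.
    by rewrite -[leRHS]mulr1 ler_pM2l.
  have [_ /(_ beta x) H] := Hz (inord i); rewrite -/(g _) inordK// in H.
  have := packet_lip J ar ai beta t (i%:R * h) x; rewrite -/La.
  have hh : `|t - i%:R * h| <= h.
    have : i%:R * h <= t by rewrite ler_pdivrMr// mulrC.
    have : t <= (i%:R + 1) * h by rewrite ler_pdivlMr// mulrC natr1 ltW.
    rewrite mulrDl mul1r ler_norml => h1 h2; apply/andP; clear -h1 h2; split; lra.
  have Lh : La * h <= dl / 2.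
    rewrite ler_pdivrMr// mulrC -ler_pdivrMr//.
    by rewrite invf_div mulrA (mulrC La).
  have := ler_wpM2l La0 hh.
  lra.
have sumg : h * \sum_r (g r) `^ (2 * p) <= (F * (kap + 1)) `^ p.
  apply: (@discrete_young R m.+1 p h kap F g (fun r s => `|kernel alpha gamma J ((z r).1 - (z s).1)
     (r%:R * h - s%:R * h) (tuple_sub (z r).2 (z s).2)|)) => //.
  - exact: ltW.
  - by move=> r s; rewrite kernel_sym.
  - move=> r; rewrite (bigD1 r)//= mulrDr; apply: lerD.
      rewrite /h mulrC ler_pdivrMr// mul1r; apply: le_trans hm2.
      apply: ge0_ler_powR; rewrite ?nnegrE ?(ltW p0)//.
      apply: le_trans (ler_norm_sum _ _ _) _; apply: ler_sum => q _.
      rewrite normrM ger0_norm ?invr_ge0 ?(ltW (level_weight_gt0 _ _))//.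
      by rewrite ler_piMr ?cos_max// invr_ge0 ltW// level_weight_gt0.
    pose f (i : nat) : R := h * (C `^ p * (i%:R * h) `^ (- sg)).
    have f0 i : 0 <= f i by rewrite !mulr_ge0 ?powR_ge0// ltW.
    rewrite mulr_sumr.
    apply: (@le_trans _ _ (\sum_(s < m.+1 | s != r) f (`|r - s|%N))).
      apply: ler_sum => s sr; rewrite /f; apply: ler_wpM2l; first exact: ltW.
      have dist : 0 < (`|r - s|%N)%:R * h <= 1.
        have a1 : (0 < `|r - s|)%N.
          move: sr; rewrite -val_eqE /=; move: (nat_of_ord r) (nat_of_ord s) => a b; clear; lia.
        have a2 : (`|r - s| <= m)%N.
          by apply: distn_le_bound; rewrite -ltnS.
        apply/andP; split; first by rewrite mulr_gt0// ltr0n.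
        apply: (@le_trans _ _ (m%:R * h)); last by rewrite mh.
        by apply: ler_wpM2r; [exact: ltW|rewrite ler_nat].
      have kb : `|kernel alpha gamma J ((z r).1 - (z s).1) (r%:R * h - s%:R * h) (tuple_sub (z r).2 (z s).2)|
          <= C * ((`|r - s|%N)%:R * h) `^ (- theta).
        case: (leqP s r) => rs.
          have e : (`|r - s|%N)%:R * h = r%:R * h - s%:R * h :> R.
            by rewrite -mulrBl -natrB//; congr (_%:R * _); move: rs; move: (nat_of_ord r) (nat_of_ord s) => a b; clear; lia.
          by rewrite -e; apply: HK.
        have e : (`|r - s|%N)%:R * h = s%:R * h - r%:R * h :> R.
          rewrite -mulrBl -natrB; last exact: ltnW.
          by congr (_%:R * _); move: rs; move: (nat_of_ord r) (nat_of_ord s) => a b; clear; lia.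
        by rewrite kernel_sym -e; apply: HK.
      apply: (@le_trans _ _ ((C * ((`|r - s|%N)%:R * h) `^ (- theta)) `^ p)).
        apply: ge0_ler_powR; rewrite ?nnegrE ?(ltW p0)//.
        by rewrite mulr_ge0 ?powR_ge0 ?(ltW C0).
      by rewrite powRM ?powR_ge0 ?(ltW C0)// -powRrM mulNr.
    apply: le_trans (sum_dist_le r f0) _.
    rewrite /f; under eq_bigr do rewrite mulrCA.
    rewrite -mulr_sumr mulrCA; apply: ler_wpM2l; first exact: powR_ge0.
    apply: ler_wpM2l => //.
    have sg01 : 0 <= sg < 1 by rewrite sg0.
    apply: le_trans (powR_sum_le m.+1 sg01 h0) _.
    rewrite ler_pM2r ?invr_gt0//.
    have n2 : m.+1%:R * h <= 2.
      rewrite -natr1 mulrDl mh mul1r.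
      have : h <= 1 by rewrite invf_le1// ler1n.
      by lra.
    apply: (@le_trans _ _ (2 `^ (1 - sg))).
      apply: ge0_ler_powR; rewrite ?nnegrE ?(ltW sg1)//.
      by rewrite mulr_ge0 ?(ltW h0).
    rewrite -[leRHS]powRr1//; apply: ler_powR; lra.
  - by move=> phi phi0; apply: packet_dual.
rewrite -/h.
apply: (@le_trans _ _ (h * \sum_(r < m.+1) 2 `^ (2 * p) * (g r `^ (2 * p) + F `^ p))).
  apply: ler_wpM2l; first exact: ltW.
  apply: ler_sum => r _; rewrite inord_val.
  have -> : F `^ p = dl `^ (2 * p) by rewrite /dl -powR12_sqrt ?(ltW F0)// -powRrM mulrA mulVf// mul1r.
  by apply: powR_add_le; rewrite ?(ltW dl0) ?mulr_ge0 ?(ltW p0).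
rewrite -mulr_sumr mulrCA /D -[leRHS]mulrA; apply: ler_wpM2l; first exact: powR_ge0.
rewrite big_split /= sumr_const card_ord [leLHS]mulrDr [leRHS]mulrDl; apply: lerD.
  by apply: le_trans sumg _; rewrite (powRM _ (ltW F0) (addr_ge0 kap0 ler01)) [leLHS]mulrC.
rewrite -[_ *+ m.+1]mulr_natl mulrA; apply: ler_wpM2r; first exact: powR_ge0.
have -> : h * m.+1%:R = 1 + h by rewrite -natr1 mulrDr mulr1 (mulrC h) mh.
have : h <= 1 by rewrite invf_le1// ler1n.
lra.
Qed.

End Packet.

Section TorusFejer.
Context (R : realType).
Notation mu := (@lebesgue_measure R).
Notation RT := (measurableTypeR R).
Notation T := (@torus_itv R).
Local Notation Int D h := (mu.-integrable D (EFin \o (h : R -> R))).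
Local Notation "\Rint_ D f" := (Rintegral mu D f) (at level 36, D at level 0, f at level 36).

(** * Fejer means on the circle *)

Lemma pi2_gt0 : 0 < 2 * pi :> R.
Proof. by rewrite mulr_gt0// pi_gt0. Qed.

Lemma measurable_torus_itv : measurable (T : set RT).
Proof. exact: measurable_itv. Qed.
Hint Resolve measurable_torus_itv : core.

Lemma continuous_affine (a c : R) : continuous (fun y : R => a * y + c).
Proof. by move=> y; apply: cvgD; [apply: cvgMr; exact: cvg_id|exact: cvg_cst]. Qed.

Lemma continuous_cos_affine (a c : R) : continuous (fun y : R => cos (a * y + c)).
Proof.
move=> y; apply: continuous_comp; [exact: continuous_affine|exact: continuous_cos].
Qed.

Lemma integrable_continuous (a b : R) (f : R -> R) : continuous f -> Int `[a, b] f.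
Proof.
move=> cf; apply: continuous_compact_integrable; first exact: segment_compact.
exact: continuous_subspaceT.
Qed.

Lemma integrable_mul_le1 (D : set RT) (h phi : R -> R) : measurable D -> Int D h ->
  continuous phi -> (forall y, `|phi y| <= 1) -> Int D (fun y => h y * phi y).
Proof.
move=> mD ih cphi phi1.
have mphi : measurable_fun D (phi : RT -> R).
  by apply: (measurable_funS measurableT) => //; exact: continuous_measurable_fun.
have bphi : [bounded phi y | y in D].
  by exists 1; split => // M M1 y _ /=; apply: le_trans (phi1 y) (ltW M1).
by have := integrableMl mD ih mphi bphi; apply: eq_integrable.
Qed.

Lemma integrableD_fun (D : set RT) (f g : R -> R) : measurable D ->
  Int D f -> Int D g -> Int D (fun y => f y + g y).
Proof. by move=> mD fi gi; have := integrableD mD fi gi; apply: eq_integrable. Qed.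

Lemma integrableZ_fun (D : set RT) (a : R) (f : R -> R) : measurable D ->
  Int D f -> Int D (fun y => a * f y).
Proof. by move=> mD fi; have := integrableZl mD a fi; apply: eq_integrable. Qed.

Lemma integrable_sum_fun (D : set RT) (I : Type) (r : seq I) (f : I -> R -> R) : measurable D ->
  (forall i, Int D (f i)) -> Int D (fun y => \sum_(i <- r) f i y).
Proof.
move=> mD fi; elim: r => [|i r IH].
  apply: (eq_integrable mD (cst 0)); last exact: integrable0.
  by move=> x _ /=; rewrite big_nil.
apply: (eq_integrable mD (EFin \o (fun y => f i y + \sum_(j <- r) f j y))).
  by move=> x _ /=; rewrite big_cons.
exact: integrableD_fun.
Qed.

Lemma Rintegral_sum_fun (D : set RT) (I : Type) (r : seq I) (f : I -> R -> R) : measurable D ->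
  (forall i, Int D (f i)) ->
  \Rint_ D (fun y => \sum_(i <- r) f i y) = \sum_(i <- r) \Rint_ D (f i).
Proof.
move=> mD fi; elim: r => [|i r IH].
  rewrite big_nil; under eq_Rintegral do rewrite big_nil.
  by rewrite /Rintegral integral0.
rewrite big_cons -IH -RintegralD//; first by under eq_Rintegral do rewrite big_cons.
exact: integrable_sum_fun.
Qed.

Lemma Rintegral_cos_int (m : int) (c : R) :
  \Rint_ T (fun y => cos (m%:~R * y + c)) = if m == 0 then 2 * pi * cos c else 0.
Proof.
have p0 := pi2_gt0.
case: eqP => [->|/eqP m0].
  under eq_Rintegral do rewrite mul0r add0r.
  rewrite Rintegral_cst//= lebesgue_measure_itv/= lte_fin p0 /= subr0; ring.
have mr : m%:~R != 0 :> R by rewrite intr_eq0.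
pose F (y : R) := sin (m%:~R * y + c) / m%:~R.
have dF (y : R) : is_derive y 1 F (cos (m%:~R * y + c)).
  have h1 : is_derive y 1 (fun y : R => m%:~R * y + c) m%:~R.
    have hz : is_derive y 1 (m%:~R \*: (@id R)) (m%:~R *: 1).
      by apply: is_deriveZ; exact: is_derive_id.
    have := @is_deriveD R R^o R^o _ (cst c) y 1 _ _ hz (is_derive_cst _ _ _).
    by rewrite addr0 /GRing.scale /= mulr1.
  have h2 := @is_derive1_comp R (@sin R) (fun y : R => m%:~R * y + c) y _ _ (is_derive_sin _) h1.
  have h3 : is_derive y 1 ((m%:~R)^-1 \*: (fun y : R => sin (m%:~R * y + c)))
      ((m%:~R)^-1 *: (cos (m%:~R * y + c) * m%:~R)).
    by apply: is_deriveZ; exact: h2.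
  have -> : F = ((m%:~R)^-1 \*: (fun y : R => sin (m%:~R * y + c))).
    by apply/funext => z; rewrite /F /= /GRing.scale /= mulrC.
  have -> : cos (m%:~R * y + c) = ((m%:~R)^-1 *: (cos (m%:~R * y + c) * m%:~R)).
    by rewrite /GRing.scale /= mulrCA mulVf// mulr1.
  exact: h3.
have dv (y : R) : derivable F y 1 by have [] := dF y.
have cF : continuous F by move=> y; exact/differentiable_continuous/derivable1_diffP.
have FTC : (\int[mu]_(y in `[0%R, (2 * pi)%R]) (cos (m%:~R * y + c))%:E = (F (2 * pi))%:E - (F 0)%:E)%E.
  apply: continuous_FTC2 => //.
  - exact/continuous_subspaceT/continuous_cos_affine.
  - split => [y _||]; [exact: dv|apply: cvg_at_right_filter; exact: cF|apply: cvg_at_left_filter; exact: cF].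
  - by move=> y _; rewrite derive1E; have [_ ->] := dF y.
rewrite /Rintegral /torus_itv FTC /= /F mulr0 add0r.
have -> : sin (m%:~R * (2 * pi) + c) = sin c :> R.
  have per (n : nat) (x : R) : sin (x + n%:R * (2 * pi)) = sin x.
    rewrite mulr_natl (_ : 2 * pi = pi *+ 2 :> R); last exact: mulr_natl.
    exact: (periodicn (@sinD2pi R)).
  rewrite addrC; case: (intP m) => [|n|n].
  - by rewrite mul0r addr0.
  - exact: per.
  - by rewrite -(per n.+1 (c + _)) mulrNz mulNr subrK.
by rewrite subrr.
Qed.

(** This is |sum_(s < N) e^(i s y)|^2 / N as a double sum: the square gives positivity, and the
    differences s - s' are the frequencies of the Fejer mean. *)
Definition fejer_kernel (N : nat) (y : R) : R :=
  N%:R^-1 * \sum_(s < N) \sum_(s' < N) cos ((s%:Z - s'%:Z)%:~R * y).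

Lemma fejer_kernel_sq (N : nat) (y : R) : fejer_kernel N y =
  N%:R^-1 * ((\sum_(0 <= s < N) cos (y * s%:R + 0)) ^+ 2 +
             (\sum_(0 <= s < N) cos (y * s%:R + - (pi / 2))) ^+ 2).
Proof.
rewrite /fejer_kernel; congr (_ * _).
rewrite !big_mkord !expr2 !mulr_suml -big_split; apply: eq_bigr => s _ /=.
rewrite !mulr_sumr -big_split; apply: eq_bigr => s' _ /=.
rewrite !cosBpihalf !addr0 -cosB; congr cos.
by rewrite intrB; ring.
Qed.

Lemma fejer_kernel_ge0 N y : 0 <= fejer_kernel N y.
Proof. by rewrite fejer_kernel_sq mulr_ge0 ?invr_ge0// addr_ge0// sqr_ge0. Qed.

Lemma fejer_kernel_le N y (s : R) : 0 < s -> s <= `|sin (y / 2)| ->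
  fejer_kernel N y <= 2 / s ^+ 2 * N%:R^-1.
Proof.
move=> s0 hs; rewrite fejer_kernel_sq mulrC; apply: ler_wpM2r; first by rewrite invr_ge0.
have h (c : R) : (\sum_(0 <= i < N) cos (y * i%:R + c)) ^+ 2 <= (s ^+ 2)^-1.
  rewrite -(real_normK (num_real (\sum_(_ <= _ < _) _))) -exprVn.
  apply: lerXn2r; rewrite ?nnegrE ?invr_ge0 ?(ltW s0)//.
  rewrite -[leRHS]mul1r ler_pdivlMr//.
  apply: le_trans (dirichlet_sum_sin N y c).
  by apply: ler_wpM2l.
by have := h 0; have := h (- (pi / 2)); lra.
Qed.

Lemma continuous_fejer_kernel N : continuous (fejer_kernel N).
Proof.
have cs (n : nat) (f : 'I_n -> R -> R) : (forall i, continuous (f i)) ->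
    continuous (fun y => \sum_(i < n) f i y).
  move=> cf; elim: n f cf => [|n IH] f cf y.
    by under eq_fun do rewrite big_ord0; exact: cvg_cst.
  under eq_fun do rewrite big_ord_recl.
  by apply: cvgD; [exact: cf|apply: (IH (fun i => f (lift ord0 i)))].
move=> y; apply: cvgMr; apply: (cs N (fun s y => \sum_(s' < N) _)) => s.
apply: (cs N (fun s' y => cos ((s%:Z - s'%:Z)%:~R * y))) => s'.
rewrite (_ : (fun y => _) = (fun y : R => cos ((s%:Z - s'%:Z)%:~R * y + 0))).
  exact: continuous_cos_affine.
by apply/funext => w; rewrite addr0.
Qed.

Lemma continuous_fejer_shift N x : continuous (fun y => fejer_kernel N (x - y)).
Proof.
move=> y; apply: (@continuous_comp R R R (fun y => x - y) (fejer_kernel N)); last exact: continuous_fejer_kernel.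
by apply: cvgB; [exact: cvg_cst|exact: cvg_id].
Qed.

(** Only the N diagonal pairs have frequency 0. *)
Lemma Rintegral_fejer_kernel N (x : R) : (0 < N)%N ->
  \Rint_ T (fun y => fejer_kernel N (x - y)) = 2 * pi.
Proof.
move=> N0; have NN : N%:R != 0 :> R by rewrite pnatr_eq0 -lt0n.
have ic (s s' : 'I_N) : Int T (fun y => cos ((s%:Z - s'%:Z)%:~R * (x - y))).
  have := @integrable_continuous 0 (2 * pi) _ (@continuous_cos_affine (- (s%:Z - s'%:Z)%:~R) ((s%:Z - s'%:Z)%:~R * x)).
  by apply: eq_integrable => // y _ /=; congr (cos _)%:E; ring.
have ics (s : 'I_N) : Int T (fun y => \sum_(s' < N) cos ((s%:Z - s'%:Z)%:~R * (x - y))).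
  exact: integrable_sum_fun.
rewrite /fejer_kernel RintegralZl//; last exact: integrable_sum_fun.
rewrite Rintegral_sum_fun//.
rewrite (eq_bigr (fun=> 2 * pi)).
  by rewrite sumr_const card_ord -[X in _ * X]mulr_natl mulKf.
move=> s _; rewrite Rintegral_sum_fun//.
rewrite (bigD1 s)//= big1 ?addr0.
  under eq_Rintegral do rewrite subrr mul0r -(add0r 0) -(mul0r 0).
  rewrite Rintegral_cst//= lebesgue_measure_itv/= lte_fin pi2_gt0 /= subr0 mul0r addr0 cos0; ring.
move=> s' s's.
have := @Rintegral_cos_int (- (s%:Z - s'%:Z)) ((s%:Z - s'%:Z)%:~R * x).
rewrite oppr_eq0 subr_eq0 ifF; last by apply/negbTE; rewrite eqz_nat eq_sym.
by move=> <-; apply: eq_Rintegral => y _; congr cos; rewrite mulrNz; ring.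
Qed.

Lemma lebesgue_ae2 (P Q S : R -> Prop) :
  {ae @lebesgue_measure R, forall y, P y} -> {ae @lebesgue_measure R, forall y, Q y} ->
  (forall y, P y -> Q y -> S y) -> {ae @lebesgue_measure R, forall y, S y}.
Proof.
move=> hP hQ PQS; have F : Filter (almost_everywhere (@lebesgue_measure R)) by exact: _.
by apply: (@filterS2 _ _ F _ _ _ PQS).
Qed.

Lemma lebesgue_aeS (P S : R -> Prop) :
  {ae @lebesgue_measure R, forall y, P y} -> (forall y, P y -> S y) ->
  {ae @lebesgue_measure R, forall y, S y}.
Proof. by move=> hP PS; apply: (lebesgue_ae2 hP hP) => y Py _; exact: PS. Qed.

Lemma lebesgue_ae_neq (c : R) : {ae @lebesgue_measure R, forall y, y != c}.
Proof.
exists [set c]; split; [exact: measurable_set1|exact: lebesgue_measure_set1|].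
by move=> y /= /negP; rewrite negbK => /eqP.
Qed.

Lemma lebesgue_ae_neq2 (a b : R) :
  {ae @lebesgue_measure R, forall y, y != a /\ y != b}.
Proof. by apply: (lebesgue_ae2 (lebesgue_ae_neq a) (lebesgue_ae_neq b)). Qed.

Let mT : measurable (T : set RT). Proof. exact: measurable_itv. Qed.
Let p2 : 0 < 2 * pi :> R. Proof. exact: pi2_gt0. Qed.

(** The kernel is a finite sum of products, so exchanging the integrals reduces to linearity. *)
Lemma Rintegral_separable_exchange (A B : set RT) (I : finType) (p q : I -> R -> R) (h : R -> R) :
  measurable A -> measurable B -> (forall i, Int A (p i)) -> (forall i, Int B (fun y => h y * q i y)) ->
  \Rint_ B (fun y => h y * \Rint_ A (fun x => \sum_i p i x * q i y)) =
  \Rint_ A (fun x => \Rint_ B (fun y => h y * \sum_i p i x * q i y)).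
Proof.
move=> mA mB ip iq.
have e1 y : \Rint_ A (fun x => \sum_i p i x * q i y) = \sum_i (\Rint_ A (p i)) * q i y.
  rewrite Rintegral_sum_fun//.
    by apply: eq_bigr => i _; rewrite RintegralZr.
  by move=> i; have := integrableZ_fun (q i y) mA (ip i); apply: eq_integrable => // x _ /=; rewrite mulrC.
have e2 x : \Rint_ B (fun y => h y * \sum_i p i x * q i y) = \sum_i p i x * \Rint_ B (fun y => h y * q i y).
  transitivity (\Rint_ B (fun y => \sum_i p i x * (h y * q i y))).
    by apply: eq_Rintegral => y _; rewrite mulr_sumr; apply: eq_bigr => i _; ring.
  rewrite Rintegral_sum_fun//.
    by apply: eq_bigr => i _; rewrite RintegralZl.
  by move=> i; exact: integrableZ_fun.
transitivity (\Rint_ B (fun y => \sum_i (\Rint_ A (p i)) * (h y * q i y))).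
  by apply: eq_Rintegral => y _; rewrite e1 mulr_sumr; apply: eq_bigr => i _; ring.
rewrite Rintegral_sum_fun//; last by move=> i; exact: integrableZ_fun.
under [RHS]eq_Rintegral do rewrite e2.
rewrite Rintegral_sum_fun//.
  by apply: eq_bigr => i _; rewrite RintegralZl// RintegralZr.
by move=> i; have := integrableZ_fun (\Rint_ B (fun y => h y * q i y)) mA (ip i); apply: eq_integrable => // x _ /=; rewrite mulrC.
Qed.

(** Separation of variables in cos m (x - y): the boolean selects the cosine or the sine, the latter
    written as a shifted cosine. *)
Let fp N (i : 'I_N * 'I_N * bool) (x : R) : R :=
  N%:R^-1 * cos ((i.1.1%:Z - i.1.2%:Z)%:~R * x + (if i.2 then 0 else - (pi / 2))).
Let fq N (i : 'I_N * 'I_N * bool) (x : R) : R :=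
  cos ((i.1.1%:Z - i.1.2%:Z)%:~R * x + (if i.2 then 0 else - (pi / 2))).

Let fejer_sep N x y : fejer_kernel N (x - y) = \sum_i @fp N i x * @fq N i y.
Proof.
rewrite /fejer_kernel mulr_sumr.
rewrite -(pair_bigA _ (fun i b => @fp N (i, b) x * @fq N (i, b) y)) /=.
rewrite -(pair_bigA _ (fun s s' => \sum_b @fp N ((s, s'), b) x * @fq N ((s, s'), b) y)) /=.
apply: eq_bigr => s _; rewrite mulr_sumr; apply: eq_bigr => s' _.
rewrite big_bool /fp /fq /= !addr0 !cosBpihalf mulrBr cosB; ring.
Qed.

Let int_fp N (a b : R) i : Int `[a, b] (@fp N i).
Proof. by apply: integrableZ_fun => //; apply: integrable_continuous; exact: continuous_cos_affine. Qed.

Let int_hfq N (D : set RT) (h : R -> R) i : measurable D -> Int D h -> Int D (fun y => h y * @fq N i y).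
Proof.
move=> mD ih; apply: integrable_mul_le1 => //; first exact: continuous_cos_affine.
by move=> y; exact: cos_max.
Qed.

Lemma fejer_kernelN N (x y : R) : fejer_kernel N (x - y) = fejer_kernel N (y - x).
Proof.
rewrite /fejer_kernel; congr (_ * _); apply: eq_bigr => s _; apply: eq_bigr => s' _.
by rewrite -cosN -mulrN opprB.
Qed.

Let int_fejer N (a b y : R) : Int `[a, b] (fun x => fejer_kernel N (x - y)).
Proof.
rewrite (_ : (fun x => _) = (fun x => fejer_kernel N (y - x))); last exact/funext/(fun x => fejer_kernelN N x y).
by apply: integrable_continuous; exact: continuous_fejer_shift.
Qed.

Lemma fejer_sin_ge (eta x y : R) : 0 < eta -> eta <= `|x - y| -> `|x - y| <= 2 * pi - eta ->
  eta / 8 <= `|sin ((x - y) / 2)|.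
Proof.
move=> e0 e1 e2.
have -> : `|sin ((x - y) / 2)| = `|sin (`|x - y| / 2)|.
  by case: (ger0P (x - y)) => // _; rewrite mulNr sinN normrN.
set u := `|x - y| in e1 e2 *.
apply: le_trans (ler_norm _).
case: (leP (u / 2) (pi / 2)) => h.
  by have := @sin_ge_quarter R (u / 2); rewrite h andbT => H; have := H (_ : 0 <= u / 2); lra.
have -> : sin (u / 2) = sin (pi - u / 2).
  by rewrite addrC sinDpi sinN opprK.
have := @sin_ge_quarter R (pi - u / 2) _; lra.
Qed.

Lemma Rintegral_sub_bound (D : set RT) (f : R -> R) (K : R) : measurable D -> D `<=` T -> Int D f ->
  0 <= K -> (forall x, D x -> f x <= K) -> \Rint_ D f <= K * (2 * pi).
Proof.
move=> mD DT iF K0 fK.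
have mDT : (mu D <= (2 * pi)%:E)%E.
  apply: (@le_trans _ _ (mu T)); first by apply: le_measure; rewrite ?inE.
  by rewrite lebesgue_measure_itv/= lte_fin p2 -EFinB subr0.
have Dfin : (mu D < +oo)%E by apply: le_lt_trans mDT _; rewrite ltry.
have iK : Int D (fun=> K).
  apply: measurable_bounded_integrable => //.
  by exists `|K|; split => // M KM y _; exact: ltW.
apply: le_trans (le_Rintegral mD iF iK fK) _.
rewrite Rintegral_cst//; apply: ler_wpM2l => //.
rewrite -lee_fin fineK//; apply/fin_numPlt; rewrite Dfin andbT.
by apply: lt_le_trans (measure_ge0 _ _); rewrite ltNyr.
Qed.

Section IntervalAverage.
Context (h : R -> R) (M a b : R).
Hypothesis (ih : Int T h) (a0 : 0 <= a) (ab : a < b) (b2 : b <= 2 * pi).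
Hypothesis fejerM : forall N x, (0 < N)%N ->
  \Rint_ T (fun y => h y * fejer_kernel N (x - y)) <= M * (2 * pi).

Let I : set RT := `[a, b].
Let D : set RT := T `\` I.
Let mI : measurable I. Proof. exact: measurable_itv. Qed.
Let mD : measurable D. Proof. exact: measurableD. Qed.
Let IT : I `<=` T.
Proof.
move=> x; rewrite /I /torus_itv /= !in_itv /= => /andP[h1 h2].
by rewrite (le_trans a0)//= (le_trans h2).
Qed.

(* the Fejer mean of the indicator function of [a, b] *)
Let Phi N (y : R) := (2 * pi)^-1 * \Rint_ I (fun x => fejer_kernel N (x - y)).

Let PhiD N y : (0 < N)%N ->
  1 - Phi N y = (2 * pi)^-1 * \Rint_ D (fun x => fejer_kernel N (x - y)).
Proof.
move=> N0.
have TE : T = I `|` D by rewrite /D setDUK.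
have e : \Rint_ T (fun x => fejer_kernel N (x - y)) = 2 * pi.
  rewrite -(Rintegral_fejer_kernel y N0); apply: eq_Rintegral => x _; exact: fejer_kernelN.
rewrite TE Rintegral_setU// in e; last 2 first.
- by rewrite -TE; exact: int_fejer.
- by rewrite disj_set2E setDIK.
have -> : \Rint_ D (fun x => fejer_kernel N (x - y)) = 2 * pi - \Rint_ I (fun x => fejer_kernel N (x - y)).
  by rewrite -e addrC addKr.
by rewrite mulrBr mulVf// gt_eqF.
Qed.

Let Phi_ge0 N y : 0 <= Phi N y.
Proof.
by rewrite mulr_ge0 ?invr_ge0 ?(ltW p2)//; apply: Rintegral_ge0 => x _; exact: fejer_kernel_ge0.
Qed.

Let Phi_le1 N y : (0 < N)%N -> Phi N y <= 1.
Proof.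
move=> N0; rewrite -subr_ge0 PhiD// mulr_ge0 ?invr_ge0 ?(ltW p2)//.
by apply: Rintegral_ge0 => x _; exact: fejer_kernel_ge0.
Qed.

Let small_part N (E : set RT) y eta : (0 < N)%N -> measurable E -> E `<=` T -> 0 < eta ->
  (forall x, E x -> eta <= `|x - y| <= 2 * pi - eta) ->
  0 <= (2 * pi)^-1 * \Rint_ E (fun x => fejer_kernel N (x - y)) <= 2 / (eta / 8) ^+ 2 * N%:R^-1.
Proof.
move=> N0 mE ET e0 hE; apply/andP; split.
  rewrite mulr_ge0 ?invr_ge0 ?(ltW p2)//.
  by apply: Rintegral_ge0 => x _; exact: fejer_kernel_ge0.
rewrite ler_pdivrMl// [leRHS]mulrC; apply: Rintegral_sub_bound => //.
- by apply: (integrableS mT) => //; exact: int_fejer.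
- by rewrite mulr_ge0 ?invr_ge0// divr_ge0// exprn_ge0// divr_ge0// ltW.
- move=> x Ex; have /andP[h1 h2] := hE x Ex.
  by apply: fejer_kernel_le; [rewrite divr_gt0|exact: fejer_sin_ge].
Qed.

Let ind (y : R) : R := if a <= y <= b then 1 else 0.

Let Phi_cvg y : 0 < y < 2 * pi -> y != a -> y != b -> Phi n.+1 y @[n --> \oo] --> ind y.
Proof.
move=> /andP[y0 y2] ya yb.
(* The distances to 0 and 2 pi enter because the kernel peaks again at |x - y| = 2 pi. *)
pose eta := Num.min (Num.min y (2 * pi - y)) (Num.min `|y - a| `|y - b|).
have e0 : 0 < eta by rewrite !lt_min y0 subr_gt0 y2 !normr_gt0 !subr_eq0 ya yb.
have e1 : eta <= y by rewrite !ge_min lexx.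
have e2 : eta <= 2 * pi - y by rewrite !ge_min lexx orbT.
have e3 : eta <= `|y - a| by rewrite !ge_min lexx !orbT.
have e4 : eta <= `|y - b| by rewrite !ge_min lexx !orbT.
have far x : T x -> `|x - y| <= 2 * pi - eta.
  by rewrite /torus_itv /= in_itv /= => /andP[h1 h2]; rewrite ler_norml; apply/andP; split; lra.
have key n : `|ind y - Phi n.+1 y| <= 2 / (eta / 8) ^+ 2 * n.+1%:R^-1.
  rewrite /ind; case: ifPn => [/andP[ay yb']|nin].
    rewrite PhiD//.
    have /andP[h1 h2] : 0 <= (2 * pi)^-1 * \Rint_ D (fun x => fejer_kernel n.+1 (x - y)) <= 2 / (eta / 8) ^+ 2 * n.+1%:R^-1.
      apply: small_part => //; first by move=> x [].
      move=> x [Tx nIx]; rewrite far// andbT.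
      move: nIx; rewrite /I /= in_itv /= => /negP; rewrite negb_and -!ltNge => /orP[hh|hh].
        by move: e3; rewrite ger0_norm ?subr_ge0// ler_normr => e3; apply/orP; right; lra.
      by move: e4; rewrite ler0_norm ?subr_le0// ler_normr => e4; apply/orP; left; lra.
    by rewrite ger0_norm.
  have /andP[h1 h2] : 0 <= Phi n.+1 y <= 2 / (eta / 8) ^+ 2 * n.+1%:R^-1.
    apply: (@small_part n.+1 I y eta isT mI IT e0).
    move=> x Ix; rewrite (far _ (IT Ix)) andbT.
    move: Ix; rewrite /I /= in_itv /= => /andP[ax xb].
    move: nin; rewrite negb_and -!ltNge => /orP[hh|hh].
      by move: e3; rewrite ltr0_norm ?subr_lt0// ler_normr => e3; apply/orP; left; lra.
    by move: e4; rewrite gtr0_norm ?subr_gt0// ler_normr => e4; apply/orP; right; lra.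
  by rewrite sub0r normrN ger0_norm.
apply/cvgrPdist_le => e eps0.
have := @cvg_harmonic R; move=> /cvgrPdist_le /(_ (e / (2 / (eta / 8) ^+ 2))).
have K0 : 0 < 2 / (eta / 8) ^+ 2 by rewrite divr_gt0// exprn_gt0// divr_gt0.
move=> /(_ (divr_gt0 eps0 K0)); apply: filterS => n.
rewrite sub0r normrN /harmonic => hn; apply: le_trans (key n) _.
by rewrite mulrC -ler_pdivlMr//; apply: le_trans hn; exact: ler_norm.
Qed.

Let hPhi_int N : Int T (fun y => h y * Phi N y).
Proof.
have := @integrable_sum_fun T _ (index_enum _)
  (fun i y => (2 * pi)^-1 * \Rint_ I (@fp N i) * (h y * fq i y)) mT _.
move=> /(_ (fun i => integrableZ_fun _ mT (int_hfq _ mT ih))).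
apply: eq_integrable => // y _ /=; congr EFin; rewrite /Phi.
have -> : \Rint_ I (fun x => fejer_kernel N (x - y)) = \sum_i \Rint_ I (@fp N i) * fq i y.
  under eq_Rintegral do rewrite fejer_sep.
  rewrite Rintegral_sum_fun//.
    by apply: eq_bigr => i _; rewrite RintegralZr//; exact: int_fp.
  move=> i; have := integrableZ_fun (fq i y) mI (int_fp a b i).
  by apply: eq_integrable => // x _ /=; rewrite mulrC.
by rewrite !mulr_sumr; apply: eq_bigr => i _; ring.
Qed.

Let hPhi_le N : (0 < N)%N -> \Rint_ T (fun y => h y * Phi N y) <= M * (b - a).
Proof.
move=> N0.
have -> : \Rint_ T (fun y => h y * Phi N y) =
    (2 * pi)^-1 * \Rint_ T (fun y => h y * \Rint_ I (fun x => \sum_i @fp N i x * fq i y)).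
  rewrite -RintegralZl; [|exact: mT|].
    by apply: eq_Rintegral => y _; rewrite /Phi mulrCA; under eq_Rintegral do rewrite fejer_sep.
  have := integrableZ_fun (2 * pi) mT (hPhi_int N).
  apply: eq_integrable => // y _ /=; congr EFin; rewrite /Phi.
  under [in LHS]eq_Rintegral do rewrite fejer_sep.
  by rewrite mulrCA mulVKf// gt_eqF.
rewrite Rintegral_separable_exchange//; last 2 first.
- by move=> i; exact: int_fp.
- by move=> i; exact: int_hfq.
rewrite ler_pdivrMl//.
have -> : 2 * pi * (M * (b - a)) = \Rint_ I (fun=> M * (2 * pi)).
  by rewrite Rintegral_cst//= lebesgue_measure_itv/= lte_fin ab -EFinB /=; ring.
apply: le_Rintegral => //.
- have := @integrable_sum_fun I _ (index_enum _)
    (fun i x => \Rint_ T (fun y => h y * @fq N i y) * fp i x) mI _.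
  move=> /(_ (fun i => integrableZ_fun _ mI (int_fp a b i))).
  apply: eq_integrable => // x _ /=; congr EFin.
  transitivity (\Rint_ T (fun y => \sum_i fp i x * (h y * @fq N i y))).
    rewrite Rintegral_sum_fun//; last by move=> i; apply: integrableZ_fun => //; exact: int_hfq.
    by apply: eq_bigr => i _; rewrite RintegralZl; [exact: mulrC|exact: mT|exact: int_hfq].
  by apply: eq_Rintegral => y _; rewrite mulr_sumr; apply: eq_bigr => i _; ring.
- by apply: integrable_continuous => x; exact: cvg_cst.
- by move=> x _; under eq_Rintegral do rewrite -fejer_sep; exact: fejerM.
Qed.

Let ind_patch y : (h \_ I) y = h y * ind y.
Proof.
rewrite patchE /ind; case: ifPn => [|]; rewrite /I mem_setE in_itv /= => yI.
  by rewrite yI mulr1.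
by rewrite (negPf yI) mulr0.
Qed.

Let hind_int : Int T (fun y => h y * ind y).
Proof.
have TI : T `&` I = I by rewrite setIC; apply/setIidPl.
have : Int (T `&` I) h by rewrite TI; exact: integrableS ih.
move=> /(integrable_restrict mu mI mT).
apply: eq_integrable => // y _; rewrite /= -ind_patch.
by rewrite /patch; case: ifP.
Qed.

(** Integrating the hypothesis over x in I and exchanging the integrals bounds the integral of h Phi
    by M (b - a). Phi lies between 0 and 1 and tends to the indicator of I off four points, so |h|
    dominates. *)
Lemma interval_average_le : \Rint_ I h <= M * (b - a).
Proof.
have lim_ae : {ae mu, forall x, T x ->
    (fun n => (h x * Phi n.+1 x)%:E) @ \oo --> (h x * ind x)%:E}.
  apply: (lebesgue_ae2 (lebesgue_ae_neq2 0 (2 * pi)) (lebesgue_ae_neq2 a b)) => y [y0 y2] [ya yb]; rewrite /torus_itv /= in_itv /= => /andP[h1 h2].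
  have yy : 0 < y < 2 * pi by rewrite !lt_neqAle h1 h2 y2 eq_sym y0.
  apply: cvg_EFin; first exact: nearW.
  by apply: cvgMr; exact: Phi_cvg.
have dom_ae : {ae mu, forall x n, T x -> (`|(h x * Phi n.+1 x)%:E| <= `|h x|%:E)%E}.
  apply: aeW => y n _ /=; rewrite lee_fin normrM ler_piMr// ger0_norm//.
  exact: Phi_le1.
have [_ _ cv] := @dominated_convergence _ RT R mu T mT
  (fun n y => (h y * Phi n.+1 y)%:E) (fun y => (h y * ind y)%:E) (fun y => `|h y|%:E)
  (fun n => measurable_int _ (hPhi_int n.+1)) (measurable_int _ hind_int) lim_ae
  (integrable_norm ih) dom_ae.
have le n : (\int[mu]_(y in T) (h y * Phi n.+1 y)%:E <= (M * (b - a))%:E)%E.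
  have := hPhi_le (ltn0Sn n); rewrite /Rintegral -lee_fin fineK//.
  exact: integrable_fin_num (hPhi_int n.+1).
have lim_le : (\int[mu]_(y in T) (h y * ind y)%:E <= (M * (b - a))%:E)%E.
  rewrite -(cvg_lim _ cv)//; apply: lime_le; first by apply/cvg_ex; eexists; exact: cv.
  exact: nearW.
have -> : \Rint_ I h = \Rint_ T (fun y => h y * ind y).
  have TI : T `&` I = I by rewrite setIC; apply/setIidPl.
  by rewrite -{1}TI Rintegral_mkcondr; apply: eq_Rintegral => y _; exact: ind_patch.
rewrite /Rintegral -lee_fin fineK//; exact: integrable_fin_num hind_int.
Qed.
End IntervalAverage.

(** If h x exceeds M by c at a Lebesgue point x, small averages of h around x are at most M, so
    those of |h - h x| stay above c and cannot tend to 0. *)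
Lemma fejer_le_ae (h : R -> R) (M : R) : Int T h ->
  (forall N x, (0 < N)%N -> \Rint_ T (fun y => h y * fejer_kernel N (x - y)) <= M * (2 * pi)) ->
  {ae mu, forall y, T y -> h y <= M}.
Proof.
move=> ih HM.
have loc := integrable_locally_restrict mT ih.
apply: (lebesgue_ae2 (lebesgue_differentiation loc) (lebesgue_ae_neq2 0 (2 * pi))).
move=> x leb [x0 x2] Tx; have := Tx; rewrite /torus_itv /= in_itv /= => /andP[h1 h2].
have xp : 0 < x by rewrite lt_neqAle eq_sym x0.
have xm : x < 2 * pi by rewrite lt_neqAle x2.
rewrite leNgt; apply/negP => Mh.
pose c := h x - M.
have c0 : 0 < c by rewrite subr_gt0.
have big (r : R) : 0 < r -> r <= x -> r <= 2 * pi - x -> (c%:E <= davg (h \_ T) x r)%E.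
  move=> r0 rx rx2.
  pose E : set RT := `]x - r, x + r[%classic.
  have ET : E `<=` T.
    by move=> y; rewrite /E /torus_itv /= !in_itv /= => /andP[y1 y2]; apply/andP; split; lra.
  have mE : measurable E by exact: measurable_itv.
  have muE : mu E = (2 * r)%:E.
    rewrite /E lebesgue_measure_itv /= lte_fin ltrD2l gtrN// -EFinB; congr EFin; ring.
  have hTE : {in E, h \_ T =1 h}.
    by move=> y; rewrite inE => /ET Ty; rewrite patchE mem_set.
  have iE : Int E h by exact: integrableS ih.
  have iEc : Int E (fun y => h x - h y).
    have ic : Int E (fun=> h x).
      apply: (integrableS mT mE ET).
      by apply: integrable_continuous => ?; exact: cvg_cst.
    by have := integrableB mE ic iE; apply: eq_integrable.
  have avg : \Rint_ E h <= M * (2 * r).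
    have -> : \Rint_ E h = \Rint_ (`[x - r, x + r]%classic) h.
      rewrite /E Rintegral_itv_bndo_bndc// Rintegral_itv_obnd_cbnd//.
      apply: integrableS ih => // y; rewrite /torus_itv /= !in_itv /= => /andP[y1 y2]; apply/andP; split; lra.
    have := @interval_average_le h M (x - r) (x + r) ih _ _ _ HM.
    rewrite (_ : x + r - (x - r) = 2 * r); last by ring.
    by apply; lra.
  rewrite /davg /iavg (_ : ball x r = E); last first.
    by rewrite /E ball_itv.
  rewrite muE inver gt_eqF ?mulr_gt0//.
  have iEn : Int E (fun y => `|h y - h x|).
    have := integrable_norm iEc; apply: eq_integrable => // y _ /=; by rewrite distrC.
  have -> : (\int[mu]_(y in E) `|((center ((h \_ T) x) \o (h \_ T)) y)%:E| =
      (\Rint_ E (fun y => `|h y - h x|))%:E)%E.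
    rewrite /Rintegral fineK; last exact: (integrable_fin_num mE iEn).
    by apply: eq_integral => y yE; rewrite /= /shift /= hTE// patchE mem_set.
  rewrite -EFinM lee_fin ler_pdivlMl ?mulr_gt0//.
  apply: (@le_trans _ _ (\Rint_ E (fun y => h x - h y))); last first.
    by apply: le_Rintegral => // y _; rewrite distrC; exact: ler_norm.
  have ic : Int E (fun=> h x).
    apply: (integrableS mT mE ET).
    by apply: integrable_continuous => ?; exact: cvg_cst.
  rewrite RintegralB// (_ : \Rint_ E (fun=> h x) = h x * (2 * r)); last first.
    by rewrite Rintegral_cst//; congr (_ * _); exact: (congr1 fine muE).
  rewrite /c mulrBr; lra.
have := leb; rewrite /lebesgue_pt => /fine_cvgP[near1 /cvgrPdist_lt /(_ _ c0) near0].
have [r [r0 rx rx2 rf rc]] : exists r, [/\ 0 < r, r <= x, r <= 2 * pi - x,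
    davg (h \_ T) x r \is a fin_num & `|0 - fine (davg (h \_ T) x r)| < c].
  have : \forall r \near (0:R)^'+, [/\ 0 < r, r <= x, r <= 2 * pi - x,
      davg (h \_ T) x r \is a fin_num & `|0 - fine (davg (h \_ T) x r)| < c].
    near=> r; split.
    - by near: r; exact: nbhs_right_gt.
    - by near: r; apply: nbhs_right_le.
    - by near: r; apply: nbhs_right_le; rewrite subr_gt0.
    - by near: r; exact: near1.
    - by near: r; exact: near0.
  by move=> /filter_ex[r Hr]; exists r.
have := big r r0 rx rx2; move: rc; rewrite sub0r normrN -(fineK rf) lee_fin => h3 h4.
by have := ler_norm (fine (davg (h \_ T) x r)); rewrite /= in h3; lra.
Unshelve. all: by end_near.
Qed.

(** * Fejer means on the torus *)

(** The real part of e^(i beta) (a + i b) as a function of the free phase. *)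
Definition sinusoid (f : R -> R) : Prop :=
  exists a b, forall beta, f beta = a * cos beta - b * sin beta.

Lemma sinusoid_addB f beta theta : sinusoid f ->
  f (beta + theta) + f (beta - theta) = 2 * (cos theta * f beta).
Proof. by move=> [a [b fE]]; rewrite !fE cosD cosB sinD sinB; ring. Qed.

Lemma sinusoid_shift f c : sinusoid f -> sinusoid (fun beta => f (beta + c)).
Proof.
move=> [a [b fE]]; exists (a * cos c - b * sin c), (a * sin c + b * cos c) => beta.
by rewrite fE cosD sinD; ring.
Qed.

Lemma sinusoid_sum (I : Type) (r : seq I) (f : I -> R -> R) :
  (forall i, sinusoid (f i)) -> sinusoid (fun beta => \sum_(i <- r) f i beta).
Proof.
move=> fs; elim: r => [|i r [a [b IH]]].
  by exists 0, 0 => beta; rewrite big_nil !mul0r subrr.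
have [a' [b' fE]] := fs i.
by exists (a' + a), (b' + b) => beta; rewrite big_cons IH fE; ring.
Qed.

Lemma continuous_sum_seq (I : Type) (r : seq I) (f : I -> R -> R) :
  (forall i, continuous (f i)) -> continuous (fun x => \sum_(i <- r) f i x).
Proof.
move=> cf; elim: r => [|i r IH] x.
  by under eq_fun do rewrite big_nil; exact: cvg_cst.
by under eq_fun do rewrite big_cons; apply: cvgD; [exact: cf|exact: IH].
Qed.

Lemma sinusoid_continuous f (a c : R) : sinusoid f -> continuous (fun x : R => f (a * x + c)).
Proof.
move=> [u [v fE]]; under eq_fun do rewrite fE.
have e (x : R) : sin (a * x + c) = cos (a * x + (c - pi / 2)) by rewrite addrA cosBpihalf.
under eq_fun do rewrite e.
by move=> x; apply: cvgB; apply: cvgMr; rewrite ?e; exact: continuous_cos_affine.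
Qed.

Lemma Rintegral_sinusoid f (m : int) c : sinusoid f ->
  \Rint_ T (fun y => f (m%:~R * y + c)) = if m == 0 then 2 * pi * f c else 0.
Proof.
move=> [u [v fE]].
have ic w : Int T (fun y => cos (m%:~R * y + w)).
  by apply: integrable_continuous; exact: continuous_cos_affine.
have -> : \Rint_ T (fun y => f (m%:~R * y + c)) =
    \Rint_ T (fun y => u * cos (m%:~R * y + c) + (- v) * cos (m%:~R * y + (c - pi / 2))).
  by apply: eq_Rintegral => y _; rewrite fE (addrA _ c) cosBpihalf mulNr.
rewrite RintegralD//; [|exact: integrableZ_fun..].
rewrite !RintegralZl// !Rintegral_cos_int cosBpihalf fE; case: ifP => _; ring.
Qed.

(* [A k beta] stands for the real part of e^(i beta) c_k. With z_i = (N_i - 1, x_i),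
   [fejer A z beta] is then the real part of
   e^(i beta) sum_k prod_i max(0, 1 - |k_i| / N_i) e^(i k.x) c_k;
   a missing entry of [z] counts as (0, 0). *)
Fixpoint fejer (n : nat) : (n.-tuple int -> R -> R) -> seq (nat * R) -> R -> R :=
  match n return (n.-tuple int -> R -> R) -> seq (nat * R) -> R -> R with
  | 0 => fun A _ beta => A [tuple] beta
  | n'.+1 => fun A z beta =>
      let w := head (0%N, 0) z in
      w.1.+1%:R^-1 * \sum_(s < w.1.+1) \sum_(s' < w.1.+1)
        fejer (fun (k : n'.-tuple int) b =>
          A (cons_tuple (s%:Z - s'%:Z) k) (b + (s%:Z - s'%:Z)%:~R * w.2)) (behead z) beta
  end.

(** The nodes and weights do not depend on [A], so integrability, continuity and measurability pass
    from [A] to its Fejer means. *)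
Lemma fejerE n z beta : exists l : seq (R * (n.-tuple int * R)),
  forall A, fejer A z beta = \sum_(q <- l) q.1 * A q.2.1 q.2.2.
Proof.
elim: n z beta => [|n IH] z beta.
  by exists [:: (1, ([tuple], beta))] => A; rewrite /= big_seq1 mul1r.
have [l lE] := IH (behead z) beta; set w := head (0%N, 0) z.
exists [seq (w.1.+1%:R^-1 * q.1, (cons_tuple (s.1%:Z - s.2%:Z) q.2.1,
   q.2.2 + (s.1%:Z - s.2%:Z)%:~R * w.2)) | s : ('I_w.1.+1 * 'I_w.1.+1)%type <- index_enum _, q : R * (n.-tuple int * R) <- l] => A.
rewrite big_allpairs_dep /= mulr_sumr -/w.
rewrite -(pair_bigA _ (fun s s' : 'I_w.1.+1 => \sum_(q <- l) w.1.+1%:R^-1 * q.1 *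
  A (cons_tuple (s%:Z - s'%:Z) q.2.1) (q.2.2 + (s%:Z - s'%:Z)%:~R * w.2))) /=.
apply: eq_bigr => s _; rewrite mulr_sumr; apply: eq_bigr => s' _.
by rewrite lE mulr_sumr; apply: eq_bigr => q _; rewrite mulrA.
Qed.

(** If [A] is made of the Fourier coefficients of [B] in the first coordinate, the first Fejer mean
    of [A] is an integral against the one-dimensional kernel. The sinusoid condition is only almost
    everywhere because slices of an integrable function are integrable only for almost every y. *)
Lemma fejer_step n (A : n.+1.-tuple int -> R -> R) (B : R -> n.-tuple int -> R -> R) N x z beta :
  (forall (s s' : 'I_N.+1) k b, let m := (s%:Z - s'%:Z)%:~R in
     A (cons_tuple (s%:Z - s'%:Z) k) b = (2 * pi)^-1 * \Rint_ T (fun y => B y k (b - m * y))) ->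
  (forall (s s' : 'I_N.+1) k b, Int T (fun y => B y k (b - (s%:Z - s'%:Z)%:~R * y))) ->
  {ae mu, forall y, T y -> forall k, sinusoid (B y k)} ->
  fejer A ((N, x) :: z) beta =
    (2 * pi)^-1 * \Rint_ T (fun y => fejer (B y) z beta * fejer_kernel N.+1 (x - y)).
Proof.
move=> AE iB sB; have [l lE] := fejerE n z beta.
have iBB (s s' : 'I_N.+1) q : Int T (fun y => q.1 *
    B y q.2.1 (q.2.2 + (s%:Z - s'%:Z)%:~R * x - (s%:Z - s'%:Z)%:~R * y)).
  by apply: integrableZ_fun => //; exact: iB.
transitivity ((2 * pi)^-1 * (N.+1%:R^-1 * \Rint_ T (fun y => \sum_(s < N.+1) \sum_(s' < N.+1) \sum_(q <- l)
    q.1 * B y q.2.1 (q.2.2 + (s%:Z - s'%:Z)%:~R * x - (s%:Z - s'%:Z)%:~R * y)))).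
  rewrite /= mulrCA; congr (_ * _).
  rewrite Rintegral_sum_fun//; last first.
    by move=> s; apply: integrable_sum_fun => // s'; apply: integrable_sum_fun => // q; exact: iBB.
  rewrite mulr_sumr; apply: eq_bigr => s _.
  rewrite Rintegral_sum_fun//; last by move=> s'; apply: integrable_sum_fun => // q; exact: iBB.
  rewrite mulr_sumr; apply: eq_bigr => s' _.
  rewrite Rintegral_sum_fun; [|exact: mT|by move=> q; exact: iBB].
  rewrite lE mulr_sumr; apply: eq_bigr => q _.
  by rewrite RintegralZl; [rewrite AE mulrCA|exact: mT|exact: iB].
congr (_ * _).
rewrite -RintegralZl; [|exact: mT|]; last first.
  by apply: integrable_sum_fun => // s; apply: integrable_sum_fun => // s'; apply: integrable_sum_fun => // q; exact: iBB.
rewrite /Rintegral; congr fine; apply: ae_eq_integral.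
- exact: mT.
- apply: measurable_int; apply: integrableZ_fun => //.
  by apply: integrable_sum_fun => // s; apply: integrable_sum_fun => // s'; apply: integrable_sum_fun => // q; exact: iBB.
- apply/measurable_EFinP; apply: measurable_funM; last first.
    apply: (measurable_funS measurableT) => //; apply: continuous_measurable_fun.
    exact: continuous_fejer_shift.
  (* The pair s = s' = 0 has frequency 0, so [iB] yields the measurability of the unshifted mean. *)
  have : Int T (fun y => \sum_(q <- l) q.1 * B y q.2.1 (q.2.2 - ((ord0 : 'I_N.+1)%:Z - (ord0 : 'I_N.+1)%:Z)%:~R * y)).
    by apply: integrable_sum_fun => // q; apply: integrableZ_fun => //; exact: iB.
  move=> /measurable_int/measurable_EFinP; apply: eq_measurable_fun => y _.
  by rewrite lE; apply: eq_bigr => q _; rewrite mul0r subr0.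
apply: (lebesgue_aeS sB) => y {}sB Ty; congr EFin; rewrite lE /fejer_kernel.
rewrite mulrCA; congr (_ * _).
(* exchanging s and s' leaves only the cosine part of the shift by m (x - y) *)
set S := LHS; have -> : S = 2^-1 * (S + S) by lra.
rewrite {2}/S exchange_big /S -big_split mulr_sumr mulr_sumr; apply: eq_bigr => s _ /=.
rewrite -big_split mulr_sumr mulr_sumr; apply: eq_bigr => s' _ /=.
rewrite -big_split mulr_sumr mulr_suml; apply: eq_bigr => q _ /=.
rewrite -mulrDr; set m := (s%:Z - s'%:Z)%:~R.
have -> : (s'%:Z - s%:Z)%:~R = - m :> R by rewrite -intrN opprB.
rewrite (_ : q.2.2 + m * x - m * y = q.2.2 + m * (x - y)); last by ring.
rewrite (_ : q.2.2 + - m * x - - m * y = q.2.2 - m * (x - y)); last by ring.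
rewrite sinusoid_addB; last exact: sB.
by field.
Qed.

(** A Fejer mean of degree below 2^J uses only coefficients of the partial sum, and it averages the
    translates of that sum against a nonnegative kernel of normalized mass 1. The induction sums
    over one coordinate at a time. *)
Lemma fejer_le n (A : n.-tuple int -> R -> R) J M z beta :
  (forall k, sinusoid (A k)) ->
  (forall b x, \sum_(k <- cube n J) A k (b + dotk k x) <= M) ->
  all (fun w => w.1 < 2 ^ J)%N z -> fejer A z beta <= M.
Proof.
elim: n A z beta => [|n IH] A z beta sA AM zJ.
  have := AM beta [tuple]; rewrite /= big_seq1.
  by rewrite /dotk big_ord0 addr0.
have -> : fejer A z beta = fejer A (head (0%N, 0 : R) z :: behead z) beta by case: z zJ.
have hJ : ((head (0%N, 0%R : R) z).1 < 2 ^ J)%N.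
  by case: z zJ => [|w z] /=; [rewrite expn_gt0|move=> /andP[]].
have zJ' : all (fun w => w.1 < 2 ^ J)%N (behead z) by case: z zJ {hJ} => //= w z /andP[].
case: (head _ z) hJ => N x hN; rewrite /= in hN.
pose B y (k : n.-tuple int) b := \sum_(a <- int_range J) A (cons_tuple a k) (b + a%:~R * y).
have sB y k : sinusoid (B y k) by apply: sinusoid_sum => a; exact: sinusoid_shift.
have e (a m : int) k b (y : R) : A (cons_tuple a k) (b - m%:~R * y + a%:~R * y) = A (cons_tuple a k) ((a - m)%:~R * y + b).
  by rewrite intrB mulrBl; congr (A _); ring.
have iA (a m : int) k b : Int T (fun y => A (cons_tuple a k) (b - m%:~R * y + a%:~R * y)).
  apply: integrable_continuous; under eq_fun do rewrite e.
  exact: sinusoid_continuous.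
have AE (s s' : 'I_N.+1) k b : let m := (s%:Z - s'%:Z)%:~R in
     A (cons_tuple (s%:Z - s'%:Z) k) b = (2 * pi)^-1 * \Rint_ T (fun y => B y k (b - m * y)).
  move=> m; rewrite /B Rintegral_sum_fun; [|exact: mT|by move=> a; exact: iA].
  (* As N < 2^J the frequency s - s' is in the range, so orthogonality selects exactly one term. *)
  have mr : (s%:Z - s'%:Z) \in int_range J.
    rewrite mem_int_range; have := ltn_ord s; have := ltn_ord s'; move: hN {m}.
    move: (2 ^ J)%N (nat_of_ord s) (nat_of_ord s') => q u v; clear; lia.
  rewrite (bigD1_seq _ mr (int_range_uniq J)) /= big1_seq.
    rewrite addr0; under eq_Rintegral do rewrite e.
    by rewrite Rintegral_sinusoid// subrr eqxx mulKf ?gt_eqF.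
  move=> a /andP[am _]; under eq_Rintegral do rewrite e.
  by rewrite Rintegral_sinusoid// subr_eq0 (negPf am).
have iB (s s' : 'I_N.+1) k b : Int T (fun y => B y k (b - (s%:Z - s'%:Z)%:~R * y)).
  by apply: integrable_sum_fun.
rewrite (fejer_step _ _ _ AE iB); last by apply: aeW => y _; exact: sB.
rewrite ler_pdivrMl// -(Rintegral_fejer_kernel x (ltn0Sn N)).
have ik : Int T (fun y => fejer_kernel N.+1 (x - y)).
  by apply: integrable_continuous; exact: continuous_fejer_shift.
rewrite -RintegralZr//.
have ifB : Int T (fun y => fejer (B y) (behead z) beta * fejer_kernel N.+1 (x - y)).
  have [l lE] := fejerE n (behead z) beta.
  have cB : continuous (fun y => fejer (B y) (behead z) beta).
    under eq_fun do rewrite lE.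
    apply: continuous_sum_seq => q; move=> y; apply: cvgMr.
    move: y; apply: continuous_sum_seq => a.
    under eq_fun do rewrite addrC.
    exact: sinusoid_continuous.
  apply: integrable_continuous => y; apply: cvgM; [exact: cB|exact: continuous_fejer_shift].
apply: le_Rintegral => //.
  by have := integrableZ_fun M mT ik; apply: eq_integrable => // y _ /=; rewrite mulrC.
move=> y _; rewrite [leRHS]mulrC; apply: ler_wpM2r; first exact: fejer_kernel_ge0.
apply: IH => // b x'.
apply: le_trans (AM b (cons_tuple y x')).
rewrite /= big_allpairs_dep exchange_big /=; apply: ler_sum => k _.
rewrite /B; apply: ler_sum => a _; rewrite /dotk big_ord_recl tnth0.
by under [X in _ <= A _ (b + (_ + X))]eq_bigr do rewrite !tnthS; rewrite addrA (addrAC b).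
Qed.

(** * Measurability, slices and linearity of the iterated integrals *)

Lemma torus_int_nneg_ge0 n (f : n.-tuple R -> \bar R) :
  (forall x, 0 <= f x)%E -> (0 <= torus_int_nneg f)%E.
Proof.
elim: n f => [|n IH] f f0 /=; first exact: f0.
by apply: integral_ge0 => y _; exact: IH.
Qed.

Lemma measurable_integral_param d (S : measurableType d) (g : S * RT -> \bar R) :
  measurable_fun setT g -> (forall q, 0 <= g q)%E ->
  measurable_fun setT (fun p => \int[mu]_(y in T) g (p, y))%E.
Proof.
move=> mg g0; pose D : set (S * RT) := setT `*` T.
have mD : measurable D by exact: measurableX.
have mgD : measurable_fun setT (g \_ D).
  by apply/(measurable_restrictT g mD); exact: measurable_funS mg.
have gD0 q : (0 <= (g \_ D) q)%E by apply: erestrict_ge0.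
have := @measurable_fun_fubini_tonelli_F _ _ S RT R mu (g \_ D) mgD gD0.
apply: eq_measurable_fun => p _; rewrite /fubini_F [RHS]integral_mkcond.
apply: eq_integral => y _; rewrite /patch.
rewrite (_ : ((p, y) \in D) = (y \in T))//.
by apply/idP/idP => /set_mem h; apply/mem_set; [case: h|split].
Qed.

Lemma measurable_cons_param d (S : measurableType d) n :
  measurable_fun setT (fun q : (S * RT) * n.-tuple R => (q.1.1, cons_tuple q.1.2 q.2)).
Proof.
apply/measurable_fun_pairP; split => /=.
  exact: (measurableT_comp measurable_fst measurable_fst).
apply: measurable_cons; last exact: measurable_snd.
exact: (measurableT_comp measurable_snd measurable_fst).
Qed.

Lemma measurable_torus_int_nneg n d (S : measurableType d) (f : S * n.-tuple R -> \bar R) :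
  measurable_fun setT f -> (forall q, 0 <= f q)%E ->
  measurable_fun setT (fun p => torus_int_nneg (fun x => f (p, x))).
Proof.
elim: n d S f => [|n IH] d S f mf f0 /=.
  by apply: (measurableT_comp mf); exact: measurable_pair2.
apply: (@measurable_integral_param _ _ (fun q => torus_int_nneg (fun x => f (q.1, cons_tuple q.2 x)))).
  apply: (IH _ _ (fun q => f (q.1.1, cons_tuple q.1.2 q.2))) => //.
  by apply: (measurableT_comp mf); exact: measurable_cons_param.
by move=> q; exact: torus_int_nneg_ge0.
Qed.

(** [fine] of a difference of two measurable integrals is measurable, whatever default value it
    takes where the integral is not finite. *)
Lemma measurable_torus_Rint n d (S : measurableType d) (f : S * n.-tuple R -> R) :
  measurable_fun setT f -> measurable_fun setT (fun p => torus_Rint (fun x => f (p, x))).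
Proof.
elim: n d S f => [|n IH] d S f mf /=.
  by apply: (measurableT_comp mf); exact: measurable_pair2.
pose g (q : S * RT) := torus_Rint (fun x => f (q.1, cons_tuple q.2 x)).
have mg : measurable_fun setT (EFin \o g).
  apply/measurable_EFinP; apply: (IH _ _ (fun q => f (q.1.1, cons_tuple q.1.2 q.2))).
  by apply: (measurableT_comp mf); exact: measurable_cons_param.
have e p : \Rint_ T (fun y => g (p, y)) =
    fine (\int[mu]_(y in T) (EFin \o g)^\+ (p, y) - \int[mu]_(y in T) (EFin \o g)^\- (p, y))%E.
  rewrite /Rintegral integralE; congr fine; congr (_ - _)%E; apply: eq_integral => y _; by rewrite unlock.
rewrite (_ : (fun p => _) = (fun p => \Rint_ T (fun y => g (p, y))))//.
under eq_fun do rewrite e.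
apply: measurableT_comp; first exact: fine_measurable.
apply: emeasurable_funB; apply: measurable_integral_param => //.
- exact: measurable_funepos.
- exact: measurable_funeneg.
Qed.

Lemma measurable_slice n (f : n.+1.-tuple R -> R) (y : R) : measurable_fun setT f ->
  measurable_fun setT (fun x : n.-tuple R => f (cons_tuple y x)).
Proof. by move=> mf; apply: (measurableT_comp mf); apply: measurable_cons. Qed.

Lemma measurable_cons_pair n :
  measurable_fun setT (fun q : RT * n.-tuple R => cons_tuple q.1 q.2).
Proof. by apply: measurable_cons; [exact: measurable_fst|exact: measurable_snd]. Qed.

Lemma measurable_torus_int_nneg_slice n (f : n.+1.-tuple R -> \bar R) :
  measurable_fun setT f -> (forall x, 0 <= f x)%E ->
  measurable_fun (setT : set RT) (fun y => torus_int_nneg (fun x => f (cons_tuple y x))).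
Proof.
move=> mf f0; apply: (@measurable_torus_int_nneg _ _ RT (fun q => f (cons_tuple q.1 q.2))) => //.
by apply: (measurableT_comp mf); exact: measurable_cons_pair.
Qed.

Lemma measurable_torus_Rint_slice n (f : n.+1.-tuple R -> R) :
  measurable_fun setT f ->
  measurable_fun (setT : set RT) (fun y => torus_Rint (fun x => f (cons_tuple y x))).
Proof.
move=> mf; apply: (@measurable_torus_Rint _ _ RT (fun q => f (cons_tuple q.1 q.2))).
by apply: (measurableT_comp mf); exact: measurable_cons_pair.
Qed.

Lemma le_torus_int_nneg n (f g : n.-tuple R -> R) :
  measurable_fun setT f -> measurable_fun setT g -> (forall x, 0 <= f x <= g x) ->
  (torus_int_nneg (EFin \o f) <= torus_int_nneg (EFin \o g))%E.
Proof.
elim: n f g => [|n IH] f g mf mg fg /=.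
  by rewrite lee_fin; have /andP[] := fg [tuple].
have f0 x : 0 <= f x by have /andP[] := fg x.
have g0 x : 0 <= g x by have /andP[h /(le_trans h)] := fg x.
apply: ge0_le_integral => //.
- by move=> y _; apply: torus_int_nneg_ge0 => x; rewrite lee_fin.
- apply: (measurable_funS measurableT) => //.
  by apply: (measurable_torus_int_nneg_slice (f := EFin \o f)) => //; exact/measurable_EFinP.
- apply: (measurable_funS measurableT) => //.
  by apply: (measurable_torus_int_nneg_slice (f := EFin \o g)) => //; exact/measurable_EFinP.
- move=> y _; apply: (IH (fun x => f (cons_tuple y x)) (fun x => g (cons_tuple y x))) => //.
  + exact: measurable_slice.
  + exact: measurable_slice.
Qed.

Lemma le_normr_torus_Rint n (f : n.-tuple R -> R) : measurable_fun setT f ->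
  (`|torus_Rint f|%:E <= torus_int_nneg (fun x => `|f x|%:E))%E.
Proof.
elim: n f => [//|n IH] f mf /=.
have mfy := measurable_torus_Rint_slice mf.
have fineN (x : \bar R) : (`|fine x|%:E <= `|x|)%E.
  by case: x => //=; rewrite normr0 leey.
apply: le_trans (fineN _) _.
apply: le_trans (le_abse_integral _ _ _) _ => //.
  by apply/measurable_EFinP; exact: measurable_funS mfy.
apply: ge0_le_integral => //.
- apply: measurableT_comp => //; apply/measurable_EFinP; exact: measurable_funS mfy.
- apply: (measurable_funS measurableT) => //.
  apply: (measurable_torus_int_nneg_slice (f := fun x => `|f x|%:E)) => //.
  by apply/measurable_EFinP; exact: measurableT_comp.
- by move=> y _; apply: IH; exact: measurable_slice.
Qed.

Definition torus_integrable n (f : n.-tuple R -> R) : Prop :=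
  measurable_fun setT f /\ (torus_int_nneg (fun x => `|f x|%:E) < +oo)%E.

Lemma le_torus_integrable n (f g : n.-tuple R -> R) : measurable_fun setT f ->
  (forall x, `|f x| <= g x) -> torus_integrable g -> torus_integrable f.
Proof.
move=> mf fg [mg gi]; split => //; apply: le_lt_trans gi.
apply: (le_torus_int_nneg (f := fun x => `|f x|) (g := fun x => `|g x|)).
- exact: measurableT_comp.
- exact: measurableT_comp.
- by move=> x; rewrite normr_ge0 (le_trans (fg x))// ler_norm.
Qed.

(** A function with finite integral, here the inner iterated integral, is finite almost
    everywhere. *)
Lemma torus_integrable_slice n (f : n.+1.-tuple R -> R) : torus_integrable f ->
  {ae mu, forall y, T y -> torus_integrable (fun x => f (cons_tuple y x))}.
Proof.
move=> [mf fi].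
have mabs : measurable_fun setT (fun x => `|f x|%:E).
  by apply/measurable_EFinP; exact: measurableT_comp.
have i : mu.-integrable T (fun y => torus_int_nneg (fun x : n.-tuple R => `|f (cons_tuple y x)|%:E)).
  apply/integrableP; split.
    apply: (measurable_funS measurableT) => //.
    exact: (measurable_torus_int_nneg_slice mabs).
  rewrite (_ : integral _ _ _ = torus_int_nneg (fun x => `|f x|%:E))//.
  by apply: eq_integral => y _; rewrite gee0_abs//; exact: torus_int_nneg_ge0.
apply: (lebesgue_aeS (integrable_ae mT i)) => y h Ty; split.
  exact: measurable_slice.
by rewrite -ge0_fin_numE; [exact: h|exact: torus_int_nneg_ge0].
Qed.

Lemma integrable_torus_Rint_slice n (f : n.+1.-tuple R -> R) : torus_integrable f ->
  Int T (fun y => torus_Rint (fun x => f (cons_tuple y x))).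
Proof.
move=> [mf fi]; have mfy := measurable_torus_Rint_slice mf.
apply/integrableP; split; first by apply/measurable_EFinP; exact: measurable_funS mfy.
apply: le_lt_trans fi => /=; apply: ge0_le_integral => //.
- apply/measurable_EFinP; apply: measurableT_comp => //; exact: measurable_funS mfy.
- apply: (measurable_funS measurableT) => //.
  apply: (measurable_torus_int_nneg_slice (f := fun x => `|f x|%:E)) => //.
  by apply/measurable_EFinP; exact: measurableT_comp.
- by move=> y _; apply: le_normr_torus_Rint; exact: measurable_slice.
Qed.

(** On a null set of slices the inner integrals may take default values and fail to be linear, so
    the integrands of the outer integral agree only almost everywhere. *)
Lemma torus_Rint_lin n (a b : R) (f g : n.-tuple R -> R) :
  torus_integrable f -> torus_integrable g ->
  torus_Rint (fun x => a * f x + b * g x) = a * torus_Rint f + b * torus_Rint g.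
Proof.
elim: n f g => [//|n IH] f g fi gi /=.
have fyi := integrable_torus_Rint_slice fi; have gyi := integrable_torus_Rint_slice gi.
rewrite -!RintegralZl// -RintegralD//; [|exact: integrableZ_fun..].
rewrite /Rintegral; congr fine; apply: ae_eq_integral => //.
- apply/measurable_EFinP; apply: (measurable_funS measurableT) => //.
  apply: (measurable_torus_Rint_slice (f := fun x => a * f x + b * g x)).
  by apply: measurable_funD; apply: measurable_funM => //; [exact: fi.1|exact: gi.1].
- by apply: measurable_int; apply: integrableD_fun => //; exact: integrableZ_fun.
apply: (lebesgue_ae2 (torus_integrable_slice fi) (torus_integrable_slice gi)).
by move=> y hf hg Ty; rewrite IH//; [exact: hf|exact: hg].
Qed.

Lemma measurable_dotk n (k : n.-tuple int) : measurable_fun setT (fun x : n.-tuple R => dotk k x).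
Proof.
apply: measurable_sum => i; apply: measurable_funM => //.
exact: measurable_tnth.
Qed.

(** Countably many conditions can be imposed simultaneously almost everywhere; this lemma restores
    the real nodes and phases. *)
Lemma continuous_le_ratr (g : R -> R) (M : R) : continuous g ->
  (forall q : rat, g (ratr q) <= M) -> forall x, g x <= M.
Proof.
move=> cg gM x; rewrite leNgt; apply/negP => Mgx.
have oO : open (g @^-1` [set y | M < y]).
  by move/continuousP : cg; apply; exact: open_gt.
have [y [/= My [q _ qy]]] := @dense_rat R _ (ex_intro _ x Mgx) oO.
by have := gM q; rewrite qy leNgt My.
Qed.

(** The maximum over the phase is reached at plus or minus acos (a / r), according to the sign of
    b. *)
Lemma cmod_le (a b M : R) :
  (forall beta, a * cos beta - b * sin beta <= M) -> cmod a b <= M.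
Proof.
move=> H; rewrite /cmod; set r := Num.sqrt _.
have r2 : r ^+ 2 = a ^+ 2 + b ^+ 2 by rewrite sqr_sqrtr// addr_ge0 ?sqr_ge0.
have [r0|r0] := eqVneq r 0.
  rewrite r0; have := H 0; have := H pi; rewrite cos0 sin0 cospi sinpi; lra.
have rp : 0 < r by rewrite lt_neqAle eq_sym r0 sqrtr_ge0.
have ar : -1 <= a / r <= 1.
  rewrite ler_pdivrMr// ler_pdivlMr// mulN1r mul1r -ler_norml.
  rewrite -(@ler_pXn2r _ 2)// ?nnegrE ?(ltW rp)// real_normK ?num_real// r2.
  by rewrite lerDl sqr_ge0.
have ca : a * cos (acos (a / r)) = a ^+ 2 / r by rewrite acosK ?in_itv//= expr2 mulrA.
have sa : sin (acos (a / r)) = `|b| / r.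
  have e : 1 - (a / r) ^+ 2 = (`|b| / r) ^+ 2.
    rewrite !expr_div_n real_normK ?num_real//.
    apply: (mulIf (x := r ^+ 2)); first by rewrite expf_neq0.
    by rewrite mulrBl !divfK ?expf_neq0// mul1r r2 addrC addKr.
  by rewrite sin_acos// e sqrtr_sqr ger0_norm// divr_ge0// ltW.
have fin : a ^+ 2 / r + b * b / r <= M -> r <= M.
  by rewrite -mulrDl -[b * b]expr2 -r2 expr2 mulfK.
apply: fin; have [b0|b0] := leP 0 b.
  have := H (- acos (a / r)); rewrite cosN sinN ca sa ger0_norm//.
  by rewrite mulrN opprK mulrA.
have := H (acos (a / r)); rewrite ca sa ltr0_norm//.
by rewrite mulNr mulrN opprK mulrA.
Qed.

(** * Fourier coefficients with a free phase, and pointwise bounds from Fejer means *)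

Definition rotate n (ur ui : n.-tuple R -> R) (k : n.-tuple int) (beta : R) (x : n.-tuple R) : R :=
  ur x * cos (beta - dotk k x) - ui x * sin (beta - dotk k x).

(** The real part of e^(i beta) times the k-th Fourier coefficient of ur + i ui. *)
Definition torus_coef n (ur ui : n.-tuple R -> R) (k : n.-tuple int) (beta : R) : R :=
  (2 * pi) ^- n * torus_Rint (rotate ur ui k beta).

Definition torus_field n (ur ui : n.-tuple R -> R) : Prop :=
  [/\ measurable_fun setT ur, measurable_fun setT ui &
      torus_integrable (fun x => cmod (ur x) (ui x))].

Lemma normr_rotate_le (a b c s : R) : c ^+ 2 + s ^+ 2 = 1 -> `|a * c - b * s| <= cmod a b.
Proof.
move=> cs; rewrite /cmod -(@ler_pXn2r _ 2)// ?nnegrE ?sqrtr_ge0//.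
rewrite real_normK ?num_real// sqr_sqrtr ?addr_ge0 ?sqr_ge0//.
have := sqr_ge0 (a * s + b * c).
have -> : a ^+ 2 + b ^+ 2 = (a ^+ 2 + b ^+ 2) * (c ^+ 2 + s ^+ 2) by rewrite cs mulr1.
nra.
Qed.

Lemma torus_integrable_rot n (ur ui : n.-tuple R -> R) (c s : n.-tuple R -> R) :
  torus_field ur ui -> measurable_fun setT c -> measurable_fun setT s ->
  (forall x, c x ^+ 2 + s x ^+ 2 = 1) ->
  torus_integrable (fun x => ur x * c x - ui x * s x).
Proof.
move=> [mr mi iu] mc ms cs; apply: le_torus_integrable iu.
  by apply: measurable_funB; apply: measurable_funM.
by move=> x; exact: normr_rotate_le.
Qed.

Lemma measurable_cos_dotk n (k : n.-tuple int) (b : R) :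
  measurable_fun setT (fun x : n.-tuple R => cos (b - dotk k x)).
Proof.
apply: (measurableT_comp (f := cos)); first by apply: continuous_measurable_fun; exact: continuous_cos.
by apply: measurable_funB => //; exact: measurable_dotk.
Qed.

Lemma measurable_sin_dotk n (k : n.-tuple int) (b : R) :
  measurable_fun setT (fun x : n.-tuple R => sin (b - dotk k x)).
Proof.
apply: (measurableT_comp (f := sin)); first by apply: continuous_measurable_fun; exact: continuous_sin.
by apply: measurable_funB => //; exact: measurable_dotk.
Qed.

Lemma torus_integrable_rotate n (ur ui : n.-tuple R -> R) k beta :
  torus_field ur ui -> torus_integrable (rotate ur ui k beta).
Proof.
move=> h; apply: torus_integrable_rot h _ _ _.
- exact: measurable_cos_dotk.
- exact: measurable_sin_dotk.
- by move=> x; exact: cos2Dsin2.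
Qed.

Lemma torus_coefE n (ur ui : n.-tuple R -> R) k beta : torus_field ur ui ->
  torus_coef ur ui k beta =
  (2 * pi) ^- n * torus_Rint (fun x => ur x * cos (dotk k x) + ui x * sin (dotk k x)) * cos beta -
  (2 * pi) ^- n * torus_Rint (fun x => ui x * cos (dotk k x) - ur x * sin (dotk k x)) * sin beta.
Proof.
move=> h; rewrite /torus_coef.
have e1 : (fun x => ur x * cos (dotk k x) + ui x * sin (dotk k x)) = rotate ur ui k 0.
  by apply/funext => x; rewrite /rotate sub0r cosN sinN mulrN opprK.
have e2 : (fun x => ui x * cos (dotk k x) - ur x * sin (dotk k x)) = rotate ur ui k (- (pi / 2)).
  apply/funext => x; rewrite /rotate (_ : - (pi / 2) - dotk k x = - (dotk k x + pi / 2)); last by ring.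
  by rewrite cosN sinN cosDpihalf sinDpihalf; ring.
rewrite e1 e2.
have -> : rotate ur ui k beta =
    (fun x => cos beta * rotate ur ui k 0 x + (- sin beta) * rotate ur ui k (- (pi / 2)) x).
  apply/funext => x; rewrite -e1 -e2 /rotate cosB sinB; ring.
rewrite torus_Rint_lin; [ring|exact: torus_integrable_rotate..].
Qed.

Lemma sinusoid_torus_coef n (ur ui : n.-tuple R -> R) k : torus_field ur ui ->
  sinusoid (torus_coef ur ui k).
Proof. by move=> h; eexists; eexists => beta; exact: torus_coefE. Qed.

Lemma torus_field_slice n (ur ui : n.+1.-tuple R -> R) : torus_field ur ui ->
  {ae mu, forall y, T y ->
    torus_field (fun x => ur (cons_tuple y x)) (fun x => ui (cons_tuple y x))}.
Proof.
move=> [mr mi iu].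
apply: (lebesgue_aeS (torus_integrable_slice iu)) => y h Ty; split; last exact: h.
- exact: measurable_slice.
- exact: measurable_slice.
Qed.

Lemma rotate_cons n (ur ui : n.+1.-tuple R -> R) m k b y x :
  rotate ur ui (cons_tuple m k) b (cons_tuple y x) =
  rotate (fun x => ur (cons_tuple y x)) (fun x => ui (cons_tuple y x)) k (b - m%:~R * y) x.
Proof.
rewrite /rotate /dotk big_ord_recl !tnth0.
by under eq_bigr do rewrite !tnthS; rewrite opprD addrA.
Qed.

Definition rat_nodes (z : seq (nat * rat)) : seq (nat * R) := [seq (w.1, ratr w.2) | w <- z].

(** Induction on the dimension: for almost every first coordinate y, one-dimensional differentiation
    gives the same bound M for all Fejer means of the slice at y. The nodes are rational so that a
    single null set serves all of them. *)
Lemma torus_ae_cmod_le n (ur ui : n.-tuple R -> R) (M : R) : torus_field ur ui ->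
  (forall z (b : rat), fejer (torus_coef ur ui) (rat_nodes z) (ratr b) <= M) ->
  torus_ae (fun x => cmod (ur x) (ui x) <= M).
Proof.
elim: n ur ui => [|n IH] ur ui h HM /=.
  apply: cmod_le.
  apply: (@continuous_le_ratr (fun b => ur [tuple] * cos b - ui [tuple] * sin b)).
    by move=> x; apply: cvgB; apply: cvgMr; [exact: continuous_cos|exact: continuous_sin].
  move=> q; have := HM [::] q; rewrite /= /torus_coef /= /rotate /dotk big_ord0 subr0.
  by rewrite expr0 invr1 mul1r.
pose B (y : R) := torus_coef (fun x : n.-tuple R => ur (cons_tuple y x)) (fun x => ui (cons_tuple y x)).
have sB : {ae mu, forall y, T y -> forall k, sinusoid (B y k)}.
  apply: (lebesgue_aeS (torus_field_slice h)) => y hy Ty k.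
  by apply: sinusoid_torus_coef; exact: hy.
have sl m k b y : torus_Rint (rotate (fun x : n.-tuple R => ur (cons_tuple y x)) (fun x => ui (cons_tuple y x)) k (b - m%:~R * y)) =
    torus_Rint (fun x => rotate ur ui (cons_tuple m k) b (cons_tuple y x)).
  by congr torus_Rint; apply/funext => x; rewrite rotate_cons.
have iR m k b : Int T (fun y => torus_Rint (fun x : n.-tuple R => rotate ur ui (cons_tuple m k) b (cons_tuple y x))).
  by apply: integrable_torus_Rint_slice; exact: torus_integrable_rotate.
have iB m k b : Int T (fun y => B y k (b - m%:~R * y)).
  rewrite /B /torus_coef; under eq_fun do rewrite sl.
  exact: integrableZ_fun.
have AE m k b : torus_coef ur ui (cons_tuple m k) b = (2 * pi)^-1 * \Rint_ T (fun y => B y k (b - m%:~R * y)).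
  rewrite /B /torus_coef; under eq_Rintegral do rewrite sl.
  by rewrite RintegralZl// mulrA -invfM -exprS.
have key (q : seq (nat * rat) * rat) : {ae mu, forall y, T y -> fejer (B y) (rat_nodes q.1) (ratr q.2) <= M}.
  case: q => z b /=; have [l lE] := fejerE n (rat_nodes z) (ratr b).
  apply: fejer_le_ae.
    under eq_fun do rewrite lE.
    apply: integrable_sum_fun => // q; apply: integrableZ_fun => //.
    by have := iB 0 q.2.1 q.2.2; apply: eq_integrable => // y _; rewrite /= mul0r subr0.
  move=> [//|N] x _; rewrite mulrC -ler_pdivrMl//.
  rewrite -(@fejer_step _ (torus_coef ur ui)) //.
  apply: (@continuous_le_ratr (fun x => fejer (torus_coef ur ui) ((N, x) :: rat_nodes z) (ratr b))).
    move=> {}x /=; apply: cvgMr; move: x; apply: continuous_sum_seq => s; apply: continuous_sum_seq => s'.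
    have [l' lE'] := fejerE n (rat_nodes z) (ratr b).
    under eq_fun do rewrite lE'.
    apply: continuous_sum_seq => q x; apply: cvgMr.
    have e (w : R) : torus_coef ur ui (cons_tuple (s%:Z - s'%:Z) q.2.1) (q.2.2 + (s%:Z - s'%:Z)%:~R * w) =
      torus_coef ur ui (cons_tuple (s%:Z - s'%:Z) q.2.1) ((s%:Z - s'%:Z)%:~R * w + q.2.2).
      by rewrite (addrC q.2.2).
    under eq_fun do rewrite e; rewrite e.
    exact: (sinusoid_continuous (sinusoid_torus_coef _ h)).
  move=> q; have := HM ((N, q) :: z) b. exact: id.
(* Nodes and phases are enumerated by [unpickle], so a countable union of null sets suffices. *)
have all_key : {ae mu, forall y, forall i : nat, T y ->
    forall q : seq (nat * rat) * rat, unpickle i = Some q -> fejer (B y) (rat_nodes q.1) (ratr q.2) <= M}.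
  apply/ae_foralln => i; case: (unpickle i) => [q|]; last exact: aeW.
  by apply: (lebesgue_aeS (key q)) => y hq Ty _ [<-]; exact: hq.
apply: (lebesgue_ae2 all_key (torus_field_slice h)) => y hk hs Ty.
apply: IH; first exact: hs.
by move=> z b; exact: (hk _ Ty (z, b) (pickleK _)).
Qed.

End TorusFejer.

(** * The maximal estimate *)

Section RestrictedIntegral.
Context d (T : measurableType d) (R : realType) (mu : {measure set T -> \bar R}).
Context (D : set T) (mD : measurable D).
Import HBNNSimple.

Lemma sintegral_mrestr (h : {nnsfun T >-> R}) :
  sintegral (mrestr mu mD) h = (\int[mu]_(x in D) (h x)%:E)%E.
Proof.
rewrite sintegralE.
under [RHS]eq_integral => x _.
  rewrite fimfunE -fsumEFin//.
  under eq_fsbigr do rewrite EFinM.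
  over.
rewrite /= ge0_integral_fsum//.
- apply: eq_fsbigr => k kh; rewrite ge0_integralZl//.
  + by rewrite integral_indic.
  + by apply/measurable_EFinP.
  + by move: kh; rewrite inE => -[x _ <-]; rewrite lee_fin; exact: fun_ge0.
- by move=> k; apply: measurable_funeM; apply/measurable_EFinP.
- by move=> k x _; exact: nnfun_muleindic_ge0.
Qed.

(* The essential supremum in space may fail to be measurable in time, so the
   integrals are compared through the simple functions below [f]. *)
(* The essential supremum in space may fail to be measurable in time, so the
   integrals are compared through the simple functions below [f]. *)
Lemma le_integral_mrestr (f G : T -> \bar R) : (forall x, 0 <= f x)%E ->
  measurable_fun D G -> (forall x, D x -> f x <= G x)%E ->
  (\int[mrestr mu mD]_x f x <= \int[mu]_(x in D) G x)%E.
Proof.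
move=> f0 mG fG; rewrite ge0_integralTE//.
apply: ge_ereal_sup => _ [h /= hf <-]; rewrite sintegral_mrestr.
apply: ge0_le_integral => //.
- by move=> x _; rewrite lee_fin; exact: fun_ge0.
- apply/measurable_EFinP; exact: measurable_funS (measurable_funPT h).
- by move=> x Dx; exact: le_trans (hf x) (fG _ Dx).
Qed.

End RestrictedIntegral.

(** * Step functions in time and Fatou's lemma *)

Section StepFunctions.
Context (R : realType).
Notation mu := (@lebesgue_measure R).
Notation RT := (measurableTypeR R).

Lemma limn_einf_le (u : (\bar R)^nat) K : (forall n, u n <= K)%E -> (limn_einf u <= K)%E.
Proof.
move=> uK; rewrite limn_einf_lim; apply: lime_le; first exact: is_cvg_einfs.
apply: nearW => n; apply: le_trans (uK n).
by apply: ereal_inf_lbound; exists n => /=.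
Qed.

Lemma limn_einf_lt (u : (\bar R)^nat) x n : (limn_einf u < x)%E ->
  exists2 k, (n <= k)%N & (u k < x)%E.
Proof.
move=> ux; have : (einfs u n < x)%E.
  apply: le_lt_trans ux; rewrite limn_einf_lim (cvg_lim _ (@cvg_einfs_sup _ u))//.
  by apply: ereal_sup_ubound; exists n.
by move=> /ereal_inf_lt[_ [k /= nk <-] h]; exists k.
Qed.

(** The lower limit of the [S n] is a measurable majorant of [f], which itself may fail to be
    measurable. *)
Lemma integral_mu01_liminf_le (f : R -> \bar R) (S : nat -> R -> R) (K : \bar R) :
  (forall t, 0 <= f t)%E -> (forall n, measurable_fun (setT : set RT) (S n)) ->
  (forall n t, 0 <= S n t) ->
  (forall t : R, (0 <= t <= 1)%R -> f t <= limn_einf (fun n => (S n t)%:E))%E ->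
  (forall n, \int[mu]_(t in `[0%R, 1%R]) (S n t)%:E <= K)%E ->
  (\int[@mu01 R]_t f t <= K)%E.
Proof.
move=> f0 mS S0 fS SK; pose D : set RT := `[0%R, 1%R]%classic.
have mD : measurable D by exact: measurable_itv.
have mSD n : measurable_fun D (fun t => (S n t)%:E).
  by apply/measurable_EFinP; exact: measurable_funS (mS n).
apply: (@le_trans _ _ (\int[mu]_(t in D) limn_einf (fun n => (S n t)%:E))%E).
  apply: le_integral_mrestr => //.
    rewrite (_ : (fun t => _) = (fun t => limn (einfs (fun n => (S n t)%:E)))); last first.
      by apply/funext => t; rewrite limn_einf_lim.
    apply: (emeasurable_fun_cvg (fun n t => einfs (fun k => (S k t)%:E) n)).
    - by move=> n; exact: measurable_fun_einfs.
    - by move=> t _; exact: is_cvg_einfs.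
apply: (@le_trans _ _ (limn_einf (fun n => \int[mu]_(t in D) (S n t)%:E)%E)).
  by apply: fatou => // n t _; rewrite lee_fin.
exact: limn_einf_le.
Qed.

(** The cells are closed and overlap at their ends, which is harmless for an upper bound. The index
    r = m serves only t = 1, where the truncation of m t equals m. *)
Definition step (m : nat) (w : nat -> R) (t : R) : R :=
  \sum_(r < m.+1) w r * \1_(`[r%:R / m%:R, r.+1%:R / m%:R]%classic) t.

Lemma measurable_step m w : measurable_fun (setT : set RT) (step m w).
Proof.
apply: measurable_sum => r; apply: measurable_funM => //.
Qed.

Lemma step_ge m w t : (0 < m)%N -> (forall r, 0 <= w r) -> 0 <= t <= 1 ->
  w (Num.truncn (m%:R * t)) <= step m w t.
Proof.
move=> m0 w0 /andP[t0 t1]; have mp : 0 < m%:R :> R by rewrite ltr0n.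
have mt : 0 <= m%:R * t by rewrite mulr_ge0.
set r := Num.truncn _.
have rm : (r < m.+1)%N.
  rewrite /r ltnS truncn_le_nat; apply: (@le_lt_trans _ _ m%:R); last by rewrite ltr_nat.
  by rewrite ler_piMr.
rewrite /step (bigD1 (Ordinal rm))//= indicE mem_set; last first.
  rewrite /= in_itv /= ler_pdivrMr// ler_pdivlMr// mulrC.
  by have /andP[-> /ltW] := truncn_itv mt.
by rewrite mulr1 lerDl; apply: sumr_ge0 => i _; rewrite mulr_ge0.
Qed.

Lemma step_ge0 m w t : (forall r, 0 <= w r) -> 0 <= step m w t.
Proof. by move=> w0; apply: sumr_ge0 => i _; rewrite mulr_ge0. Qed.

Lemma integral_step_le m w : (0 < m)%N -> (forall r, 0 <= w r) ->
  (\int[mu]_(t in `[0%R, 1%R]) (step m w t)%:E <= (m%:R^-1 * \sum_(r < m.+1) w r)%:E)%E.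
Proof.
move=> m0 w0; have mp : 0 < m%:R :> R by rewrite ltr0n.
pose E r : set RT := `[r%:R / m%:R, r.+1%:R / m%:R]%classic.
have mE r : measurable (E r) by exact: measurable_itv.
pose D : set RT := `[0%R, 1%R]%classic.
have mD : measurable D by exact: measurable_itv.
have -> : (\int[mu]_(t in D) (step m w t)%:E =
    \int[mu]_(t in D) \sum_(r < m.+1) ((w r)%:E * (\1_(E r) t)%:E))%E.
  by apply: eq_integral => t _; rewrite /step -sumEFin.
have mI (r : nat) : measurable_fun D (fun t => (\1_(E r) t)%:E : \bar R).
  by apply/measurable_EFinP; exact: measurable_indic.
rewrite ge0_integral_sum; [|exact: mD|by move=> r; apply: measurable_funeM; exact: mI|]; last first.
  by move=> r t _; rewrite mule_ge0 ?lee_fin.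
rewrite mulr_sumr -sumEFin; apply: lee_sum => r _.
rewrite ge0_integralZl//; last by rewrite lee_fin.
rewrite integral_indic// mulrC EFinM; apply: lee_wpmul2l; first by rewrite lee_fin.
apply: (@le_trans _ _ (mu (E r))).
  by apply: le_measure; rewrite ?inE//; exact: measurableI.
rewrite /E lebesgue_measure_itv /= lte_fin ltr_pM2r ?invr_gt0// ltr_nat ltnSn.
by rewrite -EFinB lee_fin -mulrBl -natrB// subSnn mul1r.
Qed.

End StepFunctions.

(** * Assembly of the maximal estimate *)

Section Assembly.
Context (R : realType).
Notation mu := (@lebesgue_measure R).
Notation RT := (measurableTypeR R).
Notation T := (@torus_itv R).

(** The torus has positive measure, so an essential supremum of a nonnegative function cannot drop
    below 0. *)
Lemma torus_ae_False n : ~ torus_ae (fun _ : n.-tuple R => False).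
Proof.
elim: n => [//|n IH] [A [mA A0 TA]].
have TsA : T `<=` A by move=> y Ty; apply: TA => /= h; exact: IH (h Ty).
have : (mu T <= mu A)%E by apply: le_measure; rewrite ?inE//; exact: measurable_torus_itv.
rewrite A0 /torus_itv lebesgue_measure_itv /= lte_fin pi2_gt0 leNgt => /negP; apply.
by rewrite -EFinB subr0 lte_fin pi2_gt0.
Qed.

Lemma torus_esssup_ge0 n (g : n.-tuple R -> R) : (forall x, 0 <= g x) ->
  (0 <= torus_esssup g)%E.
Proof.
move=> g0; apply: le_ereal_inf_tmp => M /= gM; rewrite leNgt; apply/negP => M0.
apply: (@torus_ae_False n); move: gM; congr torus_ae.
apply/funext => x; apply/propext; split => // /(fun h => le_lt_trans h M0).
by rewrite lte_fin ltNge g0.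
Qed.

Section Propagator.
Context (d : nat) (alpha gamma : R) (cr ci : d.-tuple int -> R) (ur ui : R -> d.-tuple R -> R).
Hypothesis hu : is_propagator alpha cr ci ur ui.

Lemma propagator_field t : 0 <= t <= 1 -> torus_field (ur t) (ui t).
Proof.
move=> /hu[mr mi fi _]; split => //; split.
  rewrite /cmod; apply: (@measurableT_comp _ _ _ _ RT RT (@Num.sqrt R) _ (fun x => ur t x ^+ 2 + ui t x ^+ 2)); first by apply: continuous_measurable_fun; exact: sqrt_continuous.
  by apply: measurable_funD; apply: measurable_funX.
apply: le_lt_trans fi; rewrite le_eqVlt; apply/orP; left; apply/eqP.
by congr torus_int_nneg; apply/funext => x; rewrite ger0_norm// sqrtr_ge0.
Qed.

Lemma propagator_coef t k b : 0 <= t <= 1 ->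
  torus_coef (ur t) (ui t) k b =
  cr k * cos (b - normk R k `^ alpha * t) - ci k * sin (b - normk R k `^ alpha * t).
Proof.
move=> t01; rewrite torus_coefE; last exact: propagator_field.
have [_ _ _ /(_ k) /= [-> ->]] := hu t01.
rewrite cosB sinB; ring.
Qed.

(** A bound for arbitrarily large J is all that a lower limit provides. It suffices because, for
    given nodes, one such J exceeds all degrees and J < 2^J. *)
Lemma torus_esssup_le t M : 0 <= t <= 1 ->
  (forall J0, exists2 J, (J0 <= J)%N & forall b x, packet alpha J cr ci b t x <= M) ->
  (torus_esssup (fun x => cmod (ur t x) (ui t x)) <= M%:E)%E.
Proof.
move=> t01 HM; apply: ereal_inf_lbound => /=.
have h := propagator_field t01.
have -> : (fun x => ((cmod (ur t x) (ui t x))%:E <= M%:E)%E : Prop) =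
    (fun x => cmod (ur t x) (ui t x) <= M).
  by apply/funext => x; rewrite lee_fin.
apply: (torus_ae_cmod_le h) => z b.
have [J hJ hM] := HM (\max_(w <- z) w.1)%N.
apply: (@fejer_le _ _ _ J).
- by move=> k; exact: sinusoid_torus_coef.
- move=> b' x; apply: le_trans (hM b' x); rewrite /packet; apply: ler_sum => k _.
  rewrite propagator_coef// /wave.
  by rewrite (_ : b' + dotk k x - normk R k `^ alpha * t = dotk k x - normk R k `^ alpha * t + b')//; ring.
- rewrite /rat_nodes all_map; apply/allP => w wz /=.
  apply: leq_ltn_trans (ltn_expl J (ltnSn 1)); apply: leq_trans hJ.
  by rewrite (big_rem w wz) leq_maxl.
Qed.

End Propagator.

Lemma Hnorm2_ge0 d (gamma : R) (cr ci : d.-tuple int -> R) : (0 <= Hnorm2 gamma cr ci)%E.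
Proof.
apply: esum_ge0 => k _; rewrite lee_fin mulr_ge0 ?powR_ge0//.
by rewrite addr_ge0 ?sqr_ge0.
Qed.

Lemma levels_weight_le_Hnorm2 d (gamma : R) (cr ci : d.-tuple int -> R) J : 0 <= gamma ->
  (Hnorm2 gamma cr ci < +oo)%E ->
  \sum_(q <- levels d J) level_weight gamma q.1 * (cr q.2 ^+ 2 + ci q.2 ^+ 2) <=
    fine (Hnorm2 gamma cr ci).
Proof.
move=> g0 Hoo.
pose G k := (1 + normk2 R k) `^ gamma * (cr k ^+ 2 + ci k ^+ 2).
apply: (@le_trans _ _ (\sum_(k <- cube d J) G k)).
  rewrite -sum_levels big_seq [leRHS]big_seq; apply: ler_sum => q ql.
  apply: ler_wpM2r; first by rewrite addr_ge0 ?sqr_ge0.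
  rewrite /level_weight; exact: (levels_weight g0 ql).
rewrite -lee_fin fineK ?ge0_fin_numE ?Hnorm2_ge0//.
apply: esum_ge; exists [set` cube d J].
  by split => //; exact: finite_seq.
by rewrite -fsbig_seq ?cube_uniq// sumEFin.
Qed.

Definition maximal_estimate d (alpha gamma : R) (q : \bar R) : Prop :=
  exists C : R, 0 < C /\
    forall cr ci : d.-tuple int -> R, (Hnorm2 gamma cr ci < +oo)%E ->
      forall ur ui : R -> d.-tuple R -> R, is_propagator alpha cr ci ur ui ->
        (Lnorm (@mu01 R) q (fun t => torus_esssup (fun x => cmod (ur t x) (ui t x)))
         <= (C * Hnorm gamma cr ci)%:E)%E.

Lemma Lnorm_propagator_le d (alpha gamma p theta C : R) :
  1 <= p -> 0 <= theta -> theta * p < 1 -> 0 < C -> 0 <= gamma ->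
  (forall J beta t (x : d.-tuple R), 0 < t <= 1 ->
    `|kernel alpha gamma J beta t x| <= C * t `^ (- theta)) ->
  maximal_estimate d alpha gamma (2 * p)%:E.
Proof.
move=> p1 th0 thp C0 g0 HK.
have p0 : 0 < p by lra.
have pp : 0 < 2 * p by lra.
have [D D0 HD] := packet_strichartz p1 th0 thp C0 HK.
exists (D `^ (2 * p)^-1); split; first exact: powR_gt0.
move=> cr ci Hoo ur ui hu; set F := fine (Hnorm2 gamma cr ci).
have F0 : 0 <= F by rewrite fine_ge0// Hnorm2_ge0.
have /choice[mc Hmc] : forall J, exists q : nat * (nat -> R), [/\ (0 < q.1)%N, forall i, 0 <= q.2 i,
      forall beta t x, 0 <= t <= 1 -> packet alpha J cr ci beta t x <= q.2 (Num.truncn (q.1%:R * t)) &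
      q.1%:R^-1 * \sum_(r < q.1.+1) (q.2 r) `^ (2 * p) <= D * F `^ p].
  move=> J; have [m [c H]] := HD J cr ci F F0 (levels_weight_le_Hnorm2 J g0 Hoo).
  by exists (m, c).
pose g t := torus_esssup (fun x => cmod (ur t x) (ui t x)).
have gg0 t : (0 <= g t)%E by apply: torus_esssup_ge0 => x; exact: sqrtr_ge0.
pose S J t := step (mc J).1 (fun i => (mc J).2 i `^ (2 * p)) t.
have S0 J t : 0 <= S J t by apply: step_ge0 => r; exact: powR_ge0.
have gS t : 0 <= t <= 1 -> (`|g t| `^ (2 * p) <= limn_einf (fun J => (S J t)%:E))%E.
  move=> t01.
  (* A number strictly above the lower limit exceeds [S J t] for arbitrarily large J, as
     [torus_esssup_le] asks. *)
  have key (l : R) : (limn_einf (fun J => (S J t)%:E) < l%:E)%E -> (`|g t| `^ (2 * p) <= l%:E)%E.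
    move=> ll; have [k _ ] := limn_einf_lt 0 ll; rewrite lte_fin => Skl.
    have l0 : 0 < l by exact: le_lt_trans (S0 k t) Skl.
    have gl : (g t <= (l `^ (2 * p)^-1)%:E)%E.
      apply: (torus_esssup_le hu t01) => J0.
      have [J J0J SJ] := limn_einf_lt J0 ll; exists J => // b x.
      have [m0 c0 Hp _] := Hmc J; apply: le_trans (Hp b t x t01) _.
      have := @step_ge R (mc J).1 (fun i => (mc J).2 i `^ (2 * p)) t m0 (fun r => powR_ge0 _ _) t01.
      set c := (mc J).2 _ => hc.
      have cc0 : 0 <= c by exact: c0.
      have -> : c = (c `^ (2 * p)) `^ (2 * p)^-1 by rewrite -powRrM mulfV ?lt0r_neq0// powRr1.
      apply: ge0_ler_powR; rewrite ?nnegrE ?powR_ge0 ?invr_ge0 ?(ltW pp) ?(ltW l0)//.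
      apply: le_trans hc _; apply: ltW; by rewrite -lte_fin.
    rewrite gee0_abs//.
    apply: le_trans (gt0_ler_poweR (ltW pp) _ _ gl) _.
    - by rewrite in_itv /= gg0 leey.
    - by rewrite in_itv /= lee_fin powR_ge0 leey.
    - by rewrite poweR_EFin -powRrM mulVf ?gt_eqF// powRr1// ltW.
  case E : (limn_einf _) => [l| |]; last 2 first.
  - exact: leey.
  - have lNy : (limn_einf (fun J => (S J t)%:E) < 0%:E)%E by rewrite E ltNyr.
    by have [k _] := limn_einf_lt 0 lNy; rewrite lte_fin ltNge S0.
  apply/lee_addgt0Pr => e e0; apply: key; by rewrite E lte_fin ltrDl.
rewrite unlock.
have intle : (\int[@mu01 R]_t `|g t| `^ (2 * p) <= (D * F `^ p)%:E)%E.
  apply: (@integral_mu01_liminf_le _ _ S) => //.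
  - by move=> t; exact: poweR_ge0.
  - by move=> J; exact: measurable_step.
  - move=> J; have [m0 c0 _ HS] := Hmc J.
    by apply: le_trans (integral_step_le m0 _) _ => [r|]; [exact: powR_ge0|rewrite lee_fin].
apply: le_trans (gt0_ler_poweR _ _ _ intle) _.
- by rewrite invr_ge0 ltW.
- by rewrite in_itv /= leey andbT; apply: integral_ge0 => t _; exact: poweR_ge0.
- by rewrite in_itv /= leey andbT lee_fin mulr_ge0 ?powR_ge0// ltW.
rewrite poweR_EFin lee_fin powRM ?powR_ge0 ?(ltW D0)// -powRrM /Hnorm -/F.
rewrite (_ : p * (2 * p)^-1 = 2^-1); last by field; rewrite gt_eqF.
by rewrite powR12_sqrt.
Qed.

(** At a fixed time the duality argument with a single test point suffices, because the kernel is
    bounded also at t = 0. *)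
Lemma Linfty_propagator_le d (alpha gamma : R) : 0 <= gamma -> d%:R < 2 * gamma ->
  maximal_estimate d alpha gamma +oo%E.
Proof.
move=> g0 dg; have [C C0 HC] := kernel_bound_trivial alpha dg.
exists (Num.sqrt C); split; first by rewrite sqrtr_gt0.
move=> cr ci Hoo ur ui hu; set F := fine (Hnorm2 gamma cr ci).
have F0 : 0 <= F by rewrite fine_ge0// Hnorm2_ge0.
have CH0 : 0 <= Num.sqrt C * Hnorm gamma cr ci by rewrite mulr_ge0 ?sqrtr_ge0.
have gle t : 0 <= t <= 1 ->
    (torus_esssup (fun x => cmod (ur t x) (ui t x)) <= (Num.sqrt C * Hnorm gamma cr ci)%:E)%E.
  move=> t01; apply: (torus_esssup_le hu t01) => J0; exists J0 => // b x.
  apply: le_trans (ler_norm _) _.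
  rewrite -(@ler_pXn2r _ 2)// ?nnegrE// real_normK ?num_real// /Hnorm -/F exprMn !sqr_sqrtr ?(ltW C0)//.
  apply: le_trans (@packet_sq_le R d alpha gamma J0 cr ci F b t x (levels_weight_le_Hnorm2 J0 g0 Hoo)) _.
  by rewrite mulrC; apply: ler_wpM2r.
rewrite unlock; case: ifP => _; last by rewrite lee_fin.
rewrite ess_supEae; apply: ereal_inf_lbound => /=.
pose D : set RT := `[0%R, 1%R]%classic.
have mD : measurable D by exact: measurable_itv.
exists (~` D); split; first exact: measurableC.
  by rewrite /mu01 /mrestr setICl measure0.
move=> t /= h D01; apply: h; rewrite gee0_abs; last first.
  by apply: torus_esssup_ge0 => x; exact: sqrtr_ge0.
by apply: gle; move: D01; rewrite /D /= in_itv.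
Qed.

End Assembly.

Theorem theorem1p1 (R : realType) (d : nat) (p : \bar R) (alpha gamma : R) :
  (2 <= d)%N -> (1 <= p)%E ->
  ((1 < alpha /\ gamma_ap d alpha p / 2 < gamma) \/
   ((0 < alpha < 1) /\ ell_ap d alpha p / 2 < gamma)) ->
  exists C : R, 0 < C /\
    forall cr ci : d.-tuple int -> R,
      (Hnorm2 gamma cr ci < +oo)%E ->
      forall ur ui : R -> d.-tuple R -> R,
        is_propagator alpha cr ci ur ui ->
        (Lnorm (@mu01 R) (2%:E * p)%E
           (fun t => torus_esssup (fun x => cmod (ur t x) (ui t x)))
         <= (C * Hnorm gamma cr ci)%:E)%E.
Proof.
rewrite -/(maximal_estimate d alpha gamma (2%:E * p)).
move=> d2 + H; have d2R : 2 <= d%:R :> R by rewrite (ler_nat R 2 d).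
case: p H => [p| |] H; last by [].
- rewrite lee_fin => p1; have p0 : 0 < p by lra.
  rewrite -EFinM.
  have app : alpha / p * p = alpha by rewrite divfK// gt_eqF.
  (* For alpha < 2 both exponents of the shell bound have to lie below 2 gamma. *)
  have dispersive : 0 < alpha < 2 -> alpha != 1 ->
      d%:R * alpha / 2 < 2 * gamma -> d%:R - alpha / p < 2 * gamma ->
      maximal_estimate d alpha gamma (2 * p)%:E.
    move=> al al1 g1 g2.
    have [theta [C [th0 thp C0 HK]]] := kernel_bound d2 p1 al al1 g1 g2.
    apply: Lnorm_propagator_le p1 th0 thp C0 _ HK.
    have /andP[a0 _] := al; have : 0 <= d%:R * alpha / 2 by rewrite !mulr_ge0 ?(ltW a0)//.
    lra.
  case: H => [[a1]|[/andP[a0 a1]]]; last first.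
    rewrite /ell_ap /= => hg.
    have ap0 : 0 < alpha / p by exact: divr_gt0.
    have ap1 : alpha / p <= alpha by rewrite ler_pdivrMr// ler_peMr// ltW.
    apply: dispersive; [lra|by rewrite lt_eqF| |lra].
    (* For alpha < 1 and d >= 2 one has d - alpha / p > d - 1 >= d / 2 > d alpha / 2, so the first
       exponent dominates. *)
    have : d%:R * alpha <= d%:R * 1 by apply: ler_wpM2l; [lra|exact: ltW].
    lra.
  have a0 : 0 < alpha by lra.
  rewrite /gamma_ap; have [a2|a2] := leP 2 alpha.
    rewrite orTb => hg.
    (* Here gamma > d alpha / 4 >= d / 2, so the kernel is bounded and theta = 0 serves every p. *)
    have dg : d%:R < 2 * gamma.
      have : d%:R * 2 <= d%:R * alpha by apply: ler_wpM2l => //; lra.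
      lra.
    have [C C0 HC] := kernel_bound_trivial alpha dg.
    apply: (@Lnorm_propagator_le _ _ _ _ p 0 C) => //; [by rewrite mul0r|lra|].
    by move=> J beta t x _; rewrite oppr0 powRr0 mulr1; exact: HC.
  rewrite orFb a1 /= -EFinM lee_fin => hg.
  have a2' : 0 < 2 - alpha by lra.
  (* The condition in [gamma_ap] compares d alpha / 2 with d - alpha / p, so [gamma_ap] is the
     larger of the two. *)
  have hE : (p * d%:R <= 2 * alpha / (2 - alpha)) = (d%:R * (2 - alpha) <= 2 * (alpha / p)).
    rewrite ler_pdivlMr// -(ler_pM2l p0 (d%:R * _)) mulrA; congr (_ <= _).
    by rewrite -[in LHS]app; ring.
  rewrite hE in hg; apply: dispersive; [lra|by rewrite gt_eqF|..];
    by move: hg; case: (leP (d%:R * (2 - alpha))) => hh hg; lra.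
- move=> _; rewrite gt0_muley ?lte_fin//.
  case: H => [[a1]|[/andP[a0 a1]]].
    rewrite /gamma_ap gt0_mulye ?lte_fin ?ltr0n; last by lia.
    (* For infinite p the comparison fails, so [gamma_ap] is d when 1 < alpha < 2. *)
    rewrite leye_eq /= andbF orbF; case: ifP => [a2|_] hg.
      have : d%:R * 2 <= d%:R * alpha by apply: ler_wpM2l => //; lra.
      by move=> h; apply: Linfty_propagator_le; lra.
    by apply: Linfty_propagator_le; lra.
  rewrite /ell_ap /= => hg.
  by apply: Linfty_propagator_le; lra.
Qed.
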